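(* Let $\Gamma$ be a standard graph which is a tree all of whose vertices have degree $3$ or $1$, and assume its edge lengths are rationally independent. Then the random variable $-\omega-1$ (with respect to $d_{\mathcal G}$) has binomial distribution $\mathrm{Bin}(|\partial\Gamma|-2,\tfrac12)$; explicitly, for every integer $-|\partial\Gamma|+1\le j\le -1$, $$\mathbb P(\omega=j)=\binom{|\partial\Gamma|-2}{-j-1}2^{2-|\partial\Gamma|}.$$
   Context: A standard graph is a connected metric graph with finitely many vertices and edges, no degree-two vertices, edges $[0,l_e]$, with the Laplacian $-d^2/dx^2$ and Neumann (Kirchhoff) vertex conditions (continuity and vanishing sum of outgoing derivatives). Eigenvalues $0=\lambda_0<\lambda_1\le\dots$ with multiplicity and a fixed real orthonormal eigenbasis $\{f_n\}$. $\partial\Gamma$ = set of degree-one vertices. An eigenfunction is generic if its eigenvalue is simple, it does not vanish at vertices, and its outgoing derivatives at vertices not in $\partial\Gamma$ do not vanish. $\mathcal G=\{n: f_n\text{ generic}\}$. Neumann count $\xi(f)$ = number of points in interiors of edges where $f'=0$; Neumann surplus $\omega(n)=\xi(f_n)-n$ for $n\in\mathcal G$. Rationally independent = linearly independent over $\mathbb Q$. For $A\subset\mathcal G$, $d_{\mathcal G}(A)=\lim_N|A\cap\{0..N\}|/|\mathcal G\cap\{0..N\}|$; $\mathbb P(\omega=j):=d_{\mathcal G}(\omega^{-1}(j))$, and $\omega$ is a random variable with respect to $d_{\mathcal G}$ (all $d_{\mathcal G}(\omega^{-1}(B))$ exist and form a probability measure). *)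

(* Defs.v *)
From HB Require Import structures.
From mathcomp Require Import all_boot all_order all_algebra.
From mathcomp Require Import all_classical all_reals all_analysis.

Set Implicit Arguments.
Unset Strict Implicit.
Unset Printing Implicit Defensive.

Import Order.TTheory GRing.Theory Num.Theory.
Local Open Scope ring_scope.

(* A metric graph: finite vertex set V, finite edge set E, edge e is the
   interval [0, len e] with 0 glued to vertex [src e] and [len e] glued to
   vertex [tgt e].  A function on the graph is a family [f : E -> R -> R]
   (f e is the function on edge e; only its values on [0, len e] matter for
   vertex conditions, zeros, linear (in)dependence and Neumann counts).     *)

Section QG.
Variables (R : realType) (V E : finType) (src tgt : E -> V) (len : E -> R).

Definition deg (v : V) : nat :=
  #|[set e | src e == v]| + #|[set e | tgt e == v]|.

Definition bdry : {set V} := [set v | deg v == 1%N].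

Definition adj : rel V := fun u v =>
  [exists e, ((src e == u) && (tgt e == v)) || ((src e == v) && (tgt e == u))].

Definition connected_graph : Prop := forall u v : V, connect adj u v.

Definition is_tree : Prop := connected_graph /\ (#|E|.+1 = #|V|)%N.

Definition rat_indep : Prop :=
  forall q : E -> rat, \sum_(e : E) ratr (q e) * len e = 0 -> forall e, q e = 0.

(* f is a (possibly zero) solution of -f'' = lam f on every edge with
   Neumann-Kirchhoff vertex conditions *)
Definition is_eigsol (lam : R) (f : E -> R -> R) : Prop :=
  (forall e x, derivable (f e) x 1 /\ derivable (derive1 (f e)) x 1 /\
               derive1 (derive1 (f e)) x = - lam * f e x) /\
  (exists g : V -> R, forall e, f e 0 = g (src e) /\ f e (len e) = g (tgt e)) /\
  (forall v : V, \sum_(e | src e == v) derive1 (f e) 0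
                 - \sum_(e | tgt e == v) derive1 (f e) (len e) = 0).

Definition lin_indep (k : nat) (F : 'I_k -> E -> R -> R) : Prop :=
  forall c : 'I_k -> R,
    (forall e x, 0 <= x <= len e -> \sum_(i < k) c i * F i e x = 0) ->
    forall i, c i = 0.

Definition indep_eig (S : R -> Prop) (k : nat) : Prop :=
  exists F : 'I_k -> E -> R -> R,
    (forall i, exists mu, S mu /\ is_eigsol mu (F i)) /\ lin_indep F.

Definition simple_eig (lam : R) : Prop :=
  indep_eig (fun mu => mu = lam) 1 /\ ~ indep_eig (fun mu => mu = lam) 2.

(* the number of eigenvalues strictly below lam, counted with
   multiplicity, is n *)
Definition count_below (lam : R) (n : nat) : Prop :=
  indep_eig (fun mu => mu < lam) n /\ ~ indep_eig (fun mu => mu < lam) n.+1.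

Definition generic_eig (n : nat) (f : E -> R -> R) : Prop :=
  exists lam : R,
    simple_eig lam /\ count_below lam n /\ is_eigsol lam f /\
    (forall e, f e 0 != 0 /\ f e (len e) != 0) /\
    (forall e, src e \notin bdry -> derive1 (f e) 0 != 0) /\
    (forall e, tgt e \notin bdry -> derive1 (f e) (len e) != 0).

Definition inG (n : nat) : Prop := exists f, generic_eig n f.

Definition neumann_count (f : E -> R -> R) (k : nat) : Prop :=
  exists s : seq (E * R), uniq s /\ size s = k /\
    forall p : E * R,
      (p \in s) <-> (0 < p.2 < len p.1 /\ derive1 (f p.1) p.2 = 0).

Definition omega_is (n : nat) (j : int) : Prop :=
  exists f k, generic_eig n f /\ neumann_count f k /\ (k%:Z - n%:Z = j)%R.

End QG.

Definition cnt (P : nat -> Prop) (N : nat) : nat :=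
  (\sum_(i < N.+1) `[< P i >])%N.

Definition dens_ratio (R : realType) (A G : nat -> Prop) (N : nat) : R :=
  (cnt A N)%:R / (cnt G N)%:R.

(* Main.v *)
(* Root the tree at a leaf.  At frequency k the Kirchhoff solutions on the
   branch hanging from an edge are described by a phase: k * len at a leaf edge,
   and k * len + atan (tan x + tan y) when the two branches further away have
   phases x and y.  Then k ^ 2 is an eigenvalue with an eigenfunction that does
   not vanish at the vertices iff the phase at the root lies in pi Z.  Writing
   X = tan x and Y = tan y at an inner vertex, the Neumann surplus is
   omega = - 1 - #{inner vertices with X * Y * (X + Y) < 0}.

   Along an arithmetic progression of frequencies the vector of all phases is
   equidistributed modulo pi: for k * len this is Weyl's theorem, and adding a
   function of two coordinates to a third one is a measure preserving shear.
   The reflection (X, Y) -> (- X, - Y) flips the sign of X * Y * (X + Y) and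
   keeps the derivatives of atan (X + Y), hence the speed of the root phase, so
   every one of the 2 ^ m sign patterns (m inner vertices) receives at least the
   share 2 ^ - m of the hits of the root phase on pi Z.

   The label n of such an eigenvalue is the number of zeros of its eigenfunction:
   subdividing the edges turns the counting function into the index of a
   quadratic form, and relative to a nowhere vanishing kernel vector this index
   is the number of sign changes.  The zeros number k * (total length) / pi + O(1),
   so the lower bounds for the m + 1 values of omega have sum 1 and are limits. *)
Require Import Defs.
From HB Require Import structures.
From mathcomp Require Import all_boot all_order all_algebra.
From mathcomp Require Import all_classical all_reals all_analysis.
From mathcomp Require Import ring lra zify.
Import Order.TTheory GRing.Theory Num.Theory numFieldNormedType.Exports.
Set Implicit Arguments.
Unset Strict Implicit.
Unset Printing Implicit Defensive.
Local Open Scope classical_set_scope.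
Local Open Scope ring_scope.

(** * Weyl equidistribution and shears *)

Section Means.
Variable R : realType.
Implicit Types (f g : nat -> R) (c d : R).

(** For fixed y, [join_phase] grows by pi while x runs from - pi / 2 to pi / 2, so its partial
    derivatives have mean 1 and the mean speed of the root phase is the total length L. With
    frequency steps of size d, a given sign pattern is hit at the rate 2 ^ - m * d * L / pi per
    step, while the labels grow by d * L / pi per step. The shares of the patterns thus add up to 1
    with nothing to spare, so cells near the poles of the tangent can be discarded, and it is enough
    to count the eigenvalues that are constructed.

    Sampling sees a crossing of pi Z only indirectly: the root phase lies below a multiple of pi by
    at most what it is sure to travel before the next sample. That distance depends on all other
    phases; hence the cells, on which the speed has a constant lower bound, with one arc for the
    root phase per cell.

    The step d must not be resonant with the edge lengths; rational independence leaves only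
    countably many resonant d.

    Labels are defined by independent families of eigenfunctions; the index of a finite form,
    followed continuously in the frequency, makes them computable. *)

Definition upper_mean f c := forall eta : R, 0 < eta ->
  exists J0 : nat, forall J : nat, (J0 <= J)%N ->
  \sum_(0 <= j < J) f j <= (c + eta) * J%:R.

Definition null_mean f := forall eta : R, 0 < eta ->
  exists J0 : nat, forall J : nat, (J0 <= J)%N ->
  `|\sum_(0 <= j < J) f j| <= eta * J%:R.

Lemma null_mean_ext f g : (forall j, f j = g j) -> null_mean f -> null_mean g.
Proof. by move=> fg; rewrite (_ : g = f) //; apply/funext. Qed.

Lemma null_meanD f g : null_mean f -> null_mean g -> null_mean (fun j => f j + g j).
Proof.
move=> hf hg e e0; have e2 : 0 < e / 2 by lra.
have [J1 h1] := hf _ e2; have [J2 h2] := hg _ e2.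
exists (maxn J1 J2) => J; rewrite geq_max => /andP[/h1 a1 /h2 a2].
rewrite big_split /=; apply: (le_trans (ler_normD _ _)); lra.
Qed.

Lemma null_mean0 : null_mean (fun=> 0).
Proof.
move=> e e0; exists 0%N => J _.
by rewrite big1 // normr0 mulr_ge0 // ltW.
Qed.

Lemma null_meanZ a f : null_mean f -> null_mean (fun j => a * f j).
Proof.
move=> hf e e0; have a1 : 0 < `|a| + 1 by rewrite ltr_wpDl.
have [J0 h] := hf _ (divr_gt0 e0 a1); exists J0 => J /h {}h.
rewrite -mulr_sumr normrM.
apply: (@le_trans _ _ ((`|a| + 1) * `|\sum_(0 <= j < J) f j|)).
  by rewrite ler_wpM2r // lerDl.
rewrite mulrC -ler_pdivlMr //; apply: (le_trans h).
by rewrite mulrAC.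
Qed.

Lemma null_mean_sum (I : eqType) (r : seq I) (F : I -> nat -> R) :
  (forall i, i \in r -> null_mean (F i)) -> null_mean (fun j => \sum_(i <- r) F i j).
Proof.
elim: r => [|i r IH] h.
  by apply: (null_mean_ext _ null_mean0) => j; rewrite big_nil.
apply: (@null_mean_ext (fun j => F i j + \sum_(i <- r) F i j)) => [j|].
  by rewrite big_cons.
apply: null_meanD; first by apply: h; rewrite mem_head.
by apply: IH => k kr; apply: h; rewrite in_cons kr orbT.
Qed.

Lemma upper_mean_null_mean f c : null_mean (fun j => f j - c) -> upper_mean f c.
Proof.
move=> h e e0; have [J0 {}h] := h _ e0; exists J0 => J /h.
rewrite big_split /= sumr_const_nat subn0 mulNrn -[c *+ J]mulr_natr => h1.
have := ler_norm (\sum_(0 <= j < J) f j - c * J%:R); lra.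
Qed.

Lemma upper_meanD f g c d : upper_mean f c -> upper_mean g d -> upper_mean (fun j => f j + g j) (c + d).
Proof.
move=> hf hg e e0; have e2 : 0 < e / 2 by lra.
have [J1 h1] := hf _ e2; have [J2 h2] := hg _ e2.
exists (maxn J1 J2) => J; rewrite geq_max => /andP[/h1 a1 /h2 a2].
rewrite big_split /=; lra.
Qed.

Lemma upper_mean_le f g c d : (forall j, f j <= g j) -> c <= d -> upper_mean g c -> upper_mean f d.
Proof.
move=> fg cd hg e e0; have [J0 h] := hg _ e0; exists J0 => J /h {}h.
apply: (le_trans (ler_sum _ (fun i _ => fg i))); apply: (le_trans h).
by rewrite ler_wpM2r // lerD2r.
Qed.

Lemma upper_mean0 : upper_mean (fun=> 0) 0.
Proof. by move=> e e0; exists 0%N => J _; rewrite big1 // mulr_ge0 // add0r ltW. Qed.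

Lemma upper_mean_sum (I : Type) (r : seq I) (P : pred I) (F : I -> nat -> R) (c : I -> R) :
  (forall i, P i -> upper_mean (F i) (c i)) ->
  upper_mean (fun j => \sum_(i <- r | P i) F i j) (\sum_(i <- r | P i) c i).
Proof.
move=> h; elim: r => [|i r IH].
  by apply: (upper_mean_le _ _ upper_mean0) => [j|]; rewrite big_nil.
rewrite big_cons; have [Pi|nPi] := boolP (P i).
  by apply: (upper_mean_le _ _ (upper_meanD (h i Pi) IH)) => // j; rewrite big_cons Pi.
by apply: (upper_mean_le _ _ IH) => // j; rewrite big_cons (negbTE nPi).
Qed.

Lemma upper_mean_closed f c : (forall e : R, 0 < e -> upper_mean f (c + e)) -> upper_mean f c.
Proof.
move=> h e e0; have e2 : 0 < e / 2 by lra.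
have [J0 {}h] := h _ e2 _ e2; exists J0 => J /h; by rewrite -addrA -splitr.
Qed.

End Means.

(** * Multiples of pi, and sums of cosines along a progression *)

Section Trig.
Variable R : realType.
Local Notation pi := (@pi R).

(** The sign is (-1) ^ z, recorded only through [s * s = 1]: zeros, tangents and products of two
    sines do not depend on the parity. *)
Lemma pi_shift (z : int) : exists s : R, [/\ s * s = 1,
  (forall x : R, sin (x + pi * z%:~R) = s * sin x) &
  (forall x : R, cos (x + pi * z%:~R) = s * cos x)].
Proof.
have inner_count (n : nat) : exists s : R, [/\ s * s = 1,
    (forall x : R, sin (x + pi * n%:R) = s * sin x) &
    (forall x : R, cos (x + pi * n%:R) = s * cos x)].
  elim: n => [|n [s [s1 hs hc]]].
    by exists 1; split => [|x|x]; rewrite ?mulr1 // mulr0 addr0 mul1r.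
  exists (- s); split; first by rewrite mulrNN.
    by move=> x; rewrite -natr1 mulrDr mulr1 addrA sinDpi hs mulNr.
  by move=> x; rewrite -natr1 mulrDr mulr1 addrA cosDpi hc mulNr.
case: z => n; have [s [s1 hs hc]] := inner_count n; first by exists s.
have {s s1 hs hc} [s [s1 hs hc]] := inner_count n.+1.
exists s; split => // x; rewrite NegzE mulrNz mulrN.
  by rewrite -[in RHS](subrK (pi * n.+1%:R) x) hs mulrA s1 mul1r.
by rewrite -[in RHS](subrK (pi * n.+1%:R) x) hc mulrA s1 mul1r.
Qed.

Lemma sin_pi_eq0 (x : R) : sin (pi * x) = 0 -> exists z : int, x = z%:~R.
Proof.
move=> h; exists (Num.floor x); apply/eqP; rewrite eq_sym eq_le floor_le /=.
rewrite leNgt; apply/negP => lx.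
have [s [s1 hs _]] := pi_shift (Num.floor x).
have := hs (pi * (x - (Num.floor x)%:~R)).
rewrite -mulrDr subrK h => /esym /eqP; rewrite mulf_eq0 => /orP[/eqP s0|].
  by move: s1; rewrite s0 mul0r => /eqP; rewrite eq_sym oner_eq0.
apply/negP; rewrite gt_eqF //; apply: sin_gt0_pi.
have := floorD1_gt x; rewrite intrD => h1.
rewrite mulr_gt0 ?subr_gt0 ?pi_gt0 //=.
by rewrite gtr_pMr ?pi_gt0 // ltrBlDl.
Qed.

Lemma tan_shift (z : int) (x : R) : tan (x + pi * z%:~R) = tan x.
Proof.
have [s [s1 hs hc]] := pi_shift z.
have s0 : s != 0 by apply: contra_eq_neq s1 => ->; rewrite mul0r eq_sym oner_eq0.
by rewrite /tan hs hc invfM mulrACA divff // mul1r.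
Qed.

Lemma cos_shift2 (z : int) (x : R) : cos (2 * pi * (x + z%:~R)) = cos (2 * pi * x).
Proof.
have [s [s1 _ hc]] := pi_shift z.
have -> : 2 * pi * (x + z%:~R) = 2 * pi * x + pi * z%:~R + pi * z%:~R by ring.
by rewrite !hc mulrA s1 mul1r.
Qed.

(** Each product 2 sin cos is a difference of two sines, so the sum telescopes; the factor stays on
    the left so that nothing is divided by a sine that may vanish. *)
Lemma cos_arith_sum (nu phi : R) J :
  2 * sin (pi * nu) * \sum_(0 <= j < J) cos (2 * pi * (j%:R * nu) + phi) =
  sin (2 * pi * (J%:R * nu) - pi * nu + phi) - sin (- (pi * nu) + phi).
Proof.
elim: J => [|J IH].
  by rewrite big_geq // mulr0 mul0r mulr0 add0r subrr.
rewrite big_nat_recr //= mulrDr IH.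
set a := 2 * pi * (J%:R * nu) + phi; set b := pi * nu.
have -> : 2 * pi * (J.+1%:R * nu) - b + phi = a + b.
  by rewrite /a /b -natr1; ring.
have -> : 2 * pi * (J%:R * nu) - b + phi = a - b by rewrite /a; ring.
by rewrite (sinD a b) (sinB a b); ring.
Qed.

(** The closed form bounds all partial sums by 1 / |sin (pi nu)|, which is finite because nu is not
    an integer. *)
Lemma null_mean_cos (nu phi : R) : (forall z : int, nu != z%:~R) ->
  null_mean (fun j => cos (2 * pi * (j%:R * nu) + phi)).
Proof.
move=> h e e0; have s0 : sin (pi * nu) != 0.
  by apply/eqP => /sin_pi_eq0[z /eqP]; apply/negP.
have s1 : 0 < `|sin (pi * nu)| by rewrite normr_gt0.
have [J0 hJ] : exists J0 : nat, (e * `|sin (pi * nu)|)^-1 < J0%:R.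
  exists (Num.bound ((e * `|sin (pi * nu)|)^-1)).
  by apply: archi_boundP; rewrite invr_ge0 mulr_ge0 // ltW.
exists J0 => J J0J; have := cos_arith_sum nu phi J.
set S := \sum_(_ <= _ < _) _ => /(congr1 Num.norm).
rewrite !normrM ger0_norm // => H.
have : 2 * `|sin (pi * nu)| * `|S| <= 2.
  rewrite H; apply: (le_trans (ler_normB _ _)).
  by rewrite -[2]/(1 + 1) lerD // sin_max.
rewrite -mulrA ger_pMr // => {}H.
have {hJ} : (e * `|sin (pi * nu)|)^-1 <= J%:R.
  by apply: ltW; apply: (lt_le_trans hJ); rewrite ler_nat.
rewrite -div1r ler_pdivrMr ?mulr_gt0 // => hJ.
rewrite -(ler_pM2l s1); apply: (le_trans H).
by apply: (le_trans hJ); rewrite le_eqVlt; apply/orP; left; apply/eqP; ring.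
Qed.

End Trig.

(** * Trigonometric polynomials above the indicator of an arc *)

Section Majorant.
Variable R : realType.
Local Notation pi := (@pi R).

Definition cospoly (N : nat) (f : R -> R) := exists d : nat -> R,
  forall x, f x = \sum_(0 <= n < N.+1) d n * cos (2 * pi * (n%:R * x)).

Lemma cospolyD N f g : cospoly N f -> cospoly N g -> cospoly N (fun x => f x + g x).
Proof.
move=> [d hd] [d' hd']; exists (fun n => d n + d' n) => x.
rewrite hd hd' -big_split /=; apply: eq_bigr => n _; ring.
Qed.

Lemma cospolyZ N a f : cospoly N f -> cospoly N (fun x => a * f x).
Proof.
move=> [d hd]; exists (fun n => a * d n) => x.
by rewrite hd mulr_sumr; apply: eq_bigr => n _; rewrite mulrA.
Qed.

Lemma cospoly_cos N n : (n <= N)%N -> cospoly N (fun x => cos (2 * pi * (n%:R * x))).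
Proof.
move=> nN; exists (fun m => (m == n)%:R) => x.
rewrite (bigD1_seq n) ?iota_uniq ?mem_index_iota //= eqxx mul1r.
by rewrite big1 ?addr0 // => m /negbTE ->; rewrite mul0r.
Qed.

Lemma cospoly_sum N (r : seq nat) (F : nat -> R -> R) :
  (forall n, n \in r -> cospoly N (F n)) -> cospoly N (fun x => \sum_(n <- r) F n x).
Proof.
elim: r => [|n r IH] h.
  exists (fun=> 0) => x; rewrite big_nil big1 // => m _; exact: mul0r.
have [d hd] : cospoly N (fun x => F n x + \sum_(n <- r) F n x).
  apply: cospolyD; first by apply: h; rewrite mem_head.
  by apply: IH => k kr; apply: h; rewrite in_cons kr orbT.
by exists d => x; rewrite big_cons hd.
Qed.

(** This is cos (pi x) ^ (2 N): nonnegative, of period 1, and concentrated at the integers when N is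
    large. *)
Definition kern N (x : R) : R := ((1 + cos (2 * pi * x)) / 2) ^+ N.

Lemma kern_cospoly N : cospoly N (kern N).
Proof.
elim: N => [|N [d hd]].
  exists (fun=> 1) => x; rewrite /kern expr0 big_nat1 mul0r mulr0 cos0 mulr1 //.
(* Multiplying by the cosine of frequency 1 sends n to n + 1 and n - 1; for n = 0 the frequency - 1
   is written as 1, cosine being even. *)
have [d' hd'] : cospoly N.+1 (fun x => \sum_(n <- index_iota 0 N.+1)
    (d n / 2 * cos (2 * pi * (n%:R * x)) +
     (d n / 4 * cos (2 * pi * (n.+1%:R * x)) +
     d n / 4 * cos (2 * pi * ((if n is m.+1 then m else 1%N)%:R * x))))).
  apply: cospoly_sum => n; rewrite mem_index_iota => /andP[_ nN].
  apply: cospolyD; first by apply: cospolyZ; apply: cospoly_cos; apply: ltnW.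
  by apply: cospolyD; apply: cospolyZ; apply: cospoly_cos => //; case: n nN => // n /ltnW /ltnW.
exists d' => x; rewrite -hd' /kern exprSr -/(kern N x) hd big_distrl /=.
apply: eq_bigr => n _; case: n => [|n].
  by rewrite mul0r mulr0 cos0 mul1r; field.
have -> : 2 * pi * (n.+2%:R * x) = 2 * pi * (n.+1%:R * x) + 2 * pi * x.
  by rewrite -(natr1 n.+1); ring.
have -> : 2 * pi * (n%:R * x) = 2 * pi * (n.+1%:R * x) - 2 * pi * x.
  by rewrite -(natr1 n); ring.
by rewrite cosD cosB; field.
Qed.

Lemma kern_ge0 N x : 0 <= kern N x.
Proof. by apply: exprn_ge0; have := cos_geN1 (2 * pi * x); lra. Qed.

(** The translates run over the T-th roots of unity, and the two sines of [cos_arith_sum] have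
    arguments that differ by 2 pi n. *)
Lemma cos_shift_sum (T n : nat) (x : R) : (0 < n < T)%N ->
  \sum_(0 <= t < T) cos (2 * pi * (n%:R * (x - t%:R / T%:R))) = 0.
Proof.
case/andP=> n0 nT; have T0 : (0 < T)%N by apply: leq_trans nT.
have TR : T%:R != 0 :> R by rewrite pnatr_eq0 -lt0n.
have := cos_arith_sum (- (n%:R / T%:R)) (2 * pi * (n%:R * x)) T.
rewrite (eq_bigr (fun t : nat => cos (2 * pi * (n%:R * (x - t%:R / T%:R))))); last first.
  by move=> t _; congr cos; field.
have -> : 2 * pi * (T%:R * - (n%:R / T%:R)) - pi * - (n%:R / T%:R) + 2 * pi * (n%:R * x) =
  (- (pi * - (n%:R / T%:R)) + 2 * pi * (n%:R * x)) + pi * ((- (n *+ 2)%:Z))%:~R.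
  have -> : (- (n *+ 2)%:Z)%:~R = - (2 * n%:R) :> R.
    rewrite mulrNz -natrM; congr (- _%:R); lia.
  by field.
have [s [s1 hs hc]] := pi_shift R (- (n%:Z *+ 1)).
have -> : pi * (- (n *+ 2)%:Z)%:~R = pi * (- (n%:Z *+ 1))%:~R + pi * (- (n%:Z *+ 1))%:~R.
  rewrite -mulrDr -intrD; congr (_ * _%:~R); lia.
rewrite addrA !hs mulrA s1 mul1r subrr => /eqP.
rewrite mulf_eq0 mulf_eq0 pnatr_eq0 /= => /orP[|/eqP //].
rewrite mulrN sinN oppr_eq0 gt_eqF //; apply: sin_gt0_pi.
rewrite mulr_gt0 ?pi_gt0 ?divr_gt0 ?ltr0n //=.
by rewrite gtr_pMr ?pi_gt0 // ltr_pdivrMr ?ltr0n // mul1r ltr_nat.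
Qed.

(** Averaging over more than N equidistant translates removes the frequencies 1, ..., N, so the
    translates form a partition of a constant. *)
Lemma kern_shift_sum N (d : nat -> R) T x : (N < T)%N ->
  (forall x, kern N x = \sum_(0 <= n < N.+1) d n * cos (2 * pi * (n%:R * x))) ->
  \sum_(0 <= t < T) kern N (x - t%:R / T%:R) = T%:R * d 0%N.
Proof.
move=> NT hd; under eq_bigr do rewrite hd.
rewrite exchange_big /= big_nat_recl //= [X in _ + X]big_nat [X in _ + X]big1 ?addr0.
  under eq_bigr do rewrite mul0r mulr0 cos0 mulr1.
  by rewrite sumr_const_nat subn0 mulr_natl.
move=> n nN; rewrite -mulr_sumr cos_shift_sum ?mulr0 //=.
by apply: leq_trans NT; rewrite ltnS.
Qed.

(** With r the square root of rho, (N + 1) r ^ N is at most the geometric series 1 / (1 - r), and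
    the other factor r ^ N tends to 0. *)
Lemma exp_small (rho e : R) : 0 <= rho < 1 -> 0 < e ->
  exists N : nat, N.+1%:R * rho ^+ N <= e.
Proof.
move=> /andP[r0 r1] e0; set r := Num.sqrt rho.
have rr : r * r = rho by rewrite -expr2 sqr_sqrtr.
have rge : 0 <= r by rewrite sqrtr_ge0.
have rlt : r < 1 by rewrite -[ltRHS]sqrtr1 ltr_sqrt.
have hb N : N.+1%:R * r ^+ N <= (1 - r)^-1.
  apply: (@le_trans _ _ (\sum_(i < N.+1) r ^+ i)).
    rewrite mulr_natl -[N.+1 in leLHS]card_ord -sumr_const; apply: ler_sum => i _.
    have iN : (i <= N)%N := ltn_ord i; exact: (ler_wiXn2l rge (ltW rlt) iN).
  have H : (1 - r) * \sum_(i < N.+1) r ^+ i = 1 - r ^+ N.+1.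
    have := subrXX 1 r N.+1; rewrite expr1n => ->; congr (_ * _).
    by apply: eq_bigr => i _; rewrite expr1n mul1r.
  have p : 0 < 1 - r by lra.
  rewrite -(ler_pM2l p) H mulfV ?gt_eqF //.
  by have := exprn_ge0 N.+1 rge; lra.
have p : 0 < 1 - r by lra.
have hcv : (fun n => r ^+ n : R) @ \oo --> 0.
  by apply: cvg_expr; rewrite ger0_norm.
have /cvgrPdist_le /(_ (e * (1 - r)) (mulr_gt0 e0 p)) [N _ hN] := hcv.
have {hN} := hN N (leqnn N); rewrite /= sub0r normrN ger0_norm ?exprn_ge0 // => hN.
exists N; rewrite -rr exprMn mulrA.
apply: (@le_trans _ _ ((1 - r)^-1 * r ^+ N)).
  by rewrite ler_wpM2r ?exprn_ge0.
by rewrite mulrC ler_pdivrMr.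
Qed.

(* x modulo 1 lies in the arc that starts at s and has length lam *)
Definition inarc (s lam x : R) : bool := (x - s - (Num.floor (x - s))%:~R < lam).

Lemma inarcP (s lam x : R) : lam <= 1 ->
  reflect (exists z : int, s <= x - z%:~R < s + lam) (inarc s lam x).
Proof.
move=> l1; apply: (iffP idP) => [h|[z /andP[h1 h2]]].
  exists (Num.floor (x - s)); have := floor_le (x - s); move: h; rewrite /inarc; lra.
rewrite /inarc (@floor_def _ _ z) ?intrD; lra.
Qed.

(** The mean [p.1] is kept apart from the terms (amplitude, frequency - 1, phase shift); storing the
    frequency less 1 makes every listed frequency positive. *)
Definition trigpoly (p : R * seq (R * nat * R)) (x : R) :=
  p.1 + \sum_(a <- p.2) a.1.1 * cos (2 * pi * (a.1.2.+1%:R * x) + a.2).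

Lemma cos_far (s y : R) : 0 < s -> s - 1 <= y <= - s ->
  cos (2 * pi * y) <= cos (2 * pi * s).
Proof.
move=> s0 /andP[y1 y2]; have p0 := pi_gt0 R.
have key u : s <= u <= 1 / 2 -> cos (2 * pi * u) <= cos (2 * pi * s).
  move=> /andP[u1 u2].
  have a1 : 2 * pi * s <= 2 * pi * u by rewrite ler_wpM2l // mulr_ge0 // ltW.
  have a2 : 2 * pi * u <= pi.
    by rewrite -mulrA mulrCA ger_pMr //; lra.
  have a3 : 0 <= 2 * pi * s by rewrite !mulr_ge0 // ltW.
  rewrite leNgt ltr_cos -?leNgt //; rewrite in_itv /=; apply/andP; split; lra.
have [yh|yh] := lerP (- (1 / 2)) y.
  by rewrite -cosN -mulrN; apply: key; lra.
by rewrite -[y]addr0 -(cos_shift2 1) addr0; apply: key; lra.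
Qed.

(** Translates of [kern] by multiples of 1 / T are summed over centres that fill the arc widened by
    s on both sides. Seen from the arc, the omitted centres are at distance at least s, where [kern]
    is tiny, so the kept ones carry all but a fraction e of the constant total. *)
Lemma majorant (s0 lam eta : R) : 0 <= lam <= 1 -> 0 < eta -> eta <= 1 ->
  exists p : R * seq (R * nat * R), [/\ 0 <= p.1 <= lam + eta,
    (forall x, 0 <= trigpoly p x) & (forall x, inarc s0 lam x -> 1 <= trigpoly p x)].
Proof.
move=> /andP[l0 l1] e0 e1; have [big|small] := lerP 1 (lam + eta).
  exists (1, [::]); rewrite /trigpoly; split=> [|x|x _] /=; rewrite ?big_nil ?addr0 //.
  by rewrite ler01.
set s := eta / 8; set e := eta / 8.
have sp : 0 < s by rewrite /s; lra.
have p0 := pi_gt0 R.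
have c1 : cos (2 * pi * s) < 1.
  have a1 : 0 < 2 * pi * s by rewrite !mulr_gt0.
  have a2 : 2 * pi * s <= pi by rewrite -mulrA mulrCA ger_pMr // /s; lra.
  by rewrite -[ltRHS]cos0 ltr_cos // in_itv /= ?lexx ?a2 ?ltW.
set rho := (1 + cos (2 * pi * s)) / 2.
have r01 : 0 <= rho < 1 by have := cos_geN1 (2 * pi * s); rewrite /rho; lra.
have ep : 0 < e by rewrite /e; lra.
have [N hN] := exp_small r01 ep.
have [d hd] := kern_cospoly N.
set T := (maxn N.+1 (Num.bound s^-1)).
have NT : (N < T)%N by rewrite leq_maxl.
have T0 : 0 < T%:R :> R by rewrite ltr0n; apply: leq_trans NT.
have Ts : 1 <= T%:R * s.
  rewrite -ler_pdivrMr // div1r; apply: (@le_trans _ _ (Num.bound s^-1)%:R).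
    by apply/ltW; apply: archi_boundP; rewrite invr_ge0 ltW.
  by rewrite ler_nat leq_maxr.
(* At the point 0 the N + 1 translates sum to N + 1 times the mean and include the peak value 1. The
   mean is thus at least 1 / (N + 1), whence the factor N + 1 in [exp_small]. *)
have d0 : 1 <= N.+1%:R * d 0%N.
  rewrite -(kern_shift_sum 0 (ltnSn N) hd) big_nat_recl //= mul0r subrr.
  rewrite {1}/kern mulr0 cos0 -[X in X ^+ _]/((1 + 1) / 2).
  rewrite divff // expr1n lerDl; apply: sumr_ge0 => i _; exact: kern_ge0.
have d0p : 0 < d 0%N.
  by rewrite -(@pmulr_rgt0 _ N.+1%:R) ?ltr0n //; apply: lt_le_trans d0.
set y := T%:R * (lam + 2 * s).
have y0 : 0 <= y by rewrite /y !mulr_ge0 //; lra.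
set m := (absz (Num.floor y)).+1.
have mE : m%:R = (Num.floor y)%:~R + 1 :> R.
  rewrite /m -natr1; congr (_ + _).
  by rewrite -[in RHS](gez0_abs (_ : 0 <= Num.floor y)) // floor_ge0.
have ym : y < m%:R by have := floorD1_gt y; rewrite mE intrD.
have my : m%:R <= y + 1 by have := floor_le y; rewrite mE; lra.
have mT : (m <= T)%N.
  rewrite -(ler_nat R); apply: (le_trans my); rewrite /y.
  apply: (@le_trans _ _ (T%:R * (lam + 3 * s))).
    by have := Ts; lra.
  rewrite -[leRHS]mulr1; apply: ler_wpM2l; first exact: ltW.
  by rewrite /s; lra.
(* All T translates together give T times the mean; the factor 1 - e compensates for the omitted
   ones. *)
set A := (T%:R * d 0%N * (1 - e))^-1.
have A0 : 0 < A by rewrite invr_gt0 !mulr_gt0 // /e; lra.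
pose F x := A * \sum_(0 <= t < m) kern N (x - s0 + s - t%:R / T%:R).
pose l := [seq (A * d n.+1, n, 2 * pi * (n.+1%:R * (- s0 + s - t%:R / T%:R))) |
     t <- index_iota 0 m, n <- index_iota 0 N].
pose p := (A * (m%:R * d 0%N), l).
have FE x : trigpoly p x = F x.
  rewrite /F /trigpoly [p.2]/= [p.1]/= /l big_allpairs_dep /=.
  under [in RHS]eq_bigr do rewrite hd big_nat_recl //= mul0r mulr0 cos0 mulr1.
  rewrite [in RHS]big_split /= sumr_const_nat subn0 -[d 0%N *+ m]mulr_natl [in RHS]mulrDr; congr (_ + _).
  rewrite mulr_sumr; apply: eq_bigr => t _; rewrite mulr_sumr.
  by apply: eq_bigr => n _; rewrite [RHS]mulrA; congr (_ * _); congr cos; ring.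
exists p; split.
- rewrite /p /=; apply/andP; split; first by rewrite !mulr_ge0 // ltW.
  have -> : A * (m%:R * d 0%N) = m%:R / T%:R / (1 - e).
    rewrite /A; field; rewrite ?gt_eqF //; rewrite /e; lra.
  have q1 : 0 < 1 - e by rewrite /e; lra.
  rewrite ler_pdivrMr // ler_pdivrMr //; apply: (le_trans my).
  apply: (@le_trans _ _ (T%:R * (lam + 3 * s))).
    by rewrite /y; have := Ts; lra.
  rewrite mulrC; apply: ler_wpM2r; first exact: ltW.
  rewrite /s /e.
  have : lam * eta <= eta by rewrite ler_piMl // ltW.
  have : eta * eta <= eta by rewrite ler_piMl // ltW.
  lra.
- move=> x; rewrite FE /F; apply: mulr_ge0; first exact: ltW.
  by apply: sumr_ge0 => i _; exact: kern_ge0.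
move=> x /(inarcP _ _ l1)[z /andP[z1 z2]]; rewrite FE /F.
have := kern_shift_sum (x - s0 + s) NT hd.
rewrite (big_cat_nat (leq0n _) mT) /=.
have : \sum_(m <= t < T) kern N (x - s0 + s - t%:R / T%:R) <= T%:R * (d 0%N * e).
  apply: (@le_trans _ _ (\sum_(m <= t < T) rho ^+ N)).
    rewrite big_nat [leRHS]big_nat; apply: ler_sum => t /andP[mt tT].
    rewrite /kern; apply: lerXn2r; rewrite ?nnegrE.
    - by have := cos_geN1 (2 * pi * (x - s0 + s - t%:R / T%:R)); lra.
    - by case/andP: r01.
    rewrite /rho ler_pM2r // lerD2l -(subrK z%:~R (_ - _)) cos_shift2.
    apply: cos_far => //.
    have t1 : lam + 2 * s <= t%:R / T%:R.
      rewrite ler_pdivlMr // mulrC -/y; apply/ltW; apply: (lt_le_trans ym).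
      by rewrite ler_nat.
    have t2 : t%:R / T%:R < 1 :> R by rewrite ltr_pdivrMr // mul1r ltr_nat.
    lra.
  rewrite sumr_const_nat -[leLHS]mulr_natl.
  apply: (@le_trans _ _ (T%:R * rho ^+ N)).
    by rewrite ler_wpM2r ?exprn_ge0 ?ler_nat ?leq_subr //; case/andP: r01.
  apply: ler_wpM2l; first exact: ltW.
  have h1 : 0 <= rho ^+ N by rewrite exprn_ge0 //; case/andP: r01.
  apply: (@le_trans _ _ (N.+1%:R * d 0%N * rho ^+ N)).
    by rewrite ler_peMl.
  by rewrite mulrAC mulrC ler_pM2l.
set S1 := \sum_(0 <= t < m) _; set S2 := \sum_(m <= t < T) _ => h1 h2.
rewrite /A mulrC -[leRHS]/(S1 / _) ler_pdivlMr ?mul1r; last first.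
  by rewrite !mulr_gt0 // /e; lra.
have -> : S1 = T%:R * d 0%N - S2 by rewrite -h2 addrK.
lra.
Qed.

End Majorant.

(** * Weyl's theorem in several coordinates *)

Section Weyl.
Variables (R : realType) (E : finType).
Local Notation pi := (@pi R).

(** Linear independence over the rationals of 1 and the numbers [theta e], with denominators
    cleared. *)
Definition nonresonant (theta : E -> R) := forall (n : E -> int) (z : int),
  \sum_e (n e)%:~R * theta e = z%:~R -> forall e, n e = 0.

Lemma sum_shear_phases (theta : E -> R) (n : E -> int) (e : E) (a : int) :
  \sum_e' (n e' + a * (e' == e)%:R)%:~R * theta e' =
  \sum_e' (n e')%:~R * theta e' + a%:~R * theta e.
Proof.
under eq_bigr do rewrite intrD mulrDl.
rewrite big_split /=; congr (_ + _).
rewrite (bigD1 e) //= eqxx mulr1 big1 ?addr0 // => i /negbTE ->.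
by rewrite mulr0 mul0r.
Qed.

(** Product to sum, one coordinate at a time: a term of frequency a in the coordinate e moves nu by
    a or - a times [theta e]. That nu is no integer combination, modulo integers, of the coordinates
    still to come survives each move. *)
Lemma null_mean_cos_prod (theta : E -> R) (p : E -> R * seq (R * nat * R)) (s : seq E) :
  uniq s -> forall nu phi : R,
  (forall (n : E -> int) (z : int), (forall e, e \notin s -> n e = 0) ->
     nu != \sum_e (n e)%:~R * theta e + z%:~R) ->
  null_mean (fun j => cos (2 * pi * (j%:R * nu) + phi) *
                \prod_(e <- s) trigpoly (p e) (j%:R * theta e)).
Proof.
elim: s => [|e s IH] /=.
  move=> _ nu phi h; apply: (@null_mean_ext _ (fun j => cos (2 * pi * (j%:R * nu) + phi))).
    by move=> j; rewrite big_nil mulr1.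
  apply: null_mean_cos => z; have := h (fun=> 0) z (fun _ _ => erefl).
  by rewrite big1 ?add0r // => i _; rewrite mul0r.
case/andP=> es us nu phi h; set P := fun j : nat => \prod_(e <- s) trigpoly (p e) (j%:R * theta e).
have hs (a : int) phi' : null_mean (fun j =>
    cos (2 * pi * (j%:R * (nu + a%:~R * theta e)) + phi') * P j).
  apply: IH => // n z nz; apply/eqP => H.
  have : forall e', e' \notin e :: s -> n e' + (- a) * (e' == e)%:R = 0.
    move=> e'; rewrite in_cons negb_or => /andP[/negbTE -> /nz ->].
    by rewrite mulr0 addr0.
  move=> /(h (fun e' => n e' + (- a) * (e' == e)%:R) z) /eqP; apply.
  by rewrite sum_shear_phases mulrNz mulNr addrAC -H addrK.
apply: (@null_mean_ext _ (fun j => (p e).1 * (cos (2 * pi * (j%:R * (nu + 0%:~R * theta e)) + phi) * P j)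
   + \sum_(a <- (p e).2) a.1.1 / 2 *
     (cos (2 * pi * (j%:R * (nu + (a.1.2.+1%:Z)%:~R * theta e)) + (phi + a.2)) * P j
     + cos (2 * pi * (j%:R * (nu + (- (a.1.2.+1%:Z))%:~R * theta e)) + (phi - a.2)) * P j))).
  move=> j; rewrite big_cons -/(P j) {1}/trigpoly mul0r addr0.
  rewrite [RHS]mulrA [cos _ * (_ + _)]mulrDr [RHS]mulrDl; congr (_ + _); first by ring.
  rewrite mulr_sumr mulr_suml; apply: eq_bigr => -[[a n] psi] _ /=.
  set x := 2 * pi * (j%:R * nu) + phi; set y := 2 * pi * (n.+1%:R * (j%:R * theta e)) + psi.
  have -> : 2 * pi * (j%:R * (nu + (n.+1%:Z)%:~R * theta e)) + (phi + psi) = x + y.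
    by rewrite /x /y -pmulrn; ring.
  have -> : 2 * pi * (j%:R * (nu + (- (n.+1%:Z))%:~R * theta e)) + (phi - psi) = x - y.
    by rewrite /x /y mulrNz -pmulrn; ring.
  by rewrite cosD (cosB x); field.
apply: null_meanD; first exact: null_meanZ.
apply: null_mean_sum => a _; apply: null_meanZ; apply: null_meanD; exact: hs.
Qed.

Lemma null_mean_prod (theta : E -> R) (p : E -> R * seq (R * nat * R)) (s : seq E) :
  nonresonant theta -> uniq s ->
  null_mean (fun j => \prod_(e <- s) trigpoly (p e) (j%:R * theta e) - \prod_(e <- s) (p e).1).
Proof.
move=> nr; elim: s => [|e s IH] /=.
  by move=> _; apply: (null_mean_ext _ (@null_mean0 R)) => j; rewrite !big_nil subrr.
case/andP=> es us; set P := fun j : nat => \prod_(e <- s) trigpoly (p e) (j%:R * theta e).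
set c := \prod_(e <- s) (p e).1.
apply: (@null_mean_ext _ (fun j => (p e).1 * (P j - c) + \sum_(a <- (p e).2) a.1.1 *
     (cos (2 * pi * (j%:R * ((a.1.2.+1%:Z)%:~R * theta e)) + a.2) * P j))).
  move=> j; rewrite !big_cons -/(P j) -/c {1}/trigpoly [in RHS]mulrDl mulrBr addrAC; congr (_ + _); congr (_ + _).
  rewrite mulr_suml; apply: eq_bigr => a _; rewrite mulrA; congr (_ * _); congr (_ * _); congr cos.
  by rewrite -pmulrn; ring.
apply: null_meanD; first by apply: null_meanZ; exact: IH.
apply: null_mean_sum => a _; apply: null_meanZ; apply: null_mean_cos_prod => // n z nz; apply/eqP => H.
have h : \sum_e' (n e' + - (a.1.2.+1%:Z) * (e' == e)%:R)%:~R * theta e' = (- z)%:~R.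
  by rewrite sum_shear_phases mulrNz mulNr H mulrNz; ring.
by have := nr _ _ h e; rewrite eqxx (nz _ es) add0r mulr1.
Qed.

(* Only upper bounds are required: the lower ones follow by complementing arcs. *)
Definition equidist (x : E -> nat -> R) := forall s lam : E -> R,
  (forall e, 0 <= lam e <= 1) ->
  upper_mean (fun j => ([forall e, inarc (s e) (lam e) (x e j)])%:R) (\prod_e lam e).

Lemma prod_perturb (I : Type) (r : seq I) (lam : I -> R) (eta : R) :
  (forall i, 0 <= lam i <= 1) -> 0 <= eta <= 1 ->
  \prod_(i <- r) (lam i + eta) <= \prod_(i <- r) lam i + 3 ^+ size r * eta.
Proof.
move=> hl /andP[e0 e1]; elim: r => [|i r IH].
  by rewrite !big_nil /= expr0 mul1r lerDl.
rewrite !big_cons /= exprS; case/andP: (hl i) => l0 l1.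
have P0 : 0 <= \prod_(i <- r) lam i by apply: prodr_ge0 => k _; case/andP: (hl k).
have P1 : \prod_(i <- r) lam i <= 1.
  suff : 0 <= \prod_(i <- r) lam i <= 1 by case/andP.
  elim/big_rec: _ => [|k y _ /andP[y0 y1]]; first by rewrite ler01 lexx.
  by case/andP: (hl k) => k0 k1; rewrite mulr_ge0 //= mulr_ile1.
move: IH; set P := \prod_(i <- r) lam i; set Q := \prod_(i <- r) (lam i + eta) => IH.
have x1 : 1 <= 3 ^+ size r :> R by apply: exprn_ege1; rewrite ler1n.
move: x1 IH; set x := 3 ^+ size r => x1 IH.
apply: (@le_trans _ _ ((lam i + eta) * (P + x * eta))); first by rewrite ler_wpM2l // addr_ge0.
have h1 : lam i * (x * eta) <= x * eta by rewrite ler_piMl // mulr_ge0 //; lra.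
have h2 : eta * P <= eta * x by apply: ler_wpM2l => //; apply: le_trans x1.
have h3 : eta * (x * eta) <= x * eta by rewrite ler_piMl // mulr_ge0 //; lra.
rewrite mulrDl !mulrDr; lra.
Qed.

(** The indicator of a box lies below the product of the majorants of its sides, and the averages of
    this product tend to the product of the means. *)
Lemma weyl (theta : E -> R) : nonresonant theta -> equidist (fun e j => j%:R * theta e).
Proof.
move=> nr s lam hl; apply: upper_mean_closed => e0 e0p.
set K : R := 3 ^+ size (index_enum E).
have K1 : 1 <= K by apply: exprn_ege1; rewrite ler1n.
set eta := Num.min 1 (e0 / K).
have eta0 : 0 < eta by rewrite lt_min ltr01 divr_gt0 //; lra.
have eta1 : eta <= 1 by rewrite ge_min lexx.
have /boolp.choice[p hp] : forall e, exists p : R * seq (R * nat * R), [/\ 0 <= p.1 <= lam e + eta,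
    (forall x, 0 <= trigpoly p x) & (forall x, inarc (s e) (lam e) x -> 1 <= trigpoly p x)].
  by move=> e; apply: majorant.
apply: (@upper_mean_le _ _ (fun j => \prod_e trigpoly (p e) (j%:R * theta e)) (\prod_e (p e).1)).
- move=> j; case: forallP => [h|_] /=.
    elim/big_rec: _ => [|k y _ y1] //; have [_ _ /(_ _ (h k)) m1] := hp k.
    by apply: mulr_ege1.
  by apply: prodr_ge0 => e _; have [_ h _] := hp e; apply: h.
- apply: (@le_trans _ _ (\prod_e (lam e + eta))).
    by apply: ler_prod => e _; have [] := hp e.
  apply: (le_trans (prod_perturb _ hl _)); first by rewrite ltW.
  rewrite lerD2l -/K mulrC -ler_pdivlMr; last by lra.
  by rewrite ge_min lexx orbT.
apply: upper_mean_null_mean; apply: (null_mean_ext _ (null_mean_prod p nr (index_enum_uniq E))) => j //.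
Qed.

End Weyl.

(** * Lower bounds for boxes, and shears of equidistributed sequences *)

Section Shear.
Variables (R : realType) (E : finType).

Definition lower_mean (f : nat -> R) (c : R) := forall eta : R, 0 < eta ->
  exists J0 : nat, forall J : nat, (J0 <= J)%N ->
  (c - eta) * J%:R <= \sum_(0 <= j < J) f j.

Lemma inarc1 (s x : R) : inarc s 1 x.
Proof.
apply/inarcP => //; exists (Num.floor (x - s)).
by have := floor_le (x - s); have := floorD1_gt (x - s); rewrite intrD; lra.
Qed.

Lemma inarcC (s lam x : R) : 0 <= lam <= 1 -> ~~ inarc s lam x ->
  inarc (s + lam) (1 - lam) x.
Proof.
move=> /andP[l0 l1]; rewrite /inarc -leNgt => h.
apply/inarcP; first by lra.
exists (Num.floor (x - s)); move: h.
by have := floorD1_gt (x - s); rewrite intrD; lra.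
Qed.

(** Replacing any set of sides by their complements gives 2 ^ |E| boxes that cover the torus and
    have total volume 1; the upper bounds for all the others leave the wanted share. *)
Lemma equidist_lower (x : E -> nat -> R) : equidist x -> forall s lam : E -> R,
  (forall e, 0 <= lam e <= 1) ->
  lower_mean (fun j => ([forall e, inarc (s e) (lam e) (x e j)])%:R) (\prod_e lam e).
Proof.
move=> hx s lam hl.
pose ss (g : {ffun E -> bool}) e := if g e then s e else s e + lam e.
pose ll (g : {ffun E -> bool}) e := if g e then lam e else 1 - lam e.
pose g1 : {ffun E -> bool} := [ffun=> true].
have hll g e : 0 <= ll g e <= 1.
  by rewrite /ll; case: (g e) => //; case/andP: (hl e) => *; apply/andP; split; lra.
have tot : \sum_g \prod_e ll g e = 1.
  have <- : \prod_(e : E) \sum_(b : bool) (if b then lam e else 1 - lam e) =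
    \sum_g \prod_e ll g e by rewrite bigA_distr_bigA.
  by rewrite big1 // => e _; rewrite big_bool /=; lra.
have p1 : \prod_e ll g1 e = \prod_e lam e.
  by apply: eq_bigr => e _; rewrite /ll ffunE.
have hu : upper_mean (fun j => \sum_(g | g != g1) ([forall e, inarc (ss g e) (ll g e) (x e j)])%:R)
    (\sum_(g | g != g1) \prod_e ll g e).
  by apply: upper_mean_sum => g _; apply: hx.
move=> eta eta0; have [J0 h] := hu _ eta0; exists J0 => J /h {}h.
have : J%:R <= \sum_(0 <= j < J) ([forall e, inarc (s e) (lam e) (x e j)])%:R +
  \sum_(0 <= j < J) \sum_(g | g != g1) ([forall e, inarc (ss g e) (ll g e) (x e j)])%:R :> R.
  rewrite -big_split /=.
  apply: (@le_trans _ _ (\sum_(0 <= j < J) 1)).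
    by rewrite sumr_const_nat subn0.
  apply: ler_sum => j _.
  case: forallP => [_|nh]; first by rewrite lerDl; apply: sumr_ge0 => g _; rewrite ler0n.
  pose g : {ffun E -> bool} := [ffun e => inarc (s e) (lam e) (x e j)].
  have gg1 : g != g1.
    by apply/eqP => gE; apply: nh => e; move/ffunP: gE => /(_ e); rewrite !ffunE.
  rewrite add0r (bigD1 g) //=.
  suff -> : [forall e, inarc (ss g e) (ll g e) (x e j)].
    by rewrite lerDl; apply: sumr_ge0 => g' _; rewrite ler0n.
  apply/forallP => e; rewrite /ss /ll ffunE; case: ifPn => // /inarcC; exact.
have : \sum_(g | g != g1) \prod_e ll g e = 1 - \prod_e lam e.
  by have := tot; rewrite (bigD1 g1) //= p1 => h1; lra.
move=> sE; move: h; rewrite sE; lra.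
Qed.

Lemma subarc (s lam x : R) (n : nat) : (0 < n)%N -> 0 <= lam <= 1 -> inarc s lam x ->
  exists2 i : 'I_n, inarc (s + lam * i%:R / n%:R) (lam / n%:R) x & True.
Proof.
move=> n0 /andP[l0 l1] /(inarcP _ _ l1)[z /andP[z1 z2]].
have lp : 0 < lam by lra.
have nR : 0 < n%:R :> R by rewrite ltr0n.
set u := (x - z%:~R - s) * n%:R / lam.
have u0 : 0 <= u by rewrite /u !mulr_ge0 ?invr_ge0 //; lra.
have un : u < n%:R by rewrite /u ltr_pdivrMr // mulrC ltr_pM2l //; lra.
have hf := floor_itv u.
have f0 : 0 <= Num.floor u by rewrite floor_ge0.
have fE : (absz (Num.floor u))%:R = (Num.floor u)%:~R :> R.
  by rewrite -[in RHS](gez0_abs f0).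
have fn : (absz (Num.floor u) < n)%N.
  by rewrite -(ltr_nat R) fE; apply: le_lt_trans un; exact: floor_le.
exists (Ordinal fn) => //; apply/inarcP => /=.
  by rewrite ler_pdivrMr // mul1r; apply: (le_trans l1); rewrite ler1n.
exists z; rewrite fE; move: hf; rewrite intrD => /andP[h1 h2].
have xE : x - z%:~R = s + u * lam / n%:R.
  rewrite /u; field; apply/andP; split; lra.
rewrite xE lerD2l -addrA ltrD2l -mulrDl.
rewrite ler_pM2r ?invr_gt0 // ltr_pM2r ?invr_gt0 // mulrC ler_pM2r //.
have h3 : 0 < ((Num.floor u)%:~R + 1 - u) * lam.
  by apply: mulr_gt0 => //; move: h2; rewrite mulr1z; lra.
by rewrite h1 /=; lra.
Qed.

(** An arc around 1 / 2, where tan (pi x) has its pole. *)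
Definition bad (zeta x : R) : bool := inarc (1 / 2 - zeta) (2 * zeta) x.

Definition shear_phases3 (T : Type) (f : E -> T) (e a b : E) (u v w : T) (e' : E) : T :=
  if e' == e then u else if e' == a then v else if e' == b then w else f e'.

Lemma prod3 (F : E -> R) (e a b : E) : e != a -> e != b -> a != b ->
  \prod_i F i = F e * (F a * (F b * \prod_(i | [&& i != e, i != a & i != b]) F i)).
Proof.
move=> ea eb ab; rewrite (bigD1 e) //= (bigD1 a) /=; last by rewrite eq_sym.
rewrite (bigD1 b) /=; last by rewrite eq_sym eb eq_sym.
by congr (_ * (_ * (_ * _))); apply: eq_bigl => i; rewrite andbA.
Qed.

Lemma prod_shear_phases3 (F : E -> R) (e a b : E) u v w : e != a -> e != b -> a != b ->
  \prod_i shear_phases3 F e a b u v w i =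
  u * (v * (w * \prod_(i | [&& i != e, i != a & i != b]) F i)).
Proof.
move=> ea eb ab; rewrite (prod3 _ ea eb ab) /shear_phases3 eqxx eq_sym (negbTE ea) eqxx.
rewrite ![b == _]eq_sym (negbTE eb) (negbTE ab) eqxx; congr (_ * (_ * (_ * _))).
by apply: eq_bigr => i /and3P[/negbTE -> /negbTE -> /negbTE ->].
Qed.

(* The map x |-> x + G (x_a, x_b) on the coordinate e preserves Lebesgue measure,
   and G is uniformly continuous away from the bad arcs around 1/2. *)
Lemma shear (G : R -> R -> R) (x : E -> nat -> R) (e a b : E) :
  e != a -> e != b -> a != b ->
  (forall zeta eta : R, 0 < zeta -> 0 < eta -> exists2 del : R, 0 < del &
    forall (u v u' v' : R) (z w : int), ~~ bad zeta u -> ~~ bad zeta u' ->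
      ~~ bad zeta v -> ~~ bad zeta v' -> `|u - u' - z%:~R| < del ->
      `|v - v' - w%:~R| < del -> `|G u v - G u' v'| <= eta) ->
  equidist x -> equidist (fun e' j => if e' == e then x e j + G (x a j) (x b j) else x e' j).
Proof.
move=> ea eb ab hG hx s lam hl; apply: upper_mean_closed => eps eps0.
(* Two bad arcs of length 2 [zeta] cost at most eps / 4 in all, and so does widening one side by 2
   [eta]. *)
set zeta := Num.min (1 / 4) (eps / 16).
have z0 : 0 < zeta by rewrite lt_min; apply/andP; split; lra.
have z1 : zeta <= 1 / 4 by rewrite ge_min lexx.
have z2 : zeta <= eps / 16 by rewrite ge_min lexx orbT.
set eta := eps / 8; have eta0 : 0 < eta by rewrite /eta; lra.
have [del del0 hdel] := hG zeta eta z0 eta0.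
set n := (Num.bound del^-1).+1.
have nR : 0 < n%:R :> R by rewrite ltr0n.
have ndel : n%:R^-1 < del.
  rewrite -[ltRHS]invrK ltf_pV2 ?posrE ?invr_gt0 //.
  apply: (@lt_trans _ _ (Num.bound del^-1)%:R); last by rewrite ltr_nat.
  by apply: archi_boundP; rewrite invr_ge0 ltW.
pose st c (i : 'I_n) := s c + lam c * i%:R / n%:R.
have ln c : 0 <= lam c / n%:R <= n%:R^-1.
  case/andP: (hl c) => h1 h2; apply/andP; split; first by rewrite divr_ge0.
  by rewrite ler_pdivrMr // mulVf ?gt_eqF.
have n1 : n%:R^-1 <= 1 :> R by rewrite invf_le1 ?ltr0n // ler1n.
have ln1 c : lam c / n%:R <= 1 by case/andP: (ln c) => _ h; apply: le_trans n1.
have piece c (i : 'I_n) (u u' : R) : inarc (st c i) (lam c / n%:R) u ->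
    inarc (st c i) (lam c / n%:R) u' -> exists z : int, `|u - u' - z%:~R| < del.
  move=> /(inarcP _ _ (ln1 c))[z /andP[h1 h2]] /(inarcP _ _ (ln1 c))[w /andP[h3 h4]].
  exists (z - w); rewrite intrD mulrNz; apply: le_lt_trans ndel.
  case/andP: (ln c) => _ h5; rewrite ler_norml; apply/andP; split; lra.
(* On a pair of short arcs G is constant up to [eta]; [gam] is its value at one pair of points that
   are not bad, or 0 if there is none. *)
have /boolp.choice[gam hgam] : forall ii : 'I_n * 'I_n, exists g : R, forall u v,
    ~~ bad zeta u -> ~~ bad zeta v -> inarc (st a ii.1) (lam a / n%:R) u ->
    inarc (st b ii.2) (lam b / n%:R) v -> `|G u v - g| <= eta.
  move=> [i i'] /=; have [[u' [v' [h1 h2 h3 h4]]]|no] := pselect (exists u v,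
    [/\ ~~ bad zeta u, ~~ bad zeta v, inarc (st a i) (lam a / n%:R) u &
    inarc (st b i') (lam b / n%:R) v]).
    exists (G u' v') => u v bu bv iu iv.
    have [z hz] := piece _ _ _ _ iu h3; have [w hw] := piece _ _ _ _ iv h4.
    by apply: hdel hz hw.
  by exists 0 => u v *; exfalso; apply: no; exists u, v.
(* The length of the arc of e after it has been moved back by [gam] and widened by [eta] on both
   sides; capped, since arcs have length at most 1. *)
pose le := Num.min 1 (lam e + 2 * eta).
have le01 : 0 <= le <= 1.
  rewrite /le ge_min lexx le_min ler01 /= andbT.
  by case/andP: (hl e) => *; lra.
pose B (ii : 'I_n * 'I_n) j : R :=
  ([forall e', inarc (shear_phases3 s e a b (s e - gam ii - eta) (st a ii.1) (st b ii.2) e')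
     (shear_phases3 lam e a b le (lam a / n%:R) (lam b / n%:R) e') (x e' j)])%:R.
pose D c j : R := ([forall e', inarc (if e' == c then 1 / 2 - zeta else 0)
   (if e' == c then 2 * zeta else 1) (x e' j)])%:R.
have hD c : upper_mean (D c) (2 * zeta).
  apply: (upper_mean_le _ _ (hx _ _ _)) => [j|//|e'].
    exact: lexx.
    rewrite (bigD1 c) //= eqxx big1 ?mulr1 // => i /negbTE ->; exact: erefl.
  by rewrite /=; case: ifP => _; rewrite ?ler01 ?lexx //; apply/andP; split; lra.
have hB ii : upper_mean (B ii) (le * (lam a / n%:R * (lam b / n%:R *
    \prod_(i | [&& i != e, i != a & i != b]) lam i))).
  rewrite -prod_shear_phases3 //; apply: hx => e'; rewrite /shear_phases3.
  case: ifP => // _; case: ifP => _; first by case/andP: (ln a) => -> /= ?; exact: ln1.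
  by case: ifP => // _; case/andP: (ln b) => -> /= ?; exact: ln1.
apply: (@upper_mean_le _ _ (fun j => \sum_ii B ii j + (D a j + D b j)) _ _ _ _
   (upper_meanD (@upper_mean_sum _ _ _ xpredT B _ (fun ii _ => hB ii)) (upper_meanD (hD a) (hD b)))).
- move=> j; have B0 ii : 0 <= B ii j by rewrite ler0n.
  have S0 : 0 <= \sum_ii B ii j by apply: sumr_ge0.
  have D0 c : 0 <= D c j by rewrite ler0n.
  case: forallP => [h|_] /=; last by rewrite !addr_ge0.
  have badD c : bad zeta (x c j) -> D c j = 1.
    move=> hb; rewrite /D; suff -> : [forall e', inarc (if e' == c then 1 / 2 - zeta else 0)
      (if e' == c then 2 * zeta else 1) (x e' j)] by [].
    apply/forallP => e'; have [->|_] := eqVneq e' c; first exact: hb.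
    exact: inarc1.
  have [/badD ->|nba] := boolP (bad zeta (x a j)); first by have := D0 b; lra.
  have [/badD ->|nbb] := boolP (bad zeta (x b j)); first by have := D0 a; lra.
  have := h a; rewrite eq_sym (negbTE ea) => ha.
  have := h b; rewrite eq_sym (negbTE eb) => hb.
  have := h e; rewrite eqxx => he.
  have np : (0 < n)%N by [].
  have [i hi _] := subarc np (hl a) ha; have [i' hi' _] := subarc np (hl b) hb.
  have hg := hgam (i, i') _ _ nba nbb hi hi'.
  apply: (@le_trans _ _ (B (i, i') j)); last first.
    rewrite (bigD1 (i, i')) //= -addrA lerDl addr_ge0 ?addr_ge0 //.
    by apply: sumr_ge0.
  rewrite /B; suff -> : [forall e', inarc (shear_phases3 s e a b (s e - gam (i, i') - eta) (st a i) (st b i') e')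
     (shear_phases3 lam e a b le (lam a / n%:R) (lam b / n%:R) e') (x e' j)] by [].
  apply/forallP => e'; rewrite /shear_phases3; have [->|ne] := eqVneq e' e; last first.
    have [->//|na] := eqVneq e' a; have [->//|nb] := eqVneq e' b.
    by have := h e'; rewrite (negbTE ne).
  have [big|small] := lerP 1 (lam e + 2 * eta).
    by rewrite (_ : le = 1) ?inarc1 // /le min_l.
  apply/inarcP; first by case/andP: le01.
  have le1 : lam e <= 1 by case/andP: (hl e).
  move/(inarcP _ _ le1): he => [z /andP[h1 h2]]; exists z.
  rewrite (_ : le = lam e + 2 * eta); last by rewrite /le min_r // ltW.
  move: hg; rewrite ler_norml => /andP[h3 h4]; apply/andP; split; lra.
- rewrite sumr_const card_prod card_ord -[X in X + _ <= _]mulr_natr natrM.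
  set P := \prod_(i | _) lam i.
  have -> : le * (lam a / n%:R * (lam b / n%:R * P)) * (n%:R * n%:R) = le * (lam a * (lam b * P)).
    by field; rewrite gt_eqF.
  have P0 : 0 <= P by apply: prodr_ge0 => k _; case/andP: (hl k).
  have P1 : P <= 1.
    suff : 0 <= P <= 1 by case/andP.
    rewrite /P; elim/big_rec: _ => [|k y _ /andP[y0 y1]]; first by rewrite ler01 lexx.
    by case/andP: (hl k) => k0 k1; rewrite mulr_ge0 //= mulr_ile1.
  rewrite (prod3 _ ea eb ab) -/P.
  case/andP: (hl a) => a0 a1; case/andP: (hl b) => b0 b1.
  set Q := lam a * (lam b * P).
  have Q0 : 0 <= Q by rewrite !mulr_ge0.
  have Q1 : Q <= 1 by rewrite !mulr_ile1 // ?mulr_ge0.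
  have : le * Q <= (lam e + 2 * eta) * Q by rewrite ler_wpM2r // /le ge_min lexx orbT.
  have : 2 * eta * Q <= 2 * eta by rewrite ler_piMr //; lra.
  by rewrite mulrDl /eta; lra.
Qed.

End Shear.

(** * Combining phases at a vertex *)

Section Calculus.
Variable R : realType.
Local Notation pi := (@pi R).
Implicit Types (x y a b : R).

Lemma mvt (f df : R -> R) a b : a <= b ->
  (forall x, a <= x <= b -> is_derive x 1 f (df x)) ->
  exists2 c, a <= c <= b & f b - f a = df c * (b - a).
Proof.
move=> ab hd; have [x xab||c cab h] := @MVT_segment R f df a b ab.
- by apply: hd; move: xab; rewrite in_itv /= => /andP[/ltW -> /ltW ->].
- apply: derivable_within_continuous => x; rewrite in_itv /= => xab.
  by have [] := hd x xab.
by exists c; rewrite -?in_itv.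
Qed.

Lemma pi2_gt0 : 0 < pi / 2. Proof. by have := pi_gt0 R; lra. Qed.

Lemma is_derive_tanT x : - (pi / 2) < x < pi / 2 -> is_derive x 1 tan (1 + tan x ^+ 2).
Proof.
move=> h; have c0 : cos x != 0 by rewrite gt_eqF // cos_gt0_pihalf.
by rewrite -cos2_tan2 //; exact: is_derive_tan.
Qed.

Lemma tan_gt0 x : 0 < x < pi / 2 -> 0 < tan x.
Proof.
by move=> /andP[h1 h2]; rewrite -(tan0 R) ltr_tan // in_itv /=; apply/andP; split; lra.
Qed.

Lemma tan_le a x : a < pi / 2 -> - a <= x <= a -> `|tan x| <= tan a.
Proof.
move=> ap /andP[x1 x2]; rewrite ler_norml -tanN.
have tm u v : - (pi / 2) < u -> u <= v -> v < pi / 2 -> tan u <= tan v.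
  move=> hu uv hv; rewrite leNgt ltr_tan -?leNgt // in_itv /=; apply/andP; split; lra.
by rewrite !tm //; lra.
Qed.

Lemma tan_lip a x y : a < pi / 2 -> - a <= x <= a -> - a <= y <= a ->
  `|tan x - tan y| <= (1 + tan a ^+ 2) * `|x - y|.
Proof.
move=> ap; wlog xy : x y / x <= y => [H hx hy|hx hy].
  have /orP[/H h|/H h] := le_total x y; first by apply: h.
  by rewrite distrC [`|x - y|]distrC; apply: h.
have hd u : x <= u <= y -> is_derive u 1 tan (1 + tan u ^+ 2).
  by move=> hu; apply: is_derive_tanT; apply/andP; split; lra.
have [c /andP[c1 c2]] := mvt xy hd.
rewrite distrC [`|x - y|]distrC => ->.
rewrite normrM ler_wpM2r // ger0_norm ?addr_ge0 ?sqr_ge0 // lerD2l.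
rewrite -real_normK ?num_real // lerXn2r ?nnegrE //.
  exact: le_trans (normr_ge0 _) (tan_le ap hx).
by apply: tan_le => //; lra.
Qed.

Lemma atan_lip x y : `|atan x - atan y| <= `|x - y|.
Proof.
wlog xy : x y / x <= y => [H|].
  by have /orP[/H //|/H h] := le_total x y; rewrite distrC [`|x - y|]distrC.
have [c _] := @mvt (@atan R) (fun x => (1 + x ^+ 2)^-1) x y xy (fun u _ => is_derive1_atan u).
rewrite distrC [`|x - y|]distrC => ->.
rewrite normrM ler_piMl // ger0_norm ?invr_ge0 ?addr_ge0 ?sqr_ge0 //.
by rewrite invf_le1 ?lerDl ?sqr_ge0 // ltr_pwDl // sqr_ge0.
Qed.

Definition join_phase x y : R := atan (tan x + tan y).

(** With X = tan x and Y = tan y, the partial derivative of [join_phase] with respect to x. *)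
Definition Wt (X Y : R) : R := (1 + X ^+ 2) / (1 + (X + Y) ^+ 2).

Lemma join_phaseC x y : join_phase x y = join_phase y x. Proof. by rewrite /join_phase addrC. Qed.

Lemma Wt_ge0 X Y : 0 <= Wt X Y.
Proof. by rewrite /Wt divr_ge0 // addr_ge0 // sqr_ge0. Qed.

Lemma oneDsq_gt0 X : 0 < 1 + X ^+ 2 :> R.
Proof. by rewrite ltr_pwDl // sqr_ge0. Qed.

Lemma join_phase_mvt x x' y : - (pi / 2) < x -> x <= x' -> x' < pi / 2 ->
  exists2 c, x <= c <= x' & join_phase x' y - join_phase x y = Wt (tan c) (tan y) * (x' - x).
Proof.
move=> h1 h2 h3.
apply: (@mvt (fun u => join_phase u y) (fun u => Wt (tan u) (tan y)) x x' h2) => u hu.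
have hu' : - (pi / 2) < u < pi / 2 by apply/andP; split; lra.
have := is_derive_tanT hu' => dt.
have d1 : is_derive u 1 (fun u => tan u + tan y) (1 + tan u ^+ 2).
  by apply: is_derive_eq; rewrite addr0.
have := @is_derive1_comp R (@atan R) (fun u => tan u + tan y) u _ _ (is_derive1_atan _) d1.
by move=> d2; apply: is_derive_eq d2 _; rewrite /Wt mulrC.
Qed.

Lemma Wt_lip M X Y X' Y' : 0 <= M -> `|X| <= M -> `|Y| <= M -> `|X'| <= M -> `|Y'| <= M ->
  `|Wt X Y - Wt X' Y'| <= (6 * M + 4 * M ^+ 3) * (`|X - X'| + `|Y - Y'|).
Proof.
move=> M0 hX hY hX' hY'.
set D := 1 + (X + Y) ^+ 2; set D' := 1 + (X' + Y') ^+ 2.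
have D0 : 0 < D by exact: oneDsq_gt0.
have D'0 : 0 < D' by exact: oneDsq_gt0.
have D1 : 1 <= D by rewrite lerDl sqr_ge0.
have D'1 : 1 <= D' by rewrite lerDl sqr_ge0.
have -> : Wt X Y - Wt X' Y' = (X - X') * (X + X') / D +
   (1 + X' ^+ 2) * ((X' - X + (Y' - Y)) * (X + Y + (X' + Y'))) / (D * D').
  rewrite /Wt -/D -/D' /D /D'; field; apply/andP; split; rewrite gt_eqF //; exact: oneDsq_gt0.
set dX := `|X - X'|; set dY := `|Y - Y'|.
have dX0 : 0 <= dX by rewrite normr_ge0.
have dY0 : 0 <= dY by rewrite normr_ge0.
apply: (@le_trans _ _ (2 * M * dX + (1 + M ^+ 2) * ((dX + dY) * (4 * M)))).
  apply: (le_trans (ler_normD _ _)); apply: lerD.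
    rewrite normrM normfV (ger0_norm (ltW D0)) ler_pdivrMr //.
    apply: (@le_trans _ _ (2 * M * dX)).
      rewrite normrM mulrC -/dX ler_wpM2r //; apply: (le_trans (ler_normD _ _)); lra.
    by rewrite ler_peMr // !mulr_ge0.
  rewrite normrM normfV (ger0_norm (ltW (mulr_gt0 D0 D'0))) ler_pdivrMr ?mulr_gt0 //.
  apply: (@le_trans _ _ ((1 + M ^+ 2) * ((dX + dY) * (4 * M)))); last first.
    apply: ler_peMr; last exact: mulr_ege1.
    by rewrite mulr_ge0 ?(ltW (oneDsq_gt0 _)) // mulr_ge0 ?addr_ge0 ?mulr_ge0.
  rewrite !normrM ler_pM // ?mulr_ge0 //.
    rewrite ger0_norm ?addr_ge0 ?sqr_ge0 // lerD2l -real_normK ?num_real //.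
    by rewrite lerXn2r ?nnegrE.
  rewrite ler_pM //.
    by apply: (le_trans (ler_normD _ _)); rewrite distrC [`|Y' - Y|]distrC.
  apply: (le_trans (ler_normD _ _)); have := ler_normD X Y; have := ler_normD X' Y'; lra.
(* The slack 2 M [dY] is added to make the constant symmetric in the two variables. *)
have h1 : 0 <= M * dY by rewrite mulr_ge0.
have -> : (6 * M + 4 * M ^+ 3) * (dX + dY) = 2 * M * dX +
  (1 + M ^+ 2) * ((dX + dY) * (4 * M)) + 2 * (M * dY) by ring.
by rewrite lerDl mulr_ge0.
Qed.

Lemma Wt_le M X Y : 0 <= M -> `|X| <= M -> Wt X Y <= 1 + M ^+ 2.
Proof.
move=> M0 hX; rewrite /Wt ler_pdivrMr ?oneDsq_gt0 //.
apply: (@le_trans _ _ (1 + M ^+ 2)).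
  by rewrite lerD2l -real_normK ?num_real // lerXn2r ?nnegrE.
by rewrite ler_peMr ?addr_ge0 ?sqr_ge0 // lerDl sqr_ge0.
Qed.

End Calculus.

(** * Uniform continuity of the joined phase away from the poles *)

Section GC.
Variable R : realType.
Local Notation pi := (@pi R).

Lemma nbadE (zeta u : R) : 0 < zeta <= 1 / 4 -> ~~ bad zeta u ->
  exists z : int, - (1 / 2 - zeta) <= u - z%:~R <= 1 / 2 - zeta.
Proof.
move=> /andP[z0 z1]; rewrite /bad => /inarcC h.
have /h {h} : 0 <= 2 * zeta <= 1 by apply/andP; split; lra.
move=> /inarcP h; have /h [z /andP[h1 h2]] : 1 - 2 * zeta <= 1 by lra.
by exists (z + 1); rewrite intrD; apply/andP; split; lra.
Qed.

(** Outside the bad arcs the phases have representatives in a compact part of (- pi / 2, pi / 2),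
    where the tangent is Lipschitz with constant [L]; the arctangent is 1-Lipschitz. *)
Lemma join_phase_cont (zeta eta : R) : 0 < zeta -> 0 < eta -> exists2 del : R, 0 < del &
  forall (u v u' v' : R) (z w : int), ~~ bad zeta u -> ~~ bad zeta u' ->
    ~~ bad zeta v -> ~~ bad zeta v' -> `|u - u' - z%:~R| < del ->
    `|v - v' - w%:~R| < del ->
    `|join_phase (pi * u) (pi * v) / pi - join_phase (pi * u') (pi * v') / pi| <= eta.
Proof.
move=> z0 e0.
wlog z1 : zeta z0 / zeta <= 1 / 4.
  move=> H; have [z1|z1] := lerP zeta (1 / 4); first exact: H.
  have [|del d0 h] := H (1 / 4) _ (lexx _); first by lra.
  exists del => // u v u' v' z w.
  have bb x : ~~ bad zeta x -> ~~ bad (1 / 4) x.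
    apply: contra; rewrite /bad => /inarcP h'.
    have /h'[k /andP[k1 k2]] : 2 * (1 / 4) <= 1 :> R by lra.
    have [zz|zz] := lerP (2 * zeta) 1.
      by apply/inarcP => //; exists k; apply/andP; split; lra.
    apply: (@lt_trans _ _ 1) => //; exact: (inarc1 (1 / 2 - zeta) x).
  by move=> /bb b1 /bb b2 /bb b3 /bb b4; apply: h.
set a := pi * (1 / 2 - zeta); have p0 := pi_gt0 R.
have ap : a < pi / 2 by rewrite /a mulrDr mulrN; have := mulr_gt0 p0 z0; lra.
set L := 1 + tan a ^+ 2; have L0 : 0 < L by exact: oneDsq_gt0.
exists (Num.min zeta (eta / (2 * L))); first by rewrite lt_min z0 divr_gt0 // mulr_gt0.
have key (u u' : R) (z : int) : ~~ bad zeta u -> ~~ bad zeta u' ->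
    `|u - u' - z%:~R| < Num.min zeta (eta / (2 * L)) ->
    `|tan (pi * u) - tan (pi * u')| <= pi * eta / 2.
  have zz : 0 < zeta <= 1 / 4 by rewrite z0.
  move=> /(nbadE zz)[m hm] /(nbadE zz)[m' hm']; rewrite lt_min => /andP[h1 h2].
  (* Both representatives lie in an interval of length 1 - 2 zeta and u - u' is within zeta of z, so
     z and m - m' differ by less than 1. *)
  have zE : z = m - m'.
    apply/eqP; rewrite eq_le -!ltzD1.
    rewrite -!(ltr_int R) !intrD !mulrNz.
    move: h1 hm hm'; rewrite ltr_norml => /andP[? ?] /andP[? ?] /andP[? ?].
    by apply/andP; split; rewrite mulr1z; lra.
  have sh (w : R) (k : int) : tan (pi * w) = tan (pi * (w - k%:~R)).
    by rewrite -[in LHS](subrK k%:~R w) mulrDr tan_shift.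
  rewrite (sh u m) (sh u' m').
  have hp (w : R) : - (1 / 2 - zeta) <= w <= 1 / 2 - zeta -> - a <= pi * w <= a.
    by move=> /andP[w1 w2]; rewrite /a -mulrN !ler_pM2l // w1 w2.
  apply: (le_trans (tan_lip ap (hp _ hm) (hp _ hm'))).
  rewrite -mulrBr normrM (gtr0_norm p0) -/L.
  have -> : u - m%:~R - (u' - m'%:~R) = u - u' - z%:~R by rewrite zE intrD mulrNz; ring.
  move: h2; rewrite ltr_pdivlMr ?mulr_gt0 // => h2.
  have : pi * (`|u - u' - z%:~R| * (2 * L)) <= pi * eta by rewrite ler_pM2l // ltW.
  lra.
move=> u v u' v' z w b1 b2 b3 b4 h1 h2.
rewrite -mulrBl normrM normfV (gtr0_norm p0) ler_pdivrMr //.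
apply: (le_trans (atan_lip _ _)).
have := key _ _ _ b1 b2 h1; have := key _ _ _ b3 b4 h2 => k1 k2.
have -> : tan (pi * u) + tan (pi * v) - (tan (pi * u') + tan (pi * v')) =
  (tan (pi * u) - tan (pi * u')) + (tan (pi * v) - tan (pi * v')) by ring.
by apply: (le_trans (ler_normD _ _)); lra.
Qed.

End GC.

(** * A grid of cells for the two phases at a vertex *)

Section Grid.
Variable R : realType.
Local Notation pi := (@pi R).

Lemma ev_div (C e : R) : 0 < e -> exists q0 : nat, forall q, (q0 <= q)%N -> C / q.+1%:R <= e.
Proof.
move=> e0; exists (Num.bound (`|C| / e)) => q hq.
rewrite ler_pdivrMr ?ltr0n // -ler_pdivrMl // mulrC.
apply: (@le_trans _ _ (`|C| / e)); first by rewrite ler_pM2r ?invr_gt0 // ler_norm.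
apply: ltW; apply: lt_le_trans (archi_boundP _) _; first by rewrite divr_ge0 // ltW.
by rewrite ler_nat; apply: leqW.
Qed.

Definition mid (a : R) (q : nat) (c : nat) : R := - a + (c.*2.+1)%:R * a / q%:R.

Lemma natr_mid (c : nat) : (c.*2.+1)%:R = 2 * c%:R + 1 :> R.
Proof. by rewrite -natr1 -muln2 natrM mulrC. Qed.

(** The midpoint in units of a / q. Being an integer, it turns questions about signs on cells into
    integer arithmetic. *)
Definition mid_index (q c : nat) : int := (c.*2.+1)%:Z - q%:Z.

Lemma midE (a : R) q c : (0 < q)%N -> mid a q c = (mid_index q c)%:~R * (a / q%:R).
Proof.
move=> q0; rewrite /mid /mid_index intrD mulrNz -!pmulrn; field.
by rewrite pnatr_eq0 -lt0n.
Qed.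

Lemma mid_bound (a : R) q c : 0 <= a -> (c < q)%N -> - a <= mid a q c <= a.
Proof.
move=> a0 cq; have q0 : (0 < q)%N by apply: leq_trans cq.
have qR : 0 < q%:R :> R by rewrite ltr0n.
rewrite /mid lerDl divr_ge0 ?mulr_ge0 //=.
suff : c.*2.+1%:R * a / q%:R <= 2 * a by lra.
rewrite ler_pdivrMr // mulrAC ler_wpM2r // -natrM ler_nat -muln2; lia.
Qed.

(** Each phase will be followed up to 2 units of a / q away from its midpoint, and the sum of both
    up to 4 units; past these thresholds no sign can change. *)
Definition cell_good (q c1 c2 : nat) : bool :=
  [&& (2 < absz (mid_index q c1))%N, (2 < absz (mid_index q c2))%N & (4 < absz (mid_index q c1 + mid_index q c2)%R)%N].

(** Tells whether X Y (X + Y) is negative on a good cell, since tan x + tan y has the sign of x +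
    y. *)
Definition eps (q c1 c2 : nat) : bool := mid_index q c1 * mid_index q c2 * (mid_index q c1 + mid_index q c2) < 0.

Lemma mid_index_rev q (c : 'I_q) : mid_index q (rev_ord c) = - mid_index q c.
Proof. rewrite /mid_index /=; have := ltn_ord c; lia. Qed.

Lemma cell_good_rev q (c1 c2 : 'I_q) : cell_good q (rev_ord c1) (rev_ord c2) = cell_good q c1 c2.
Proof. by rewrite /cell_good !mid_index_rev -opprD !abszN. Qed.

Lemma cell_goodC q c1 c2 : cell_good q c1 c2 = cell_good q c2 c1.
Proof. by rewrite /cell_good andbCA [mid_index q c1 + _]addrC. Qed.

Lemma eps_rev q (c1 c2 : 'I_q) : cell_good q c1 c2 ->
  eps q (rev_ord c1) (rev_ord c2) = ~~ eps q c1 c2.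
Proof.
rewrite /cell_good /eps !mid_index_rev => /and3P[h1 h2 h3].
rewrite -opprD mulrNN mulrN oppr_lt0 ltNge le_eqVlt negb_or andbC.
suff -> : mid_index q c1 * mid_index q c2 * (mid_index q c1 + mid_index q c2) != 0 by rewrite andbT.
by rewrite !mulf_neq0 // -absz_gt0; lia.
Qed.

Lemma half_sum q (F : 'I_q -> 'I_q -> R) (s : bool) :
  (forall c1 c2, F (rev_ord c1) (rev_ord c2) = F c1 c2) ->
  2 * \sum_(c1 < q) \sum_(c2 < q | cell_good q c1 c2 && (eps q c1 c2 == s)) F c1 c2 =
  \sum_(c1 < q) \sum_(c2 < q | cell_good q c1 c2) F c1 c2.
Proof.
move=> hF.
have flip : \sum_(c1 < q) \sum_(c2 < q | cell_good q c1 c2 && (eps q c1 c2 == s)) F c1 c2 =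
   \sum_(c1 < q) \sum_(c2 < q | cell_good q c1 c2 && (eps q c1 c2 != s)) F c1 c2.
  rewrite (reindex_inj rev_ord_inj) /=; apply: eq_bigr => c1 _.
  rewrite (reindex_inj rev_ord_inj) /=; apply: eq_big => [c2|c2 _]; last exact: hF.
  rewrite cell_good_rev; have [g|//] := boolP (cell_good q c1 c2); rewrite /= (eps_rev g).
  by case: (eps q c1 c2); case: s.
rewrite mulr_natl mulr2n {2}flip -big_split /=; apply: eq_bigr => c1 _.
by rewrite [RHS](bigID (fun c2 : 'I_q => eps q c1 c2 == s)).
Qed.

(** The mean value theorem on each of the q cells yields derivatives at unknown points; the
    hypothesis moves them to the midpoints with an error [eta] each. *)
Lemma row_sum (a : R) q (y eta : R) : 0 < a < pi / 2 -> (0 < q)%N ->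
  (forall (c : 'I_q) x, `|x - mid a q c| <= a / q%:R ->
     Wt (tan x) (tan y) <= Wt (tan (mid a q c)) (tan y) + eta) ->
  join_phase a y - join_phase (- a) y - 2 * a * eta <=
  (2 * a / q%:R) * \sum_(c < q) Wt (tan (mid a q c)) (tan y).
Proof.
move=> /andP[a0 ap] q0 h; have qR : 0 < q%:R :> R by rewrite ltr0n.
have qN : q%:R != 0 :> R by rewrite gt_eqF.
pose ed (c : nat) := - a + c%:R * (2 * a / q%:R).
have edq : ed q = a by rewrite /ed; field.
have ed0 : ed 0%N = - a by rewrite /ed mul0r addr0.
have -> : join_phase a y - join_phase (- a) y = \sum_(c < q) (join_phase (ed c.+1) y - join_phase (ed c) y).
  rewrite -[in join_phase a]edq -ed0 -(big_mkord xpredT (fun c => join_phase (ed c.+1) y - join_phase (ed c) y)).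
  by rewrite telescope_sumr.
have -> : 2 * a * eta = \sum_(c < q) (2 * a / q%:R * eta).
  by rewrite sumr_const card_ord -mulr_natr; field.
rewrite -sumrB mulr_sumr; apply: ler_sum => c _.
have st : 0 < 2 * a / q%:R by rewrite divr_gt0 // mulr_gt0.
have e1 : ed c <= ed c.+1 by rewrite /ed lerD2l ler_pM2r // ler_nat.
have e0 : - a <= ed c by rewrite /ed lerDl mulr_ge0 // ltW.
have e2 : ed c.+1 <= a.
  rewrite -[leRHS]edq /ed lerD2l ler_pM2r // ler_nat; exact: ltn_ord.
have [| |x xx ->] := @join_phase_mvt R (ed c) (ed c.+1) y _ e1; [lra|lra|].
have dE : ed c.+1 - ed c = 2 * a / q%:R by rewrite /ed -natr1; ring.
rewrite dE mulrC -mulrBr ler_pM2l // lerBlDr; apply: h.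
have : ed c = mid a q c - a / q%:R.
  by rewrite /ed /mid natr_mid; field.
have : ed c.+1 = mid a q c + a / q%:R.
  by rewrite /ed /mid natr_mid -natr1; field.
move=> E1 E2; rewrite ler_norml; move: xx; rewrite E1 E2 => /andP[? ?].
by apply/andP; split; lra.
Qed.

Lemma clip_lip (b x y : R) : x <= y ->
  Num.max (- b) (Num.min b y) - Num.max (- b) (Num.min b x) <= y - x.
Proof.
move=> xy; rewrite lerBlDr ge_max; apply/andP; split.
  by rewrite -[leLHS]add0r lerD ?subr_ge0 // le_max lexx.
have : Num.min b y <= y - x + Num.min b x.
  rewrite -lerBlDl le_min lerBlDl ge_min; apply/andP; split.
    by apply/orP; left; rewrite lerDr subr_ge0.
  by rewrite lerBlDr ge_min [x + _]addrC subrK lexx orbT.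
by move/le_trans; apply; rewrite lerD2l le_max lexx orbT.
Qed.

(** The identity clipped to [- b', b'], where b' is one cell shorter than b, has total growth 2 b',
    and it grows only on cells whose midpoint lies in [- b, b]. *)
Lemma count_mid (a : R) q (b : R) : 0 < a -> (0 < q)%N -> 0 <= b <= a ->
  2 * (b - 2 * a / q%:R) <= (2 * a / q%:R) * \sum_(c < q) ((`|mid a q c| <= b)%R : bool)%:R.
Proof.
move=> a0 q0 /andP[b0 ba]; have qR : 0 < q%:R :> R by rewrite ltr0n.
have qN : q%:R != 0 :> R by rewrite gt_eqF.
have st : 0 < 2 * a / q%:R by rewrite divr_gt0 // mulr_gt0.
have [neg|pos] := lerP (b - 2 * a / q%:R) 0.
  by apply: (@le_trans _ _ 0); [lra|rewrite mulr_ge0 ?sumr_ge0 // ltW].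
set b' := b - 2 * a / q%:R.
pose ed (c : nat) := - a + c%:R * (2 * a / q%:R).
have edq : ed q = a by rewrite /ed; field.
have ed0 : ed 0%N = - a by rewrite /ed mul0r addr0.
pose cl x := Num.max (- b') (Num.min b' x).
have e1 (c : nat) : ed c <= ed c.+1 by rewrite /ed lerD2l ler_pM2r // ler_nat.
have -> : 2 * b' = \sum_(c < q) (cl (ed c.+1) - cl (ed c)).
  rewrite -(big_mkord xpredT (fun c => cl (ed c.+1) - cl (ed c))) telescope_sumr //.
  have -> : cl (ed q) = b' by rewrite edq /cl /b' min_l ?max_r //; lra.
  have -> : cl (ed 0%N) = - b' by rewrite ed0 /cl /b' min_r ?max_l //; lra.
  by ring.
rewrite mulr_sumr; apply: ler_sum => c _.
have dE : ed c.+1 - ed c = 2 * a / q%:R by rewrite /ed -natr1; ring.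
have E1 : ed c = mid a q c - a / q%:R.
  by rewrite /ed /mid natr_mid; field.
have E3 : 2 * a / q%:R = 2 * (a / q%:R) by ring.
have [hm|hm] := boolP (`|mid a q c| <= b).
  rewrite mulr1 -dE; exact: clip_lip.
rewrite mulr0; move: hm; rewrite ler_norml negb_and -!ltNge => /orP[hm|hm].
  have h1 : ed c.+1 <= - b' by rewrite -[ed c.+1](subrK (ed c)) dE E1 /b'; lra.
  have h2 : ed c <= - b' by move: dE; lra.
  have bb : - b' <= b' by rewrite /b'; lra.
  by rewrite /cl (min_r (le_trans h1 bb)) (min_r (le_trans h2 bb)) (max_l h1) (max_l h2) subrr.
have h1 : b' <= ed c by rewrite E1 /b'; lra.
have h2 : b' <= ed c.+1 by move: dE; lra.
by rewrite /cl !min_l ?subrr.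
Qed.

Lemma count_window q (P : pred nat) (m k : nat) :
  (forall c, (c < q)%N -> P c -> (m <= c < m + k)%N) -> (\sum_(c < q) P c <= k)%N.
Proof.
move=> h; have -> : (\sum_(c < q) P c = count P (iota 0 q))%N.
  rewrite -(big_mkord xpredT (fun c => nat_of_bool (P c))) /index_iota subn0.
  by elim: (iota 0 q) => [|x s IH]; rewrite ?big_nil ?big_cons //= IH.
rewrite -size_filter -(size_iota m k); apply: uniq_leq_size.
  by rewrite filter_uniq // iota_uniq.
by move=> c; rewrite mem_filter !mem_iota add0n => /andP[Pc cq]; apply: h.
Qed.

(** Bad pairs lie in three strips, around x = 0, y = 0 and x + y = 0, each at most 5 cells wide. *)
Lemma bad_count q : (\sum_(c1 < q) \sum_(c2 < q) ~~ cell_good q c1 c2 <= 15 * q)%N.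
Proof.
pose B1 c := (absz (mid_index q c) <= 2)%N.
pose B3 c1 c2 := (absz (mid_index q c1 + mid_index q c2)%R <= 4)%N.
have cB1 : (\sum_(c < q) B1 c <= 5)%N.
  apply: (@count_window q B1 (q - 3)./2) => c cq; rewrite /B1 /mid_index; lia.
have cB3 c1 : (\sum_(c2 < q) B3 c1 c2 <= 5)%N.
  apply: (@count_window q (B3 c1) (q - 3 - c1)) => c2 cq; rewrite /B3 /mid_index; lia.
apply: (@leq_trans (\sum_(c1 < q) (B1 c1 * q + 5 + 5))).
  apply: leq_sum => c1 _.
  apply: (@leq_trans (\sum_(c2 < q) (B1 c1 + B1 c2 + B3 c1 c2))).
    apply: leq_sum => c2 _; rewrite /cell_good /B1 /B3 !ltnNge.
    by case: (_ <= 2)%N => //=; case: (_ <= 2)%N => //=; case: (_ <= 4)%N.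
  rewrite !big_split /= sum_nat_const card_ord mulnC -addnA.
  by rewrite -addnA leq_add2l leq_add // cB3.
rewrite !big_split /= -big_distrl /= !sum_nat_const card_ord.
have := leq_mul cB1 (leqnn q); move: (\sum_(i < q) _)%N => S; nia.
Qed.

Lemma dist_between (x c x' m r : R) :
  `|x - m| <= r -> `|x' - m| <= r -> x <= c -> c <= x' -> `|c - m| <= r.
Proof.
by rewrite !ler_norml => /andP[? ?] /andP[? ?] ? ?; apply/andP; split; lra.
Qed.

Lemma norm_lower (x y r : R) : `|x - y| <= r -> y - r <= x.
Proof. by rewrite ler_norml => /andP[? ?]; lra. Qed.

Lemma tanD_lt0 (u v : R) : - (pi / 2) < u < pi / 2 -> - (pi / 2) < v < pi / 2 ->
  (tan u + tan v < 0) = (u + v < 0).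
Proof.
move=> h1 h2; rewrite -[tan v]opprK -tanN subr_lt0 ltr_tan ?in_itv //=.
  by rewrite -subr_lt0 opprK.
by case/andP: h2 => v1 v2; rewrite ltrN2 v2 ltrNl v1.
Qed.

Lemma tanD_gt0 (u v : R) : - (pi / 2) < u < pi / 2 -> - (pi / 2) < v < pi / 2 ->
  (0 < tan u + tan v) = (0 < u + v).
Proof.
move=> h1 h2; rewrite -[tan v]opprK -tanN subr_gt0 ltr_tan ?in_itv //=.
  by rewrite -subr_gt0 opprK.
by case/andP: h2 => v1 v2; rewrite ltrN2 v2 ltrNl v1.
Qed.

Lemma zero_itv : - (pi / 2) < (0 : R) < pi / 2.
Proof. by have := pi2_gt0 R; rewrite oppr_lt0 => ->. Qed.

Lemma tan_lt0E (u : R) : - (pi / 2) < u < pi / 2 -> (tan u < 0) = (u < 0).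
Proof. by move=> h; have := tanD_lt0 h zero_itv; rewrite tan0 !addr0. Qed.

Lemma tan_gt0E (u : R) : - (pi / 2) < u < pi / 2 -> (0 < tan u) = (0 < u).
Proof. by move=> h; have := tanD_gt0 h zero_itv; rewrite tan0 !addr0. Qed.

Lemma mul3_lt0 (F : realDomainType) (u v w : F) : u != 0 -> v != 0 -> w != 0 ->
  (u * v * w < 0) = (u < 0) (+) (v < 0) (+) (w < 0).
Proof. by move=> u0 v0 w0; rewrite !mulr_lt0 u0 v0 w0 mulf_neq0. Qed.

Lemma sign_near (h u : R) (z : int) (k : nat) : 0 < h -> (k < absz z)%N ->
  `|u - z%:~R * h| <= k%:R * h -> (u < 0) = (z < 0) /\ (u != 0).
Proof.
move=> h0 kz; rewrite ler_norml => /andP[u1 u2]; have [z0|z0] := ltP z 0.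
  have : (z + 1)%:~R <= (- k%:Z)%:~R :> R by rewrite ler_int; lia.
  rewrite intrD mulrNz -pmulrn -(ler_pM2r h0) => hh; have un : u < 0 by lra.
  by rewrite un lt_eqF.
have : (k%:Z + 1)%:~R <= z%:~R :> R by rewrite ler_int; lia.
rewrite intrD -pmulrn -(ler_pM2r h0) => hh; have un : 0 < u by lra.
by rewrite gt_eqF // ltNge (ltW un).
Qed.

Definition cellsum q (F : 'I_q -> 'I_q -> R) (s : bool) : R :=
  \sum_(c1 < q) \sum_(c2 < q | cell_good q c1 c2 && (eps q c1 c2 == s)) F c1 c2.

(* Reversing both indices exchanges the two signs and keeps the weights, which is
   where the factor 1/2 comes from; W1 and W2 are lower bounds for the partial
   derivatives of join_phase on the cells. *)
Lemma grid (eta : R) : 0 < eta < 1 ->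
  exists (a : R) (q : nat) (W1 W2 : 'I_q -> 'I_q -> R) (C : R),
  [/\ 0 < a < pi / 2, (0 < q)%N, 0 <= C & forall c1 c2, 0 <= W1 c1 c2 /\ 0 <= W2 c1 c2] /\
  (forall s, let m F := (2 * a / (pi * q%:R)) ^+ 2 * cellsum F s in
     [/\ (1 - eta) / 2 <= m W1, (1 - eta) / 2 <= m W2 &
         (1 - eta) / 2 <= m (fun _ _ => 1)]) /\
  (forall (c1 c2 : 'I_q) x y x' y', cell_good q c1 c2 ->
     `|x - mid a q c1| <= 2 * a / q%:R -> `|x' - mid a q c1| <= 2 * a / q%:R ->
     `|y - mid a q c2| <= 2 * a / q%:R -> `|y' - mid a q c2| <= 2 * a / q%:R ->
     x <= x' -> y <= y' ->
     W1 c1 c2 * (x' - x) + W2 c1 c2 * (y' - y) <= join_phase x' y' - join_phase x y <=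
     C * ((x' - x) + (y' - y))) /\
  (forall (c1 c2 : 'I_q) x y, cell_good q c1 c2 ->
     `|x - mid a q c1| <= 2 * a / q%:R -> `|y - mid a q c2| <= 2 * a / q%:R ->
     [/\ - (pi / 2) < x < pi / 2, - (pi / 2) < y < pi / 2 &
     [/\ tan x != 0, tan y != 0, tan x + tan y != 0 &
      (tan x * tan y * (tan x + tan y) < 0) = eps q c1 c2]]).
Proof.
(* Six losses of size [kap]: four from (1 - 2 kap) ^ 2, one from passing to the lower bounds [W1],
   one from the bad cells. *)
move=> /andP[eta0 eta1]; set kap := eta / 6.
have k0 : 0 < kap by rewrite /kap; lra.
have k1 : kap < 1 / 6 by rewrite /kap; lra.
have p0 := pi_gt0 R.
set b := pi / 2 * (1 - kap).
have pk : 0 < pi * kap by rewrite mulr_gt0.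
have pk1 : pi * kap < pi * (1 / 6) by rewrite ltr_pM2l.
have b0 : 0 < b by rewrite /b mulr_gt0 ?pi2_gt0 //; lra.
have bp : b < pi / 2 by rewrite /b mulrBr mulr1; lra.
set B := 2 * tan b; set a := atan B.
have tb0 : 0 < tan b.
  by apply: tan_gt0; rewrite b0.
have bE : b = atan (tan b) by rewrite tanK // in_itv /=; apply/andP; split; lra.
have ba : b <= a.
  rewrite bE; by apply: le_atan; rewrite /B; lra.
have ap : a < pi / 2 by exact: atan_ltpi2.
have a0 : 0 < a by lra.
have tanaE : tan a = B by exact: atanK.
(* Room for points outside [- a, a] but close to one of its cells; [M] bounds every tangent that
   occurs. *)
set a' := (a + pi / 2) / 2.
have a'p : a' < pi / 2 by rewrite /a'; lra.
set M := tan a'.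
have M0 : 0 < M by apply: tan_gt0; rewrite /a'; apply/andP; split; lra.
set K := (6 * M + 4 * M ^+ 3) * (2 * (1 + M ^+ 2) * (2 * a)).
have da : 0 < a' - a by rewrite /a'; lra.
have kp4 : 0 < pi / 2 * kap by rewrite mulr_gt0 ?pi2_gt0.
have [q1 hq1] := ev_div (2 * a) da.
have [q2 hq2] := ev_div K k0.
have [q3 hq3] := ev_div (2 * a) kp4.
have [q4 hq4] := ev_div (15 * (1 + M ^+ 2)) k0.
set q' := maxn (maxn q1 q2) (maxn q3 q4).
have {}hq1 := hq1 q' (leq_trans (leq_maxl _ _) (leq_maxl _ _)).
have {}hq2 := hq2 q' (leq_trans (leq_maxr _ _) (leq_maxl _ _)).
have {}hq3 := hq3 q' (leq_trans (leq_maxl _ _) (leq_maxr _ _)).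
have {}hq4 := hq4 q' (leq_trans (leq_maxr _ _) (leq_maxr _ _)).
set q := q'.+1; rewrite -/q in hq1 hq2 hq3 hq4.
have q0 : (0 < q)%N by [].
clearbody q.
have qR : 0 < q%:R :> R by rewrite ltr0n.
have piN : pi != 0 by rewrite gt_eqF.
have qN : q%:R != 0 :> R by rewrite gt_eqF.
have r0 : 0 < 2 * a / q%:R by rewrite divr_gt0 // mulr_gt0.
have r2 : 2 * a / q%:R = 2 * (a / q%:R) by ring.
have near (c : 'I_q) x : `|x - mid a q c| <= 2 * a / q%:R -> - a' <= x <= a'.
  have /andP[m1 m2] := mid_bound (ltW a0) (ltn_ord c).
  by rewrite ler_norml => /andP[h1 h2]; apply/andP; split; move: m1 m2 h1 h2 hq1; clear; lra.
have midnear (c : 'I_q) : `|mid a q c - mid a q c| <= 2 * a / q%:R.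
  by rewrite subrr normr0 ltW.
have fine (c1 c2 : 'I_q) x y : `|x - mid a q c1| <= 2 * a / q%:R ->
    `|y - mid a q c2| <= 2 * a / q%:R ->
    `|Wt (tan x) (tan y) - Wt (tan (mid a q c1)) (tan (mid a q c2))| <= kap.
  move=> hx hy; have nx := near _ _ hx; have ny := near _ _ hy.
  have nmx := near _ _ (midnear c1); have nmy := near _ _ (midnear c2).
  apply: (le_trans (Wt_lip (ltW M0) (tan_le a'p nx) (tan_le a'p ny) (tan_le a'p nmx) (tan_le a'p nmy))).
  apply: le_trans hq2; rewrite /K -mulrA ler_pM2l; last first.
    by rewrite addr_gt0 // mulr_gt0 // exprn_gt0.
  have lx := tan_lip a'p nx nmx; have ly := tan_lip a'p ny nmy.
  have s1 : (1 + M ^+ 2) * `|x - mid a q c1| <= (1 + M ^+ 2) * (2 * a / q%:R).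
    by rewrite ler_pM2l // oneDsq_gt0.
  have s2 : (1 + M ^+ 2) * `|y - mid a q c2| <= (1 + M ^+ 2) * (2 * a / q%:R).
    by rewrite ler_pM2l // oneDsq_gt0.
  by move: lx ly s1 s2; rewrite -/M; clear; lra.
pose w (c1 c2 : 'I_q) := Wt (tan (mid a q c1)) (tan (mid a q c2)).
pose W1 (c1 c2 : 'I_q) := Num.max 0 (w c1 c2 - kap).
pose W2 (c1 c2 : 'I_q) := Num.max 0 (w c2 c1 - kap).
(* The side of a cell in units of the period pi, so that v ^ 2 is the share of one cell in the
   torus. *)
set v := 2 * a / (pi * q%:R).
have vE : v ^+ 2 * pi ^+ 2 = (2 * a / q%:R) ^+ 2 by rewrite -exprMn /v [pi * _]mulrC invfM mulrA divfK.
have vq : v * q%:R <= 1.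
  by rewrite /v invfM mulrA divfK // ler_pdivrMr //; move: ap; clear; lra.
have vq1 : 1 - kap <= v * q%:R.
  by rewrite /v invfM mulrA divfK // ler_pdivlMr //; move: ba; rewrite /b; clear; lra.
have v0 : 0 <= v by rewrite /v divr_ge0 ?mulr_ge0 // ltW.
(* Only rows with midpoint in [- b, b] are kept: each contributes almost pi, and together they fill
   almost a whole period. *)
have T1 : (1 - 2 * kap) ^+ 2 <= v ^+ 2 * \sum_(c1 < q) \sum_(c2 < q) w c1 c2.
  have p2 : 0 < pi ^+ 2 by rewrite exprn_gt0.
  rewrite -(ler_pM2r p2) [leRHS]mulrAC vE exchange_big /= !expr2 -[leRHS]mulrA mulr_sumr.
  apply: (@le_trans _ _ (2 * a / q%:R * \sum_(c2 < q)
     ((`|mid a q c2| <= b)%R : bool)%:R * (pi * (1 - 2 * kap)))); last first.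
    rewrite ler_pM2l //; apply: ler_sum => c2 _.
    have [hc|_] := boolP (`|mid a q c2| <= b); last first.
      rewrite mul0r mulr_ge0 ?(ltW r0) //; apply: sumr_ge0 => c1 _; exact: Wt_ge0.
    rewrite mul1r; have := @row_sum a q (mid a q c2) kap.
    rewrite a0 ap => /(_ isT q0) h.
    have {}h := h _; apply: le_trans (h _).
      rewrite /join_phase tanN tanaE; set Y := tan (mid a q c2).
      have hY : `|Y| <= tan b by apply: tan_le => //; rewrite -ler_norml.
      have -> : - B + Y = - (B - Y) by ring.
      rewrite atanN opprK.
      move: hY; rewrite ler_norml => /andP[Y1 Y2].
      have : b <= atan (B + Y) by rewrite {1}bE; apply: le_atan; rewrite /B; move: Y1 Y2; clear; lra.
      have : b <= atan (B - Y) by rewrite {1}bE; apply: le_atan; rewrite /B; move: Y1 Y2; clear; lra.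
      have : 2 * a * kap <= pi * kap by rewrite ler_pM2r //; move: ap; clear; lra.
      rewrite /b; clear; lra.
    move=> c x hx; have := fine c c2 x (mid a q c2) _ (midnear _).
    have -> : `|x - mid a q c| <= 2 * a / q%:R.
      by apply: (le_trans hx); rewrite r2; have := divr_gt0 a0 qR; clear; lra.
    by move=> /(_ isT); rewrite ler_norml => /andP[_]; clear; lra.
  rewrite -mulr_suml mulrA.
  have bb : 0 <= b <= a by rewrite (ltW b0) ba.
  have := count_mid a0 q0 bb.
  set S := (2 * a / q%:R) * _ => hS.
  have : pi * (1 - 2 * kap) <= S by apply: le_trans hS; rewrite /b; move: hq3; clear; lra.
  have pp : 0 <= pi * (1 - 2 * kap) by rewrite mulr_ge0 ?(ltW p0) //; move: k1; clear; lra.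
  move=> hS'; have -> : (1 - 2 * kap) * (1 - 2 * kap) * (pi * pi) =
    (pi * (1 - 2 * kap)) * (pi * (1 - 2 * kap)) by ring.
  by rewrite ler_wpM2r.
have w_le c1 c2 : w c1 c2 <= 1 + M ^+ 2.
  by apply: Wt_le; [exact: ltW|exact: tan_le (near _ _ (midnear _))].
have badR : \sum_(c1 < q) \sum_(c2 < q) (~~ cell_good q c1 c2)%:R <= 15 * q%:R :> R.
  rewrite -natrM; under eq_bigr do rewrite -natr_sum.
  by rewrite -natr_sum ler_nat bad_count.
have cut (F : 'I_q -> 'I_q -> R) (D : R) : 0 <= D -> (forall c1 c2, F c1 c2 <= D) ->
    \sum_(c1 < q) \sum_(c2 < q) F c1 c2 - 15 * q%:R * D <=
    \sum_(c1 < q) \sum_(c2 < q | cell_good q c1 c2) F c1 c2.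
  move=> D0 hF; rewrite lerBlDr.
  apply: (@le_trans _ _ (\sum_(c1 < q) \sum_(c2 < q | cell_good q c1 c2) F c1 c2 +
     \sum_(c1 < q) \sum_(c2 < q) (~~ cell_good q c1 c2)%:R * D)).
    rewrite -big_split /=; apply: ler_sum => c1 _.
    rewrite (bigID (fun c2 : 'I_q => cell_good q c1 c2)) /= lerD2l.
    rewrite [leRHS](bigID (fun c2 : 'I_q => cell_good q c1 c2)) /= -[leLHS]add0r.
    apply: lerD; first by apply: sumr_ge0 => c2 _; rewrite mulr_ge0.
    by apply: ler_sum => c2 ->; rewrite mul1r.
  rewrite lerD2l; under eq_bigr do rewrite -mulr_suml.
  by rewrite -mulr_suml ler_wpM2r.
have sumW1 : 1 - 6 * kap <= v ^+ 2 * \sum_(c1 < q) \sum_(c2 < q | cell_good q c1 c2) W1 c1 c2.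
  have M1 : 0 <= 1 + M ^+ 2 by exact: ltW (oneDsq_gt0 _).
  have W1le c1 c2 : W1 c1 c2 <= 1 + M ^+ 2.
    by rewrite /W1 ge_max M1 /=; have := w_le c1 c2; move: k0; clear; lra.
  have h1 : \sum_(c1 < q) \sum_(c2 < q) w c1 c2 - kap * (q%:R * q%:R) <=
      \sum_(c1 < q) \sum_(c2 < q) W1 c1 c2.
    have -> : kap * (q%:R * q%:R) = \sum_(c1 < q) \sum_(c2 < q) kap.
      under eq_bigr do rewrite sumr_const card_ord.
      by rewrite sumr_const card_ord -[_ *+ q *+ q]mulr_natr -[kap *+ q]mulr_natr mulrA.
    rewrite -sumrB; apply: ler_sum => c1 _; rewrite -sumrB; apply: ler_sum => c2 _.
    by rewrite /W1 le_max lexx orbT.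
  have h2 := cut W1 _ M1 W1le.
  have v2 : 0 <= v ^+ 2 by rewrite sqr_ge0.
  have h3 : v ^+ 2 * (\sum_(c1 < q) \sum_(c2 < q) w c1 c2 - kap * (q%:R * q%:R) -
     15 * q%:R * (1 + M ^+ 2)) <= v ^+ 2 * \sum_(c1 < q) \sum_(c2 < q | cell_good q c1 c2) W1 c1 c2.
    by apply: ler_wpM2l => //; move: h1 h2; clear; lra.
  apply: le_trans h3.
  have vq2 : (v * q%:R) ^+ 2 <= 1 by rewrite expr_le1 // mulr_ge0 // ltW.
  have h4 : v ^+ 2 * (kap * (q%:R * q%:R)) <= kap.
    have -> : v ^+ 2 * (kap * (q%:R * q%:R)) = kap * (v * q%:R) ^+ 2 by ring.
    by rewrite ler_piMr // ltW.
  have h5 : v ^+ 2 * (15 * q%:R * (1 + M ^+ 2)) <= kap.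
    have -> : v ^+ 2 * (15 * q%:R * (1 + M ^+ 2)) =
       (v * q%:R) ^+ 2 * (15 * (1 + M ^+ 2) / q%:R) by field.
    apply: le_trans hq4; rewrite ler_piMl // divr_ge0 ?(ltW qR) //.
    by rewrite mulr_ge0.
  have : 1 - 4 * kap <= (1 - 2 * kap) ^+ 2.
    by clear; have := sqr_ge0 kap; rewrite !expr2; lra.
  by rewrite !mulrBr; move: T1 h4 h5; clear; lra.
have sumC : 1 - 6 * kap <= v ^+ 2 * \sum_(c1 < q) \sum_(c2 < q | cell_good q c1 c2) 1.
  have h2 := cut (fun _ _ => 1) 1 ler01 (fun _ _ => lexx _).
  have v2 : 0 <= v ^+ 2 by rewrite sqr_ge0.
  have h3 := ler_wpM2l v2 h2; apply: le_trans h3.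
  have -> : \sum_(c1 < q) \sum_(c2 < q) 1 = q%:R * q%:R :> R.
    under eq_bigr do rewrite sumr_const card_ord.
    by rewrite sumr_const card_ord -[q%:R *+ q]mulr_natr.
  have -> : v ^+ 2 * (q%:R * q%:R - 15 * q%:R * 1) = (v * q%:R) ^+ 2 * (1 - 15 / q%:R) by field.
  have h15 : 15 / q%:R <= kap.
    apply: le_trans hq4; rewrite ler_pM2r ?invr_gt0 // ler_peMr //.
    by rewrite lerDl sqr_ge0.
  have h6 : (1 - kap) ^+ 2 <= (v * q%:R) ^+ 2.
    by rewrite lerXn2r ?nnegrE //; [move: k0 k1; clear; lra|rewrite mulr_ge0 // ltW].
  apply: (@le_trans _ _ ((1 - kap) ^+ 2 * (1 - kap))).
    have kk : 0 <= kap * kap by rewrite mulr_ge0 // ltW.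
    have k3 : kap * kap * kap <= kap * kap.
      by rewrite ler_piMr //; move: k1; clear; lra.
    by move: k0 kk k3; clear; rewrite expr2; lra.
  by apply: ler_pM => //; rewrite ?sqr_ge0 //; move: k1 h15; clear; lra.
have etaE : 1 - eta = 1 - 6 * kap by rewrite /kap; clear; lra.
have reveven c1 c2 : w (rev_ord c1) (rev_ord c2) = w c1 c2.
  rewrite /w !midE // !mid_index_rev !mulrNz !mulNr !tanN /Wt sqrrN -opprD sqrrN //.
have T2 : \sum_(c1 < q) \sum_(c2 < q | cell_good q c1 c2) W2 c1 c2 =
    \sum_(c1 < q) \sum_(c2 < q | cell_good q c1 c2) W1 c1 c2.
  rewrite (exchange_big_dep xpredT) //=; apply: eq_bigr => c1 _.
  by apply: eq_bigl => c2; rewrite cell_goodC.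
exists a, q, W1, W2, (1 + M ^+ 2); split.
  split; [by rewrite a0|by []|exact: ltW (oneDsq_gt0 _)|].
  by move=> c1 c2; rewrite /W1 /W2 !le_max !lexx.
split.
  move=> s m; rewrite {}/m -/v etaE.
  have key F : (forall c1 c2, F (rev_ord c1) (rev_ord c2) = F c1 c2) ->
      1 - 6 * kap <= v ^+ 2 * \sum_(c1 < q) \sum_(c2 < q | cell_good q c1 c2) F c1 c2 ->
      (1 - 6 * kap) / 2 <= v ^+ 2 * cellsum F s.
    by move=> Fev; rewrite -(half_sum s Fev) -/(cellsum F s); clear; lra.
  split; apply: key => //; rewrite ?T2 // => c1 c2; by rewrite /W1 /W2 reveven.
have cosr x : - a' <= x <= a' -> - (pi / 2) < x < pi / 2.
  by move=> /andP[n1 n2]; rewrite (lt_le_trans _ n1) ?(le_lt_trans n2) // ltrN2.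
split.
  move=> c1 c2 x y x' y' g hx hx' hy hy' xx yy.
  have /cosr/andP[x1 x2] := near _ _ hx; have /cosr/andP[x1' x2'] := near _ _ hx'.
  have /cosr/andP[y1 y2] := near _ _ hy; have /cosr/andP[y1' y2'] := near _ _ hy'.
  have [c /andP[cx cx'] E1] := join_phase_mvt y' x1 xx x2'.
  have [d /andP[dy dy'] E2] := join_phase_mvt x y1 yy y2'.
  have hc : `|c - mid a q c1| <= 2 * a / q%:R.
    exact: dist_between hx hx' cx cx'.
  have hd : `|d - mid a q c2| <= 2 * a / q%:R.
    exact: dist_between hy hy' dy dy'.
  have -> : join_phase x' y' - join_phase x y = Wt (tan c) (tan y') * (x' - x) + Wt (tan d) (tan x) * (y' - y).
    by rewrite -E1 -E2 (join_phaseC y' x) (join_phaseC y x); ring.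
  have f1 := fine _ _ _ _ hc hy'; have f2 := fine _ _ _ _ hd hx.
  have A1 : W1 c1 c2 <= Wt (tan c) (tan y').
    by rewrite /W1 ge_max Wt_ge0 (norm_lower f1).
  have A2 : W2 c1 c2 <= Wt (tan d) (tan x).
    by rewrite /W2 ge_max Wt_ge0 (norm_lower f2).
  have B1 : Wt (tan c) (tan y') <= 1 + M ^+ 2.
    by apply: Wt_le; [exact: ltW|exact: tan_le (near _ _ hc)].
  have B2 : Wt (tan d) (tan x) <= 1 + M ^+ 2.
    by apply: Wt_le; [exact: ltW|exact: tan_le (near _ _ hd)].
  have X0 : 0 <= x' - x by rewrite subr_ge0.
  have Y0 : 0 <= y' - y by rewrite subr_ge0.
  rewrite [(1 + M ^+ 2) * (_ + _)]mulrDr; apply/andP.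
  by split; apply: lerD; apply: ler_wpM2r.
move=> c1 c2 x y /and3P[g1 g2 g3] hx hy.
have hx' := cosr _ (near _ _ hx); have hy' := cosr _ (near _ _ hy).
have aq : 0 < a / q%:R by rewrite divr_gt0.
have [sx nx] : (x < 0) = (mid_index q c1 < 0) /\ (x != 0).
  by apply: (sign_near aq (k := 2%N)); rewrite // -midE // -r2.
have [sy ny] : (y < 0) = (mid_index q c2 < 0) /\ (y != 0).
  by apply: (sign_near aq (k := 2%N)); rewrite // -midE // -r2.
have [sz nz] : (x + y < 0) = (mid_index q c1 + mid_index q c2 < 0) /\ (x + y != 0).
  apply: (sign_near aq (k := 4%N)) => //; rewrite intrD mulrDl -!midE //.
  have -> : x + y - (mid a q c1 + mid a q c2) = (x - mid a q c1) + (y - mid a q c2) by ring.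
  by apply: (le_trans (ler_normD _ _)); rewrite r2 in hx hy; move: hx hy; clear; lra.
have tx : tan x != 0 by rewrite neq_lt tan_lt0E // tan_gt0E // -neq_lt.
have ty : tan y != 0 by rewrite neq_lt tan_lt0E // tan_gt0E // -neq_lt.
have txy : tan x + tan y != 0 by rewrite neq_lt tanD_lt0 // tanD_gt0 // -neq_lt.
split => //; split => //.
have n1 : mid_index q c1 != 0 by rewrite -absz_gt0; move: g1 g2 g3; clear; lia.
have n2 : mid_index q c2 != 0 by rewrite -absz_gt0; move: g1 g2 g3; clear; lia.
have n3 : mid_index q c1 + mid_index q c2 != 0 by rewrite -absz_gt0; move: g1 g2 g3; clear; lia.
by rewrite /eps !mul3_lt0 // !tan_lt0E // tanD_lt0 // sx sy sz.
Qed.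

End Grid.

(** * Index of quadratic forms *)

Section LinAlg.
Variable R : realType.

Lemma dependent (I T : finType) (g : I -> T -> R) : (#|T| < #|I|)%N ->
  exists c : I -> R, (exists i, c i != 0) /\ forall t, \sum_i c i * g i t = 0.
Proof.
move=> TI; pose A : 'M[R]_(#|I|, #|T|) := \matrix_(i, j) g (enum_val i) (enum_val j).
have : kermx A != 0.
  rewrite -mxrank_eq0 mxrank_ker subn_eq0 -ltnNge; apply: leq_ltn_trans TI.
  exact: rank_leq_col.
move/matrix0Pn => [i [j nz]].
exists (fun k => kermx A i (enum_rank k)); split.
  by exists (enum_val j); rewrite enum_valK.
move=> t; have := mulmx_ker A => /matrixP /(_ i (enum_rank t)); rewrite !mxE => H.
rewrite -[RHS]H [RHS](reindex enum_rank (onW_bij _ (@enum_rank_bij _))) /=.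
by apply: eq_bigr => k _; rewrite !mxE !enum_rankK.
Qed.

Section Forms.
Variable T : finType.
Implicit Types (Q : T -> T -> R) (g h : T -> R).

Definition bil Q g h := \sum_s \sum_t Q s t * g s * h t.

Definition lincomb (I : finType) (c : I -> R) (g : I -> T -> R) : T -> R :=
  fun t => \sum_i c i * g i t.

Lemma bil_lcl Q (I : finType) (c : I -> R) (g : I -> T -> R) h :
  bil Q (lincomb c g) h = \sum_i c i * bil Q (g i) h.
Proof.
rewrite /bil /lincomb; under [RHS]eq_bigr do rewrite mulr_sumr.
rewrite [RHS]exchange_big /=; apply: eq_bigr => s _.
under [RHS]eq_bigr do rewrite mulr_sumr.
rewrite [RHS]exchange_big /=; apply: eq_bigr => t _.
by rewrite mulr_sumr mulr_suml; apply: eq_bigr => i _; ring.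
Qed.

Definition symf Q := forall s t, Q s t = Q t s.

Lemma bilC Q g h : symf Q -> bil Q g h = bil Q h g.
Proof.
move=> sQ; rewrite /bil exchange_big /=; apply: eq_bigr => s _.
by apply: eq_bigr => t _; rewrite sQ; ring.
Qed.

Lemma bil_lcr Q (I : finType) (c : I -> R) (g : I -> T -> R) h : symf Q ->
  bil Q h (lincomb c g) = \sum_i c i * bil Q h (g i).
Proof. by move=> sQ; rewrite bilC // bil_lcl; apply: eq_bigr => i _; rewrite bilC. Qed.

Lemma bilDl Q g g' h : bil Q (fun t => g t + g' t) h = bil Q g h + bil Q g' h.
Proof.
rewrite /bil -big_split /=; apply: eq_bigr => s _.
by rewrite -big_split /=; apply: eq_bigr => t _; ring.
Qed.

(** The index of Q is at least N; strict negativity includes linear independence of the family. *)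
Definition negfam Q N := exists g : 'I_N -> T -> R,
  forall c : 'I_N -> R, (exists i, c i != 0) -> bil Q (lincomb c g) (lincomb c g) < 0.

Definition nullfam Q N := exists g : 'I_N -> T -> R,
  (forall i h, bil Q (g i) h = 0) /\
  (forall c : 'I_N -> R, (forall t, lincomb c g t = 0) -> forall i, c i = 0).

Lemma lincomb_inj (I J : finType) (phi : J -> I) (c : J -> R) (g : I -> T -> R) t :
  injective phi ->
  lincomb c (fun j => g (phi j)) t = lincomb (fun i => \sum_(j | phi j == i) c j) g t.
Proof.
move=> inj; rewrite /lincomb (partition_big phi xpredT) //=; apply: eq_bigr => i _.
by rewrite mulr_suml; apply: eq_bigr => j /eqP ->.
Qed.

Lemma negfam_sub Q (I : finType) (g : I -> T -> R) N : (N <= #|I|)%N ->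
  (forall c : I -> R, (exists i, c i != 0) -> bil Q (lincomb c g) (lincomb c g) < 0) ->
  negfam Q N.
Proof.
move=> NI hg; pose phi (j : 'I_N) : I := enum_val (widen_ord NI j).
have inj : injective phi by move=> j k /enum_val_inj /(congr1 val) /= /val_inj.
exists (fun j => g (phi j)) => c [j weight].
have -> : lincomb c (fun j => g (phi j)) = lincomb (fun i => \sum_(j | phi j == i) c j) g.
  by apply/funext => t; apply: lincomb_inj.
apply: hg; exists (phi j); rewrite (eq_bigl (pred1 j)) ?big_pred1_eq //.
by move=> k /=; rewrite (inj_eq inj).
Qed.

Definition orth Q (I : finType) (f : I -> T -> R) :=
  forall i j, i != j -> bil Q (f i) (f j) = 0.

Lemma bil_lincomb_orth Q (I : finType) (f : I -> T -> R) (c : I -> R) i : symf Q -> orth Q f ->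
  bil Q (lincomb c f) (f i) = c i * bil Q (f i) (f i).
Proof.
move=> sQ of_; rewrite bil_lcl (bigD1 i) //= big1 ?addr0 // => j ji.
by rewrite of_ // mulr0.
Qed.

Lemma bil_lincomb2_orth Q (I : finType) (f : I -> T -> R) (c : I -> R) : symf Q -> orth Q f ->
  bil Q (lincomb c f) (lincomb c f) = \sum_i c i ^+ 2 * bil Q (f i) (f i).
Proof.
move=> sQ of_; rewrite bil_lcr //; apply: eq_bigr => i _.
by rewrite bil_lincomb_orth // mulrA expr2.
Qed.

Lemma bil0l Q h : bil Q (fun=> 0) h = 0.
Proof. by rewrite /bil big1 // => s _; rewrite big1 // => t _; rewrite mulr0 mul0r. Qed.

Lemma orth_indep Q (I : finType) (f : I -> T -> R) (c : I -> R) : symf Q -> orth Q f ->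
  (forall i, bil Q (f i) (f i) != 0) -> (forall t, lincomb c f t = 0) -> forall i, c i = 0.
Proof.
move=> sQ of_ nz h i; have := bil_lincomb_orth c i sQ of_.
have -> : lincomb c f = (fun=> 0) by apply/funext.
by rewrite bil0l => /esym /eqP; rewrite mulf_eq0 (negbTE (nz i)) orbF => /eqP.
Qed.

(** A family of maximal size is taken: a vector orthogonal to it and not isotropic could be added to
    it. *)
Lemma max_orth Q : symf Q -> exists (r : nat) (f : 'I_r -> T -> R),
  [/\ orth Q f, (forall i, bil Q (f i) (f i) != 0) &
   forall v, (forall i, bil Q (f i) v = 0) -> bil Q v v = 0].
Proof.
move=> sQ.
pose P r := `[< exists f : 'I_r -> T -> R, orth Q f /\ forall i, bil Q (f i) (f i) != 0 >].
have P0 : exists r, P r.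
  by exists 0%N; apply/asboolP; exists (fun _ _ => 0); split => -[].
have Pn r : P r -> (r <= #|T|)%N.
  move=> /asboolP[f [of_ nz]]; rewrite leqNgt; apply/negP; rewrite -{1}(card_ord r) => h.
  have [c [[i ci] hc]] := dependent f h.
  by move: ci; rewrite (orth_indep sQ of_ nz hc) eqxx.
case: (ex_maxnP P0 Pn) => r /asboolP[f [of_ nz]] mx.
exists r, f; split => // v hv; apply/eqP; apply: contraT => nv.
suff : P r.+1 by move/mx; rewrite ltnn.
apply/asboolP; exists (fun i => oapp f v (unlift ord_max i)); split; last first.
  by move=> i; case: unliftP => [j|] _ /=.
move=> i j; case: unliftP => [i' ->|->]; case: unliftP => [j' ->|->] //= ij.
- by apply: of_; apply: contraNneq ij => ->.
- by rewrite bilC.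
- by rewrite eqxx in ij.
Qed.

Lemma bilDr Q g h h' : bil Q g (fun t => h t + h' t) = bil Q g h + bil Q g h'.
Proof.
rewrite /bil -big_split /=; apply: eq_bigr => s _.
by rewrite -big_split /=; apply: eq_bigr => t _; ring.
Qed.

(** Polarisation: the diagonal of Q vanishes on the orthogonal complement, hence so does Q, and
    every h enters the complement once its projection is subtracted. *)
Lemma max_orth_null Q (r : nat) (f : 'I_r -> T -> R) v : symf Q -> orth Q f ->
  (forall i, bil Q (f i) (f i) != 0) ->
  (forall v, (forall i, bil Q (f i) v = 0) -> bil Q v v = 0) ->
  (forall i, bil Q (f i) v = 0) -> forall h, bil Q v h = 0.
Proof.
move=> sQ of_ nz mx hv h.
pose c i := - (bil Q (f i) h / bil Q (f i) (f i)).
pose w t := h t + lincomb c f t.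
have hw i : bil Q (f i) w = 0.
  rewrite /w bilDr (bilC _ (lincomb c f)) // bil_lincomb_orth // /c mulNr divfK // subrr //.
have pol : bil Q v w = 0.
  clearbody w.
  have hvw i : bil Q (f i) (fun t => v t + w t) = 0 by rewrite bilDr hv hw addr0.
  have := mx _ hvw; rewrite bilDl !bilDr (mx _ hv) (mx _ hw) (bilC w v sQ) add0r addr0.
  by move=> /eqP; rewrite -mulr2n mulrn_eq0 /= => /eqP.
move: pol; rewrite /w bilDr bilC // bil_lcr // big1 ?addr0 // ?(bilC h) // => i _.
by rewrite (bilC v) // hv mulr0.
Qed.

Lemma solutions (r : nat) (L : 'I_r -> T -> R) : exists z : 'I_(#|T| - r) -> T -> R,
  (forall i j, \sum_t L i t * z j t = 0) /\
  (forall c : 'I_(#|T| - r) -> R, (forall t, lincomb c z t = 0) -> forall j, c j = 0).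
Proof.
pose B : 'M[R]_(#|T|, r) := \matrix_(i, j) L j (enum_val i).
have rk : (#|T| - r <= \rank (kermx B))%N.
  by rewrite mxrank_ker leq_sub2l // rank_leq_col.
pose Z := row_base (kermx B).
exists (fun j t => Z (widen_ord rk j) (enum_rank t)); split.
  move=> i j; have : Z *m B = 0.
    by apply/sub_kermxP; rewrite eq_row_base.
  move=> /matrixP /(_ (widen_ord rk j) i); rewrite !mxE => H; rewrite -[RHS]H.
  rewrite [RHS](reindex enum_rank (onW_bij _ (@enum_rank_bij _))) /=; apply: eq_bigr => t _.
  by rewrite [B _ _]mxE enum_rankK mulrC.
move=> c hc j; pose u : 'rV[R]_(\rank (kermx B)) :=
  \row_k (\sum_(j | widen_ord rk j == k) c j).
have : u *m Z = 0.
  apply/rowP => k; rewrite !mxE -[RHS](hc (enum_val k)) /lincomb.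
  rewrite [RHS](partition_big (widen_ord rk) xpredT) //=; apply: eq_bigr => i _.
  by rewrite mxE mulr_suml; apply: eq_bigr => l /eqP <-; rewrite enum_valK.
move=> /eqP; rewrite mulmx_free_eq0 ?row_base_free // => /eqP/rowP/(_ (widen_ord rk j)).
by rewrite !mxE (eq_bigl (pred1 j)) ?big_pred1_eq // => k /=.
Qed.

(** With d a positive lower bound of the diagonal, the form is at least d times the sum of the
    squared coefficients, and a small perturbation of the entries changes it by at most half of
    that. *)
Lemma pos_open Q0 (I : finType) (f : I -> T -> R) : symf Q0 -> orth Q0 f ->
  (forall i, 0 < bil Q0 (f i) (f i)) ->
  exists2 e : R, 0 < e & forall Q, (forall s t, `|Q s t - Q0 s t| <= e) ->
    forall c : I -> R, (exists i, c i != 0) -> 0 < bil Q (lincomb c f) (lincomb c f).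
Proof.
move=> sQ of_ pf.
have [d d0 hd] : exists2 d : R, 0 < d & forall i, d <= bil Q0 (f i) (f i).
  exists (\big[Num.min/1]_i bil Q0 (f i) (f i)); last by move=> i; apply: bigmin_le_cond.
  by elim/big_ind: _ => // x y x0 y0; rewrite lt_min x0.
pose K := \sum_i \sum_j \sum_s \sum_t `|f i s * f j t|.
have K0 : 0 <= K by do 4 (apply: sumr_ge0 => ? _).
have Kij i j : \sum_s \sum_t `|f i s * f j t| <= K.
  rewrite /K (bigD1 i) //= (bigD1 j) //= -addrA lerDl addr_ge0 //.
    by apply: sumr_ge0 => ? _; do 2 (apply: sumr_ge0 => ? _).
  by do 4 (apply: sumr_ge0 => ? _).
pose m := #|I|%:R + 1 : R.
have m0 : 0 < m by rewrite ltr_wpDl.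
have k1 : 0 < K + 1 by rewrite ltr_wpDl.
exists (d / (2 * m * (K + 1))); first by rewrite divr_gt0 // !mulr_gt0.
move=> Q hQ c [i0 ci0].
pose D i j := bil Q (f i) (f j) - bil Q0 (f i) (f j).
have hD i j : `|D i j| <= d / (2 * m).
  rewrite /D /bil -sumrB.
  apply: (@le_trans _ _ (d / (2 * m * (K + 1)) * (\sum_s \sum_t `|f i s * f j t|))).
    rewrite mulr_sumr; apply: (le_trans (ler_norm_sum _ _ _)); apply: ler_sum => s _.
    rewrite -sumrB mulr_sumr; apply: (le_trans (ler_norm_sum _ _ _)); apply: ler_sum => t _.
    have -> : Q s t * f i s * f j t - Q0 s t * f i s * f j t =
      (Q s t - Q0 s t) * (f i s * f j t) by ring.
    by rewrite normrM ler_wpM2r.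
  apply: (@le_trans _ _ (d / (2 * m * (K + 1)) * (K + 1))).
    rewrite ler_wpM2l //; first by rewrite divr_ge0 ?ltW // !mulr_gt0.
    by apply: (le_trans (Kij i j)); rewrite lerDl.
  by rewrite invfM mulrA divfK // gt_eqF.
pose S := \sum_i c i ^+ 2.
have S0 : 0 < S.
  rewrite /S (bigD1 i0) //= ltr_pwDl //; first by rewrite exprn_even_gt0.
  by apply: sumr_ge0 => i _; rewrite sqr_ge0.
have E : bil Q (lincomb c f) (lincomb c f) = bil Q0 (lincomb c f) (lincomb c f) + \sum_i \sum_j c i * c j * D i j.
  have ex Q' : bil Q' (lincomb c f) (lincomb c f) = \sum_i \sum_j c i * c j * bil Q' (f i) (f j).
    rewrite bil_lcl; apply: eq_bigr => i _; rewrite {1}/bil.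
    rewrite /lincomb mulr_sumr; under eq_bigr do rewrite mulr_sumr.
    under eq_bigr do under eq_bigr do rewrite mulr_sumr mulr_sumr.
    under eq_bigr do rewrite exchange_big /=.
    rewrite exchange_big /=; apply: eq_bigr => j _; rewrite /bil mulr_sumr.
    apply: eq_bigr => s _; rewrite mulr_sumr; apply: eq_bigr => t _; ring.
  rewrite !ex -big_split /=; apply: eq_bigr => i _; rewrite -big_split /=.
  by apply: eq_bigr => j _; rewrite /D; ring.
have h1 : d * S <= bil Q0 (lincomb c f) (lincomb c f).
  rewrite bil_lincomb2_orth // /S mulr_sumr; apply: ler_sum => i _.
  by rewrite mulrC ler_wpM2l // sqr_ge0.
have h2 : `|\sum_i \sum_j c i * c j * D i j| <= d / (2 * m) * (#|I|%:R * S).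
  apply: (@le_trans _ _ (\sum_i \sum_j (d / (2 * m)) * ((c i ^+ 2 + c j ^+ 2) / 2))).
    apply: (le_trans (ler_norm_sum _ _ _)); apply: ler_sum => i _.
    apply: (le_trans (ler_norm_sum _ _ _)); apply: ler_sum => j _.
    rewrite normrM mulrC; apply: ler_pM => //.
    rewrite normrM -(real_normK (num_real (c i))) -(real_normK (num_real (c j))).
    by have := sqr_ge0 (`|c i| - `|c j|); rewrite sqrrB; lra.
  under eq_bigr do rewrite -mulr_sumr.
  rewrite -mulr_sumr ler_wpM2l //; first by rewrite divr_ge0 ?ltW // mulr_gt0.
  under eq_bigr do rewrite -mulr_suml big_split /= sumr_const.
  rewrite -mulr_suml big_split /= sumr_const sumrMnl -/S -[S *+ _]mulr_natl; lra.
have h3 : d / (2 * m) * (#|I|%:R * S) <= d * S / 2.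
  have -> : d / (2 * m) * (#|I|%:R * S) = d * S / 2 * (#|I|%:R / m) by rewrite invfM; ring.
  rewrite ler_piMr //; first by rewrite divr_ge0 // mulr_ge0 // ltW.
  by rewrite ler_pdivrMr // mul1r /m lerDl.
have h4 : 0 < d * S by rewrite mulr_gt0.
rewrite E; move: h2; rewrite ler_norml => /andP[h2 _]; lra.
Qed.

Lemma nullfam_sub Q N M : (M <= N)%N -> nullfam Q N -> nullfam Q M.
Proof.
move=> MN [z [hz iz]]; exists (fun j => z (widen_ord MN j)); split=> [i h|c hc j].
  exact: hz.
have inj : injective (widen_ord MN) by move=> i k /(congr1 val) /= /val_inj.
have H t : lincomb (fun i => \sum_(j | widen_ord MN j == i) c j) z t = 0.
  by rewrite -(lincomb_inj c z t inj).
have := iz _ H (widen_ord MN j).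
by rewrite (eq_bigl (pred1 j)) ?big_pred1_eq // => k /=; rewrite (inj_eq inj).
Qed.

Lemma lincomb_sum (I J : finType) (c : I + J -> R) (g : I + J -> T -> R) t :
  lincomb c g t = lincomb (fun i => c (inl i)) (fun i => g (inl i)) t +
             lincomb (fun j => c (inr j)) (fun j => g (inr j)) t.
Proof. by rewrite /lincomb big_sumType. Qed.

Lemma lincombN (I : finType) (c : I -> R) (g : I -> T -> R) t :
  lincomb (fun i => - c i) g t = - lincomb c g t.
Proof. by rewrite /lincomb -sumrN; apply: eq_bigr => i _; rewrite mulNr. Qed.

Lemma lincomb0 (I : finType) (c : I -> R) (g : I -> T -> R) :
  (forall i, c i = 0) -> lincomb c g = (fun=> 0).
Proof. by move=> h; apply/funext => t; rewrite /lincomb big1 // => i _; rewrite h mul0r. Qed.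

Section Inertia.
Variables (Q : T -> T -> R) (r : nat) (f : 'I_r -> T -> R).
Hypotheses (sQ : symf Q) (of_ : orth Q f) (nz : forall i, bil Q (f i) (f i) != 0).
Hypothesis mx : forall v, (forall i, bil Q (f i) v = 0) -> bil Q v v = 0.

Let Ip := {i : 'I_r | 0 < bil Q (f i) (f i)}.
Let In := {i : 'I_r | ~~ (0 < bil Q (f i) (f i))}.

Lemma inertia_card : (#|{: Ip}| + #|{: In}| = r)%N.
Proof. by rewrite !card_sig -[RHS](card_ord r) -(cardC (fun i => 0 < bil Q (f i) (f i))). Qed.

Lemma inertia_r : (r <= #|T|)%N.
Proof.
rewrite leqNgt; apply/negP; rewrite -{1}(card_ord r) => h.
have [c [[i ci] hc]] := dependent f h.
by move: ci; rewrite (orth_indep sQ of_ nz hc) eqxx.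
Qed.

Lemma inertia_null : nullfam Q (#|T| - r).
Proof.
have [z [hz iz]] := solutions (fun i t => \sum_s Q s t * f i s).
exists z; split => // j h; apply: (max_orth_null sQ of_ nz mx) => i.
rewrite -[RHS](hz i j) /bil exchange_big /=; apply: eq_bigr => t _.
by rewrite mulr_suml.
Qed.

Lemma orth_sub (I : finType) (phi : I -> 'I_r) : injective phi -> orth Q (fun i => f (phi i)).
Proof. by move=> inj i j ij; apply: of_; rewrite (inj_eq inj). Qed.

Lemma inertia_neg_lt (c : In -> R) : (exists i, c i != 0) ->
  bil Q (lincomb c (fun i => f (val i))) (lincomb c (fun i => f (val i))) < 0.
Proof.
move=> [i0 ci0]; rewrite bil_lincomb2_orth //; last exact: (orth_sub val_inj).
have neg (i : In) : bil Q (f (val i)) (f (val i)) < 0.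
  by have := valP i; rewrite -leNgt le_eqVlt (negbTE (nz _)).
rewrite (bigD1 i0) //= ltr_wnDr //.
  by apply: sumr_le0 => i _; apply: mulr_ge0_le0; [exact: sqr_ge0|exact: ltW (neg i)].
by rewrite pmulr_rlt0 ?exprn_even_gt0 //; exact: neg.
Qed.

(** Sylvester's law of inertia: a larger negative family together with the positive and the null
    vectors would exceed the dimension, and a dependence would equate a negative value of Q with a
    nonnegative one. *)
Lemma inertia_neg_le N : negfam Q N -> (N <= #|{: In}|)%N.
Proof.
move=> [g hg]; have [z [hz iz]] := inertia_null.
rewrite leqNgt; apply/negP => lt.
pose G (x : 'I_N + (Ip + 'I_(#|T| - r))) : T -> R :=
  match x with inl i => g i | inr (inl i) => f (val i) | inr (inr i) => z i end.
have card : (#|T| < #|{: 'I_N + (Ip + 'I_(#|T| - r))}|)%N.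
  rewrite !card_sum !card_ord; move: lt inertia_card inertia_r; clear.
  by move: #|{: Ip}| #|{: In}| #|T| => x y w; lia.
have [c [[x cx] hc]] := dependent G card.
pose a i := c (inl i); pose b i := c (inr (inl i)); pose d i := c (inr (inr i)).
have E t : lincomb a g t + (lincomb b (fun i => f (val i)) t + lincomb d z t) = 0.
  by rewrite -[RHS](hc t) -/(lincomb c G t) lincomb_sum; congr (_ + _); rewrite lincomb_sum.
have zl h : bil Q (lincomb d z) h = 0.
  by rewrite bil_lcl big1 // => i _; rewrite hz mulr0.
have [[i ai]|na] := pselect (exists i, a i != 0).
  have := hg a (ex_intro _ i ai).
  have -> : lincomb a g = (fun t => lincomb (fun i => - b i) (fun i => f (val i)) t + lincomb (fun i => - d i) z t).
    by apply/funext => t; rewrite !lincombN; have := E t; lra.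
  have zl' h : bil Q (lincomb (fun i => - d i) z) h = 0.
    by rewrite bil_lcl big1 // => j _; rewrite hz mulr0.
  rewrite bilDl !bilDr !zl' (bilC _ (lincomb (fun i => - d i) z)) // zl' !addr0.
  rewrite bil_lincomb2_orth //; last exact: (orth_sub val_inj).
  rewrite ltNge sumr_ge0 // => j _; rewrite mulr_ge0 ?sqr_ge0 // ltW //; exact: (valP j).
have a0 i : a i = 0 by apply/eqP; apply: contraT => h; case: na; exists i.
have E2 t : lincomb b (fun i => f (val i)) t + lincomb d z t = 0.
  by have := E t; rewrite (lincomb0 g a0) add0r.
have b0 i : b i = 0.
  have := bil_lincomb_orth b i sQ (orth_sub val_inj).
  have -> : lincomb b (fun i => f (val i)) = lincomb (fun i => - d i) z.
    by apply/funext => t; rewrite lincombN; have := E2 t; lra.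
  rewrite bil_lcl big1 => [|j _]; last by rewrite hz mulr0.
  by move=> /esym/eqP; rewrite mulf_eq0 (negbTE (nz _)) orbF => /eqP.
have d0 i : d i = 0.
  by apply: (iz d) => t; have := E2 t; rewrite (lincomb0 _ b0) add0r.
move: cx; case: x => [i|[i|i]].
- by rewrite -/(a i) a0 eqxx.
- by rewrite -/(b i) b0 eqxx.
- by rewrite -/(d i) d0 eqxx.
Qed.

End Inertia.

(** Lower semicontinuity of the index. The given family is exchanged for the negative vectors of an
    orthogonal one, at least as many by inertia, because [pos_open] starts from orthogonality. *)
Lemma neg_open Q0 N : symf Q0 -> negfam Q0 N -> exists2 e : R, 0 < e &
  forall Q, (forall s t, `|Q s t - Q0 s t| <= e) -> negfam Q N.
Proof.
move=> sQ hN; have [r [f [of_ nz mx]]] := max_orth sQ.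
have NI := inertia_neg_le sQ of_ nz mx hN.
pose In := {i : 'I_r | ~~ (0 < bil Q0 (f i) (f i))}.
have bilN Q g h : bil (fun s t => - Q s t) g h = - bil Q g h.
  rewrite /bil -sumrN; apply: eq_bigr => s _; rewrite -sumrN; apply: eq_bigr => t _; ring.
have [||i|e e0 he] := @pos_open (fun s t => - Q0 s t) In (fun i => f (val i)).
- by move=> s t; rewrite sQ.
- by move=> i j ij; rewrite bilN of_ ?oppr0 // (inj_eq val_inj).
- by rewrite bilN oppr_gt0; have := valP i; rewrite -leNgt le_eqVlt (negbTE (nz _)).
exists e => // Q hQ; apply: (@negfam_sub Q In (fun i => f (val i))) => // c hc.
rewrite -oppr_gt0 -bilN; apply: he => // s t.
by rewrite -opprD normrN; exact: hQ.
Qed.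

(** The positive vectors of Q0 stay positive for nearby forms, so the index of such a form exceeds
    that of Q0 by at most the nullity of Q0. *)
Lemma neg_jump Q0 : symf Q0 -> exists2 e : R, 0 < e &
  forall Q, (forall s t, `|Q s t - Q0 s t| <= e) -> forall N, negfam Q N ->
  exists M, [/\ (M <= N)%N, negfam Q0 M & nullfam Q0 (N - M)].
Proof.
move=> sQ; have [r [f [of_ nz mx]]] := max_orth sQ.
pose Ip := {i : 'I_r | 0 < bil Q0 (f i) (f i)}.
pose In := {i : 'I_r | ~~ (0 < bil Q0 (f i) (f i))}.
have [|i|e e0 he] := @pos_open Q0 Ip (fun i => f (val i)) sQ.
- by move=> i j ij; rewrite of_ // (inj_eq val_inj).
- exact: (valP i).
exists e => // Q hQ N [g hg].
have NI : (N <= #|T| - #|{: Ip}|)%N.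
  rewrite leqNgt; apply/negP => lt.
  pose G (x : 'I_N + Ip) : T -> R := match x with inl i => g i | inr i => f (val i) end.
  have card : (#|T| < #|{: 'I_N + Ip}|)%N by rewrite card_sum card_ord; move: lt; clear; move: #|{: Ip}| #|T| => x y; lia.
  have [c [[x cx] hc]] := dependent G card.
  pose a i := c (inl i); pose b i := c (inr i).
  have E t : lincomb a g t + lincomb b (fun i => f (val i)) t = 0.
    by rewrite -[RHS](hc t) -/(lincomb c G t) lincomb_sum.
  have bge b' : 0 <= bil Q (lincomb b' (fun i : Ip => f (val i))) (lincomb b' (fun i : Ip => f (val i))).
    have [h|h] := pselect (exists i, b' i != 0); first by apply/ltW; apply: he.
    rewrite (lincomb0 _ (_ : forall i, b' i = 0)) ?bil0l // => i.
    by apply/eqP; apply: contraT => hi; case: h; exists i.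
  have [ha|na] := pselect (exists i, a i != 0).
    have := hg a ha; rewrite ltNge.
    have -> : lincomb a g = lincomb (fun i => - b i) (fun i : Ip => f (val i)).
      by apply/funext => t; rewrite lincombN; have := E t; lra.
    by rewrite bge.
  have a0 i : a i = 0 by apply/eqP; apply: contraT => h; case: na; exists i.
  have E2 : lincomb b (fun i : Ip => f (val i)) = (fun=> 0).
    by apply/funext => t; have := E t; rewrite (lincomb0 g a0) add0r.
  case: x cx => [i|i] cx; first by move: cx; rewrite -/(a i) a0 eqxx.
  by have := he Q hQ b (ex_intro _ i cx); rewrite E2 bil0l ltxx.
exists (minn N #|{: In}|); split; first exact: geq_minl.
  apply: (@negfam_sub Q0 In (fun i => f (val i))); first exact: geq_minr.
  by move=> c; apply: (inertia_neg_lt sQ of_ nz).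
apply: (@nullfam_sub _ (#|T| - r)); last exact: (inertia_null sQ of_ nz mx).
have := inertia_card Q0 f; rewrite -/Ip -/In => card.
by rewrite minnE; lia.
Qed.

End Forms.
End LinAlg.

(** * Counting eigenvalues *)

Section ODE.
Variable R : realType.

Definition der (f f' : R -> R) := forall x : R, is_derive x 1 f (f' x).

Definition ode (lam : R) (f : R -> R) := forall x : R, derivable f x 1 /\
  derivable (derive1 f) x 1 /\ derive1 (derive1 f) x = - lam * f x.

Lemma der_derive1 f f' : der f f' -> derive1 f = f'.
Proof. by move=> h; apply/funext => x; rewrite derive1E; have [_] := h x. Qed.

Lemma derivable_der (f : R -> R) : (forall x : R, derivable f x 1) -> der f (derive1 f).
Proof. by move=> h x; rewrite derive1E; apply/derivableP. Qed.

Lemma ode_der1 lam (f : R -> R) : ode lam f -> der f (derive1 f).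
Proof. by move=> h; apply: derivable_der => x; have [] := h x. Qed.

Lemma ode_der2 lam (f : R -> R) : ode lam f -> der (derive1 f) (fun x => - lam * f x).
Proof.
move=> h x; have [_ [d2 <-]] := h x; rewrite derive1E.
exact/derivableP.
Qed.

Lemma der_ode lam f f' : der f f' -> der f' (fun x => - lam * f x) -> ode lam f.
Proof.
move=> h1 h2 x; rewrite (der_derive1 h1) (der_derive1 h2); split; first by have [] := h1 x.
by split => //; have [] := h2 x.
Qed.

Lemma derD f f' g g' : der f f' -> der g g' -> der (fun x => f x + g x) (fun x => f' x + g' x).
Proof. by move=> hf hg x; have := hf x; have := hg x => ? ?; apply: is_derive_eq. Qed.

Lemma derM f f' g g' : der f f' -> der g g' ->
  der (fun x => f x * g x) (fun x => f' x * g x + f x * g' x).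
Proof.
move=> hf hg x; have := hf x; have := hg x => d1 d2.
apply: is_derive_eq; rewrite /GRing.scale /=; ring.
Qed.

Lemma derZ a f f' : der f f' -> der (fun x => a * f x) (fun x => a * f' x).
Proof.
move=> hf; have dc : der (fun=> a) (fun=> 0) by move=> x; exact: is_derive_cst.
by move=> x; have := derM dc hf x; rewrite mul0r add0r.
Qed.

Lemma der_sum (I : finType) (f f' : I -> R -> R) : (forall i, der (f i) (f' i)) ->
  der (fun x => \sum_i f i x) (fun x => \sum_i f' i x).
Proof.
move=> h; rewrite -[index_enum I]/(index_enum I).
elim: (index_enum I) => [|i r IH] x.
  rewrite big_nil (_ : (fun _ => _) = cst 0) ?funeqE => [|y]; last by rewrite big_nil.
  exact: is_derive_cst.
have := derD (h i) IH x; rewrite big_cons.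
by congr is_derive; apply/funext => y; rewrite big_cons.
Qed.

Lemma der_cos k : der (fun x => cos (k * x)) (fun x => - k * sin (k * x)).
Proof.
move=> x; have d : is_derive x 1 (fun y : R => k * y) k.
  by apply: (is_derive_eq (is_deriveZ k (is_derive_id x 1))); rewrite /GRing.scale /= mulr1.
by apply: (is_derive_eq (@is_derive1_comp R cos (fun y => k * y) x _ _ (is_derive_cos _) d)); ring.
Qed.

Lemma der_sin k : der (fun x => sin (k * x)) (fun x => k * cos (k * x)).
Proof.
move=> x; have d : is_derive x 1 (fun y : R => k * y) k.
  by apply: (is_derive_eq (is_deriveZ k (is_derive_id x 1))); rewrite /GRing.scale /= mulr1.
by apply: (is_derive_eq (@is_derive1_comp R sin (fun y => k * y) x _ _ (is_derive_sin _) d)); ring.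
Qed.

Definition trigf (k a b x : R) := a * cos (k * x) + b * sin (k * x).
Definition trigf' (k a b x : R) := k * (b * cos (k * x) - a * sin (k * x)).

Lemma der_eq f f' g' : (forall x, f' x = g' x) -> der f f' -> der f g'.
Proof. by move=> h d x; rewrite -h. Qed.

Lemma der_trigf k a b : der (trigf k a b) (trigf' k a b).
Proof.
apply: der_eq (derD (derZ a (der_cos k)) (derZ b (der_sin k))) => x.
by rewrite /trigf'; ring.
Qed.

Lemma der_trigf' k a b : der (trigf' k a b) (fun x => - (k ^+ 2) * trigf k a b x).
Proof.
have h := derZ k (derD (derZ b (der_cos k)) (derZ (- a) (der_sin k))).
apply: der_eq (_ : der _ _) => [|x]; last first.
  have := h x; congr is_derive; apply/funext => y; rewrite /trigf'; ring.
by move=> x; rewrite /trigf; ring.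
Qed.

Lemma trigf_ode k a b : ode (k ^+ 2) (trigf k a b).
Proof. exact: der_ode (der_trigf k a b) (der_trigf' k a b). Qed.

Lemma derive1_trigf k a b : derive1 (trigf k a b) = trigf' k a b.
Proof. exact: der_derive1 (der_trigf k a b). Qed.

(** Rotating the vector (f, f' / k) by the angle k x gives two functions [A] and [B] with derivative
    0. *)
Lemma ode_trig k f : k != 0 -> ode (k ^+ 2) f ->
  f = trigf k (f 0) (derive1 f 0 / k).
Proof.
move=> k0 hf; have d1 := ode_der1 hf; have d2 := ode_der2 hf.
set A := fun x => f x * cos (k * x) - derive1 f x / k * sin (k * x).
set B := fun x => f x * sin (k * x) + derive1 f x / k * cos (k * x).
have dA (x : R) : is_derive x 1 A 0.
  have := derD (derM d1 (der_cos k)) (derZ (- k^-1) (derM d2 (der_sin k))) x.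
  congr is_derive; last by field.
  by apply/funext => y; rewrite /A; ring.
have dB (x : R) : is_derive x 1 B 0.
  have := derD (derM d1 (der_sin k)) (derZ (k^-1) (derM d2 (der_cos k))) x.
  congr is_derive; last by field.
  by apply/funext => y; rewrite /B; ring.
apply/funext => x; have hA := is_derive_0_is_cst x 0 dA; have hB := is_derive_0_is_cst x 0 dB.
have : f x = A x * cos (k * x) + B x * sin (k * x).
  rewrite /A /B -[LHS]mulr1 -(cos2Dsin2 (k * x)); ring.
move=> ->; rewrite hA hB /trigf /A /B mulr0 cos0 sin0.
by rewrite !mulr0 !mulr1 subr0 add0r.
Qed.

Lemma der_zero f f' l : 0 < l -> der f f' -> (forall x, 0 < x < l -> f x = 0) ->
  forall x, 0 < x < l -> f' x = 0.
Proof.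
move=> l0 d h x xl; have [_ <-] := d x.
rewrite (near_eq_derive (g := cst 0)); first exact: derive_cst.
have : \forall y \near x, y \in `]0, l[ by apply: near_in_itvoo; rewrite in_itv.
by apply: filterS => y; rewrite in_itv => /h.
Qed.

Lemma der_cont f f' : der f f' -> continuous f.
Proof.
move=> d x; apply/differentiable_continuous; rewrite -derivable1_diffP.
by have [] := d x.
Qed.

(** Relations between eigenfunctions are known on the edges only: differentiating them confines them
    to the open edge, and continuity restores the end points. *)
Lemma zero_closed f f' l : 0 < l -> der f f' -> (forall x, 0 < x < l -> f x = 0) ->
  forall x, 0 <= x <= l -> f x = 0.
Proof.
move=> l0 d h x /andP[x0 xl]; apply/eqP; apply: contraT => nz.
have /cvgr_neq0 /(_ nz) : f y @[y --> x] --> f x by exact: der_cont d x.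
move=> /nbhs_ballP[e /= e0 he].
pose m := Num.min (e / 2) (l / 2).
have m0 : 0 < m by rewrite lt_min; apply/andP; split; lra.
have me : m <= e / 2 by rewrite ge_min lexx.
have ml : m <= l / 2 by rewrite ge_min lexx orbT.
pose y := if x <= l / 2 then x + m / 2 else x - m / 2.
have hy : 0 < y < l by rewrite /y; case: ifPn => [|]; rewrite -?ltNge => hx; apply/andP; split; lra.
have : f y != 0.
  apply: he; rewrite /ball /= /y; case: ifPn => _.
    by rewrite opprD addNKr normrN gtr0_norm; lra.
  by rewrite opprB addrC subrK gtr0_norm; lra.
by rewrite (h y hy) eqxx.
Qed.

(* f f' is nondecreasing, so equal end values force f' = 0. *)
Lemma nonpos_flat lam f l : lam <= 0 -> 0 < l -> ode lam f ->
  f 0 * derive1 f 0 <= f l * derive1 f l /\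
  (f 0 * derive1 f 0 = f l * derive1 f l -> forall x, 0 <= x <= l -> f x = f 0).
Proof.
move=> lam0 l0 hf; have d1 := ode_der1 hf; have d2 := ode_der2 hf.
pose P x := f x * derive1 f x.
have dP : der P (fun x => (derive1 f x) ^+ 2 - lam * f x ^+ 2).
  by apply: der_eq (derM d1 d2) => x; ring.
have Pge x : 0 <= (derive1 f x) ^+ 2 - lam * f x ^+ 2.
  by rewrite addr_ge0 ?sqr_ge0 // -mulNr mulr_ge0 ?sqr_ge0 // oppr_ge0.
have mono x y : x <= y -> P x <= P y.
  move=> xy; have [c _] := mvt xy (fun u _ => dP u).
  by move=> E; rewrite -subr_ge0 E mulr_ge0 // subr_ge0.
split; first exact: mono (ltW l0).
move=> E; have cst x : 0 < x < l -> P x = P 0.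
  move=> /andP[x0 xl]; apply/eqP; rewrite eq_le; apply/andP; split; last exact: mono (ltW x0).
  by rewrite {2}/P E; exact: mono (ltW xl).
have dP0 x : 0 < x < l -> (derive1 f x) ^+ 2 - lam * f x ^+ 2 = 0.
  have dPc : der (fun x => P x + - P 0) (fun x => ((derive1 f x) ^+ 2 - lam * f x ^+ 2) + 0).
    by apply: derD => // y; exact: is_derive_cst.
  move=> hx; rewrite -[LHS]addr0; apply: (der_zero l0 dPc) hx => y hy.
  by rewrite cst // subrr.
have f'0 x : 0 < x < l -> derive1 f x = 0.
  move=> /dP0 /eqP; rewrite paddr_eq0 ?sqr_ge0 //; last first.
    by rewrite -mulNr mulr_ge0 ?sqr_ge0 // oppr_ge0.
  by case/andP => /eqP /eqP; rewrite sqrf_eq0 => /eqP.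
have f'c := zero_closed l0 d2 f'0.
move=> x /andP[x0 xl]; have [c /andP[c0 cx]] := mvt x0 (fun u _ => d1 u).
by rewrite f'c ?mul0r ?c0 ?(le_trans cx) // => /eqP; rewrite subr_eq0 => /eqP.
Qed.

End ODE.

(** * Linear independence of eigenfunctions *)

Section Families.
Variables (R : realType) (V E : finType) (src tgt : E -> V) (len : E -> R).
Hypothesis lpos : forall e, 0 < len e.

Lemma push_coef (I J : finType) (phi : J -> I) (c : J -> R) (F : I -> R) :
  \sum_j c j * F (phi j) = \sum_i (\sum_(j | phi j == i) c j) * F i.
Proof.
rewrite (partition_big phi xpredT) //=; apply: eq_bigr => i _.
by rewrite mulr_suml; apply: eq_bigr => j /eqP ->.
Qed.

Lemma lin_indep_sub N M (F : 'I_N -> E -> R -> R) (phi : 'I_M -> 'I_N) :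
  injective phi -> lin_indep len F -> lin_indep len (fun j => F (phi j)).
Proof.
move=> inj hF c hc j.
have := hF (fun i => \sum_(j | phi j == i) c j) _ (phi j).
rewrite (eq_bigl (pred1 j)) ?big_pred1_eq => [|k /=]; last by rewrite (inj_eq inj).
by apply=> e x hx; rewrite -(push_coef phi c (fun i => F i e x)); apply: hc.
Qed.

Lemma indep_eig_sub S N M : (M <= N)%N -> indep_eig src tgt len S N ->
  indep_eig src tgt len S M.
Proof.
move=> MN [F [hF iF]]; exists (fun j => F (widen_ord MN j)); split => [j|]; first exact: hF.
by apply: lin_indep_sub => // i j /(congr1 val) /= /val_inj.
Qed.

Lemma indep_eig_mono (S S' : R -> Prop) N : (forall mu, S mu -> S' mu) ->
  indep_eig src tgt len S N -> indep_eig src tgt len S' N.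
Proof.
move=> h [F [hF iF]]; exists F; split => // i.
by have [mu [/h ? ?]] := hF i; exists mu.
Qed.

Definition glue M1 M2 (F1 : 'I_M1 -> E -> R -> R) (F2 : 'I_M2 -> E -> R -> R)
  (i : 'I_(M1 + M2)) := match fintype.split i with inl a => F1 a | inr b => F2 b end.

(** Applying the second derivative plus [mu] to a vanishing combination kills the functions for [mu]
    and multiplies the others by the nonzero numbers [mu - m i]. *)
Lemma glue_indep mu M1 M2 (F1 : 'I_M1 -> E -> R -> R) (F2 : 'I_M2 -> E -> R -> R) :
  (forall i, exists m, m < mu /\ is_eigsol src tgt len m (F1 i)) -> lin_indep len F1 ->
  (forall j, is_eigsol src tgt len mu (F2 j)) -> lin_indep len F2 ->
  lin_indep len (glue F1 F2).
Proof.
move=> /boolp.choice[m hm] i1 h2 i2 c hc.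
pose c1 i := c (lshift M2 i); pose c2 j := c (rshift M1 j).
have gl i : glue F1 F2 (lshift M2 i) = F1 i.
  by rewrite /glue -[lshift M2 i]/(unsplit (inl i)) unsplitK.
have gr j : glue F1 F2 (rshift M1 j) = F2 j.
  by rewrite /glue -[rshift M1 j]/(unsplit (inr j)) unsplitK.
have hc' e x : 0 <= x <= len e -> \sum_i c1 i * F1 i e x + \sum_j c2 j * F2 j e x = 0.
  move=> hx; rewrite -[RHS](hc e x hx) big_split_ord /=.
  by congr (_ + _); apply: eq_bigr => i _; rewrite ?gl ?gr.
have o1 i e : ode (m i) (F1 i e) by have [_ [+ _]] := hm i; move=> h x; exact: h.
have o2 j e : ode mu (F2 j e) by have [+ _] := h2 j; move=> h x; exact: h.
have key e x : 0 <= x <= len e -> \sum_i (c1 i * (mu - m i)) * F1 i e x = 0.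
  pose H (x : R) := \sum_i c1 i * F1 i e x + \sum_j c2 j * F2 j e x.
  pose H1 x := \sum_i c1 i * derive1 (F1 i e) x + \sum_j c2 j * derive1 (F2 j e) x.
  pose H2 x := \sum_i c1 i * (- m i * F1 i e x) + \sum_j c2 j * (- mu * F2 j e x).
  have dH : der H H1.
    by apply: derD; apply: der_sum => i; apply: derZ; [apply: ode_der1 (o1 i e)|apply: ode_der1 (o2 i e)].
  have dH1 : der H1 H2.
    by apply: derD; apply: der_sum => i; apply: derZ; [apply: ode_der2 (o1 i e)|apply: ode_der2 (o2 i e)].
  have z1 : forall y, 0 < y < len e -> H1 y = 0.
    apply: (der_zero (lpos e) dH) => y /andP[y0 yl].
    by apply: hc'; rewrite !ltW.
  have z2 := der_zero (lpos e) dH1 z1.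
  have dG : der (fun x => \sum_i (c1 i * (mu - m i)) * F1 i e x)
                (fun x => \sum_i (c1 i * (mu - m i)) * derive1 (F1 i e) x).
    by apply: der_sum => i; apply: derZ; apply: ode_der1 (o1 i e).
  apply: (zero_closed (lpos e) dG) => y hy.
  have : H2 y + mu * H y = 0.
    rewrite z2 // /H hc' ?mulr0 ?addr0 //; by case/andP: hy => y0 yl; rewrite !ltW.
  rewrite /H2 /H mulrDr !mulr_sumr addrACA -!big_split /= [X in _ + X]big1 ?addr0.
    by move=> H0; rewrite -[RHS]H0; apply: eq_bigr => i _; ring.
  by move=> j _; ring.
have c10 i : c1 i = 0.
  have := i1 _ key i => /eqP; rewrite mulf_eq0 subr_eq0 => /orP[/eqP //|/eqP Em].
  by have [+ _] := hm i; rewrite Em ltxx.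
have c20 j : c2 j = 0.
  apply: i2 => e x hx; rewrite -[RHS](hc' e x hx) [X in _ = X + _]big1 ?add0r // => i _.
  by rewrite c10 mul0r.
move=> i; rewrite -(splitK i); case: (fintype.split i) => a; [exact: c10|exact: c20].
Qed.

Lemma indep_eig_glue mu mu' M1 M2 (F2 : 'I_M2 -> E -> R -> R) : mu < mu' ->
  indep_eig src tgt len (fun m => m < mu) M1 ->
  (forall j, is_eigsol src tgt len mu (F2 j)) -> lin_indep len F2 ->
  indep_eig src tgt len (fun m => m < mu') (M1 + M2).
Proof.
move=> mm [F1 [h1 i1]] h2 i2; exists (glue F1 F2); split; last exact: (glue_indep h1).
move=> i; rewrite /glue; case: (fintype.split i) => a; last by exists mu.
by have [m [lm hm]] := h1 a; exists m; split => //; apply: lt_trans mm.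
Qed.

Lemma connected_const (u : V -> R) : connected_graph src tgt ->
  (forall e, u (src e) = u (tgt e)) -> forall v w, u v = u w.
Proof.
move=> conn hu v w; have /connectP[p pth ->] := conn v w.
elim: p v pth => //= x p IH v /andP[vx /IH <-].
by move: vx => /existsP[e /orP[] /andP[/eqP <- /eqP <-]]; rewrite hu.
Qed.

(** By Kirchhoff's condition the increments of f f' over the edges have sum 0; as none is negative,
    all vanish and f is constant on every edge. *)
Lemma nonpos_eig_const lam f : connected_graph src tgt -> lam <= 0 ->
  is_eigsol src tgt len lam f ->
  exists c, forall e x, 0 <= x <= len e -> f e x = c.
Proof.
move=> conn lam0 [ho [[g hg] hk]].
have o e : ode lam (f e) by move=> x; exact: ho.
have flat e := nonpos_flat lam0 (lpos e) (o e).
pose D e := f e (len e) * derive1 (f e) (len e) - f e 0 * derive1 (f e) 0.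
have D0 e : 0 <= D e by rewrite subr_ge0; case: (flat e).
have S0 : \sum_e D e = 0.
  have : \sum_v g v * (\sum_(e | src e == v) derive1 (f e) 0
                 - \sum_(e | tgt e == v) derive1 (f e) (len e)) = 0.
    by rewrite big1 // => v _; rewrite hk mulr0.
  under eq_bigr do rewrite mulrBr.
  rewrite sumrB => /eqP; rewrite subr_eq0 => /eqP H.
  rewrite /D sumrB; apply/eqP; rewrite subr_eq0; apply/eqP.
  rewrite [RHS](partition_big src xpredT) //= [LHS](partition_big tgt xpredT) //=.
  transitivity (\sum_v g v * \sum_(e | tgt e == v) derive1 (f e) (len e)).
    apply: eq_bigr => v _; rewrite mulr_sumr; apply: eq_bigr => e /eqP <-.
    by have [_ ->] := hg e.
  rewrite -H; apply: eq_bigr => v _; rewrite mulr_sumr; apply: eq_bigr => e /eqP <-.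
  by have [-> _] := hg e.
have De e : D e = 0.
  have := S0; rewrite (bigD1 e) //= => /eqP; rewrite paddr_eq0 ?D0 //.
    by case/andP => /eqP.
  by apply: sumr_ge0.
have fc e x : 0 <= x <= len e -> f e x = g (src e).
  case: (hg e) => <- _; case: (flat e) => _; apply.
  by apply/eqP; rewrite eq_sym -subr_eq0; apply/eqP; exact: De.
have gc : forall v w, g v = g w.
  apply: connected_const => // e; have [_ <-] := hg e.
  by rewrite fc // lexx ltW ?lpos.
have [e0|noE] := pselect (exists e0 : E, True).
  by case: e0 => e0 _; exists (g (src e0)) => e x /fc ->; exact: gc.
by exists 0 => e; case: noE; exists e.
Qed.

End Families.

(** * A quadratic form on the subdivided graph *)

Section Subdivision.
Variables (R : realType) (V E : finType) (src tgt : E -> V) (len : E -> R) (P : nat).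

Definition nodeT : finType := (V + E * 'I_P.+1)%type.
Definition pieceT : finType := (E * 'I_P.+2)%type.

(** Node 0 of an edge is its source, node P + 2 its target, and between them lie the P + 1 cut
    points; larger indices also give the target. *)
Definition node (e : E) (i : nat) : nodeT :=
  if i is j.+1 then (if (j < P.+1)%N then inr (e, inord j) else inl (tgt e))
  else inl (src e).

Arguments node : simpl never.

Definition node_diff (g : nodeT -> R) (j : pieceT) : R := g (node j.1 j.2) - g (node j.1 j.2.+1).
Definition node_sum (g : nodeT -> R) (j : pieceT) : R := g (node j.1 j.2) + g (node j.1 j.2.+1).

(** On a piece, the difference of the end values drives the part of a solution that is odd about the
    midpoint, and their sum the even part. The two parts do not interact, so the energy is diagonal
    in these coordinates. *)
Definition qform (a b : E -> R) (g h : nodeT -> R) : R :=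
  \sum_j (a j.1 * (node_diff g j * node_diff h j) - b j.1 * (node_sum g j * node_sum h j)).

Definition dirac1 (s : nodeT) : nodeT -> R := fun x => (x == s)%:R.

Definition Qm (a b : E -> R) (s t : nodeT) : R := qform a b (dirac1 s) (dirac1 t).

Lemma dirac_sum (g : nodeT -> R) x : \sum_s dirac1 s x * g s = g x.
Proof.
rewrite (bigD1 x) //= /dirac1 eqxx mul1r big1 ?addr0 // => s.
by rewrite eq_sym => /negbTE ->; rewrite mul0r.
Qed.

Lemma node_diff_sum g j : \sum_s node_diff (dirac1 s) j * g s = node_diff g j.
Proof.
rewrite /node_diff; under eq_bigr do rewrite mulrBl.
by rewrite sumrB !dirac_sum.
Qed.

Lemma node_sum_sum g j : \sum_s node_sum (dirac1 s) j * g s = node_sum g j.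
Proof.
rewrite /node_sum; under eq_bigr do rewrite mulrDl.
by rewrite big_split /= !dirac_sum.
Qed.

Lemma bil_Qm a b g h : bil (Qm a b) g h = qform a b g h.
Proof.
rewrite /bil /Qm /qform.
under eq_bigr do under eq_bigr do rewrite -mulrA mulr_suml.
under eq_bigr do rewrite exchange_big /=.
rewrite exchange_big /=; apply: eq_bigr => j _.
rewrite -(node_diff_sum g) -(node_diff_sum h) -(node_sum_sum g) -(node_sum_sum h) !big_distrlr /= !mulr_sumr -sumrB.
apply: eq_bigr => s _; rewrite !mulr_sumr -sumrB.
by apply: eq_bigr => t _; ring.
Qed.

Lemma Qm_sym a b : symf (Qm a b).
Proof. by move=> s t; rewrite /Qm /qform; apply: eq_bigr => j _; rewrite mulrC [node_sum _ _ * _]mulrC [node_diff _ _ * _]mulrC [_ * a _]mulrC. Qed.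

Lemma Qm_close (eps : R) : 0 < eps -> exists2 d : R, 0 < d & forall a b a' b' : E -> R,
  (forall e, `|a e - a' e| <= d /\ `|b e - b' e| <= d) ->
  forall s t, `|Qm a b s t - Qm a' b' s t| <= eps.
Proof.
move=> eps0; pose n : R := 8 * (#|pieceT|%:R + 1).
have n0 : 0 < n by rewrite mulr_gt0 // ltr_wpDl.
exists (eps / n); first exact: divr_gt0.
move=> a b a' b' h s t; rewrite /Qm /qform -sumrB.
apply: (@le_trans _ _ (\sum_(j : pieceT) (8 * (eps / n)))); last first.
  rewrite sumr_const -[leLHS]mulr_natr.
  have -> : 8 * (eps / n) * #|pieceT|%:R = eps * (8 * #|pieceT|%:R) / n by ring.
  by rewrite ler_pdivrMr // ler_pM2l // /n ler_pM2l // lerDl.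
apply: (le_trans (ler_norm_sum _ _ _)); apply: ler_sum => j _.
have d1 u (x : nodeT) : `|dirac1 u x| <= 1 by rewrite /dirac1; case: (x == u); rewrite ?normr1 ?normr0.
have dd u : `|node_diff (dirac1 u) j| <= 2.
  by apply: (le_trans (ler_normB _ _)); have := d1 u (node j.1 j.2); have := d1 u (node j.1 j.2.+1); lra.
have ss u : `|node_sum (dirac1 u) j| <= 2.
  by apply: (le_trans (ler_normD _ _)); have := d1 u (node j.1 j.2); have := d1 u (node j.1 j.2.+1); lra.
have -> : a j.1 * (node_diff (dirac1 s) j * node_diff (dirac1 t) j) - b j.1 * (node_sum (dirac1 s) j * node_sum (dirac1 t) j)
  - (a' j.1 * (node_diff (dirac1 s) j * node_diff (dirac1 t) j) - b' j.1 * (node_sum (dirac1 s) j * node_sum (dirac1 t) j))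
  = (a j.1 - a' j.1) * (node_diff (dirac1 s) j * node_diff (dirac1 t) j)
    - (b j.1 - b' j.1) * (node_sum (dirac1 s) j * node_sum (dirac1 t) j) by ring.
have [ha hb] := h j.1.
have -> : 8 * (eps / n) = (eps / n) * (2 * 2) + (eps / n) * (2 * 2) by ring.
apply: (le_trans (ler_normB _ _)); apply: lerD; rewrite normrM.
  by apply: ler_pM => //; rewrite normrM; apply: ler_pM.
by apply: ler_pM => //; rewrite normrM; apply: ler_pM.
Qed.

Lemma node_cover : (forall v, exists e, src e = v \/ tgt e = v) ->
  forall s : nodeT, exists j : pieceT, s = node j.1 j.2 \/ s = node j.1 j.2.+1.
Proof.
move=> inc [v|[e i]].
  have [e [<-|<-]] := inc v; first by exists (e, ord0); left.
  by exists (e, ord_max); right; rewrite /node /= ltnn.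
exists (e, lift ord0 i); left; rewrite [(_, _).1]/= [(_, _).2]/= lift0 /node ltn_ord.
by rewrite inord_val.
Qed.

Lemma node_inr e' (i' : nat) e (i : 'I_P.+1) : (i' <= P.+2)%N ->
  (node e' i' == inr (e, i)) = (e' == e) && (i' == i.+1).
Proof.
rewrite /node; case: i' => [|j] hj; first by rewrite andbF.
case: ifP => [jP|jP].
  rewrite -[inr _ == inr _]/((e', inord j) == (e, i)) xpair_eqE eqSS.
  by congr andb; rewrite -val_eqE /= inordK.
apply/esym/negbTE; rewrite negb_and; apply/orP; right; apply/eqP => -[Ej].
by move: jP; rewrite Ej ltn_ord.
Qed.

(** [op] and [om] are the coefficients of the test function at the first and the last node of a
    piece; on samples of a solution they are its derivatives there, up to sign and a common
    factor. *)
Definition op (a b : E -> R) (w : nodeT -> R) (j : pieceT) := a j.1 * node_diff w j - b j.1 * node_sum w j.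
Definition om (a b : E -> R) (w : nodeT -> R) (j : pieceT) := - (a j.1 * node_diff w j) - b j.1 * node_sum w j.

Lemma qform_out a b w h : qform a b w h =
  \sum_(j : pieceT) (h (node j.1 j.2) * op a b w j + h (node j.1 j.2.+1) * om a b w j).
Proof. by apply: eq_bigr => j _; rewrite /op /om /node_diff /node_sum; ring. Qed.

Lemma qform_inner a b w e (i : 'I_P.+1) :
  qform a b w (dirac1 (inr (e, i))) = op a b w (e, lift ord0 i) + om a b w (e, widen_ord (leqnSn _) i).
Proof.
have hi : (i.+1 <= P.+2)%N := leqW (ltn_ord i).
rewrite qform_out big_split /=; congr (_ + _).
  rewrite (bigD1 (e, lift ord0 i)) //= big1 ?addr0.
    by rewrite /dirac1 /bump leq0n add1n (node_inr _ _ _ hi) !eqxx mul1r.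
  move=> [e' i'] ne; rewrite /dirac1 (node_inr _ _ _ (ltnW (ltn_ord i'))) /=.
  case: eqP => [E1|_]; last by rewrite mul0r.
  case: eqP => [E2|_]; last by rewrite andbF mul0r.
  by case/eqP: ne; rewrite E1; congr (_, _); apply: val_inj; rewrite /= E2.
rewrite (bigD1 (e, widen_ord (leqnSn _) i)) //= big1 ?addr0.
  by rewrite /dirac1 (node_inr _ _ _ hi) !eqxx mul1r.
move=> [e' i'] ne; rewrite /dirac1 (node_inr _ _ _ (ltn_ord i')) /=.
case: eqP => [E1|_]; last by rewrite mul0r.
case: eqP => [[E2]|_]; last by rewrite andbF mul0r.
by case/eqP: ne; rewrite E1; congr (_, _); apply: val_inj; rewrite /= E2.
Qed.

End Subdivision.

Arguments node : simpl never.

(** * Index of the form and number of eigenvalues below k ^ 2 *)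

Section Spectrum.
Variables (R : realType) (V E : finType) (src tgt : E -> V) (len : E -> R) (P : nat).
Hypothesis lpos : forall e, 0 < len e.
Hypothesis conn : connected_graph src tgt.
Hypothesis inc : forall v, exists e, src e = v \/ tgt e = v.
Local Notation pi := (@pi R).
Local Notation nodeT := (nodeT V E P).
Local Notation pieceT := (pieceT E P).
Local Notation node := (@node V E src tgt P).

(* Every edge is cut into P + 2 pieces of angular length 2 * half_step.  With these
   coefficients the form is 2 / k times the least value of int (u'^2 - k^2 u^2)
   among the functions u with prescribed values at the nodes. *)
Definition half_step (k : R) (e : E) := k * len e / (2 * P.+2%:R).
Definition al k e := (tan (half_step k e))^-1.
Definition be k e := tan (half_step k e).
Definition Qk k := qform src tgt (P := P) (al k) (be k).

(** Pieces have angular length less than pi, so that the solution with given end values exists, is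
    unique and minimises the energy. *)
Definition fine_grid (k : R) := 0 < k /\ forall e, half_step k e < pi / 2.

Lemma pR : 0 < 2 * P.+2%:R :> R. Proof. by rewrite mulr_gt0 // ltr0n. Qed.

Lemma half_step_gt0 k e : 0 < k -> 0 < half_step k e.
Proof. by move=> k0; rewrite divr_gt0 ?pR // mulr_gt0. Qed.

Lemma half_step_lt k k' e : k < k' -> half_step k e < half_step k' e.
Proof. by move=> kk; rewrite /half_step ltr_pM2r ?invr_gt0 ?pR // ltr_pM2r. Qed.

Lemma fine_grid_le k k' : 0 < k -> k <= k' -> fine_grid k' -> fine_grid k.
Proof.
move=> k0 kk [_ h]; split => // e; apply: le_lt_trans (h e).
by move: kk; rewrite le_eqVlt => /orP[/eqP -> //|/(half_step_lt e)/ltW].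
Qed.

Lemma be_gt0 k e : fine_grid k -> 0 < be k e.
Proof. by move=> [k0 h]; apply: tan_gt0; rewrite half_step_gt0 // h. Qed.

Lemma be_lt k k' e : 0 < k -> k < k' -> fine_grid k' -> be k e < be k' e.
Proof.
move=> k0 kk [k'0 h]; have h1 := half_step_lt e kk; have h2 := half_step_gt0 e k0; have h3 := h e.
by rewrite /be ltr_tan // in_itv /=; apply/andP; split; lra.
Qed.

Lemma al_lt k k' e : 0 < k -> k < k' -> fine_grid k' -> al k' e < al k e.
Proof.
move=> k0 kk ok'; have ok := fine_grid_le k0 (ltW kk) ok'.
by rewrite /al ltf_pV2 ?posrE; [exact: be_lt|exact: be_gt0|exact: be_gt0].
Qed.

(** The cotangent [al] decreases and the tangent [be] increases with k; strictness comes from a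
    piece ending at s, where the difference or the sum of the end values is not 0. *)
Lemma Qk_lt k k' g : 0 < k -> k < k' -> fine_grid k' -> (exists s, g s != 0) ->
  Qk k' g g < Qk k g g.
Proof.
move=> k0 kk ok' [s gs]; rewrite -subr_gt0 /Qk /qform -sumrB.
have T j : 0 <= al k j.1 * (node_diff src tgt g j * node_diff src tgt g j) - be k j.1 * (node_sum src tgt g j * node_sum src tgt g j)
   - (al k' j.1 * (node_diff src tgt g j * node_diff src tgt g j) - be k' j.1 * (node_sum src tgt g j * node_sum src tgt g j)).
  have a1 := al_lt j.1 k0 kk ok'; have b1 := be_lt j.1 k0 kk ok'.
  have h1 : 0 <= (al k j.1 - al k' j.1) * (node_diff src tgt g j * node_diff src tgt g j).
    by rewrite mulr_ge0 -?expr2 ?sqr_ge0 // subr_ge0 ltW.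
  have h2 : 0 <= (be k' j.1 - be k j.1) * (node_sum src tgt g j * node_sum src tgt g j).
    by rewrite mulr_ge0 -?expr2 ?sqr_ge0 // subr_ge0 ltW.
  move: h1 h2; clear; lra.
have [j hj] := node_cover inc s.
rewrite (bigD1 j) //= ltr_wpDr //; first by apply: sumr_ge0.
have a1 := al_lt j.1 k0 kk ok'; have b1 := be_lt j.1 k0 kk ok'.
have nz : node_diff src tgt g j != 0 \/ node_sum src tgt g j != 0.
  have [d0|] := eqVneq (node_diff src tgt g j) 0; last by left.
  have [s0|] := eqVneq (node_sum src tgt g j) 0; last by right.
  exfalso; move: d0 s0; rewrite /node_diff /node_sum => d0 s0.
  have [x0 y0] : g (node j.1 j.2) = 0 /\ g (node j.1 j.2.+1) = 0 by split; lra.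
  by case: hj gs => -> ; rewrite ?x0 ?y0 eqxx.
have h1 : 0 <= (al k j.1 - al k' j.1) * (node_diff src tgt g j * node_diff src tgt g j).
  by rewrite mulr_ge0 -?expr2 ?sqr_ge0 // subr_ge0 ltW.
have h2 : 0 <= (be k' j.1 - be k j.1) * (node_sum src tgt g j * node_sum src tgt g j).
  by rewrite mulr_ge0 -?expr2 ?sqr_ge0 // subr_ge0 ltW.
case: nz => nz.
  have h3 : 0 < (al k j.1 - al k' j.1) * (node_diff src tgt g j * node_diff src tgt g j).
    by rewrite mulr_gt0 ?subr_gt0 // -expr2 exprn_even_gt0.
  by move: h2 h3; clear; lra.
have h3 : 0 < (be k' j.1 - be k j.1) * (node_sum src tgt g j * node_sum src tgt g j).
  by rewrite mulr_gt0 ?subr_gt0 // -expr2 exprn_even_gt0.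
by move: h1 h3; clear; lra.
Qed.

Lemma near_tan (c k0 d : R) : 0 <= c -> 0 < d -> 0 <= k0 -> c * k0 < pi / 2 ->
  exists2 del : R, 0 < del & forall k, 0 <= k -> `|k - k0| < del ->
  `|tan (c * k) - tan (c * k0)| <= d.
Proof.
move=> c0 d0 k00 h; set a := (c * k0 + pi / 2) / 2.
have ap : a < pi / 2 by rewrite /a; lra.
have ca : c * k0 < a by rewrite /a; lra.
have L0 : 0 < 1 + tan a ^+ 2 by exact: oneDsq_gt0.
have c1 : 0 < c + 1 by lra.
have ck0 : 0 <= c * k0 by rewrite mulr_ge0.
exists (Num.min ((a - c * k0) / (c + 1)) (d / ((1 + tan a ^+ 2) * (c + 1)))).
  by rewrite lt_min !divr_gt0 ?mulr_gt0 // subr_gt0.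
move=> k kge; rewrite lt_min !ltr_pdivlMr ?mulr_gt0 // => /andP[h1 h2].
have cd : `|c * k - c * k0| <= `|k - k0| * (c + 1).
  by rewrite -mulrBr normrM (ger0_norm c0) mulrC ler_wpM2l // lerDl.
have ck : 0 <= c * k by rewrite mulr_ge0.
apply: (le_trans (tan_lip ap _ _)).
- apply/andP; split; first by lra.
  by have := ler_norm (c * k - c * k0); lra.
- apply/andP; split; lra.
apply: (@le_trans _ _ ((1 + tan a ^+ 2) * (`|k - k0| * (c + 1)))); first by rewrite ler_pM2l.
by rewrite mulrCA; exact: ltW.
Qed.

Lemma near_cot (c k0 d : R) : 0 < c -> 0 < d -> 0 < k0 -> c * k0 < pi / 2 ->
  exists2 del : R, 0 < del & forall k, 0 <= k -> `|k - k0| < del ->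
  `|(tan (c * k))^-1 - (tan (c * k0))^-1| <= d.
Proof.
move=> c0 d0 k00 h; set u := tan (c * k0).
have u0 : 0 < u by apply: tan_gt0; rewrite mulr_gt0.
have m0 : 0 < Num.min (u / 2) (d * u * u / 2) by rewrite lt_min; apply/andP; split; do ![apply: divr_gt0 => //|apply: mulr_gt0 => //].
have [del del0 hd] := near_tan (ltW c0) m0 (ltW k00) h.
exists del => // k kge /(hd k kge); rewrite -/u le_min => /andP[h1 h2].
set v := tan (c * k) in h1 h2 *.
have v0 : u / 2 <= v by move: h1; rewrite ler_norml => /andP[]; lra.
have vp : 0 < v by apply: lt_le_trans v0; lra.
have -> : v^-1 - u^-1 = (u - v) / (v * u) by field; rewrite !gt_eqF.
have vu := mulr_gt0 vp u0.
rewrite normrM normfV (gtr0_norm vu) ler_pdivrMr // -normrN opprB.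
apply: (le_trans h2).
have : d * (u * (u / 2)) <= d * (u * v) by rewrite !ler_pM2l.
lra.
Qed.

Lemma fin_delta (Pr : E -> R -> Prop) :
  (forall e, exists2 del : R, 0 < del & forall k, k < del -> Pr e k) ->
  exists2 del : R, 0 < del & forall k, k < del -> forall e, Pr e k.
Proof.
move=> h; have /boolp.choice[D hD] : forall e, exists del : R, 0 < del /\ forall k, k < del -> Pr e k.
  by move=> e; have [del d0 hd] := h e; exists del.
exists (\big[Num.min/1]_e D e).
  by elim/big_ind: _ => // [x y x0 y0|e _]; [rewrite lt_min x0|case: (hD e)].
move=> k hk e; have [_] := hD e; apply; apply: (lt_le_trans hk).
exact: bigmin_le_cond.
Qed.

Lemma hangE k e : half_step k e = len e / (2 * P.+2%:R) * k.
Proof. by rewrite /half_step; ring. Qed.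

Lemma cE e : 0 < len e / (2 * P.+2%:R). Proof. by rewrite divr_gt0 ?pR. Qed.

Lemma coef_cont k0 (d : R) : fine_grid k0 -> 0 < d -> exists2 del : R, 0 < del &
  forall k, 0 <= k -> `|k - k0| < del -> forall e,
  `|al k e - al k0 e| <= d /\ `|be k e - be k0 e| <= d.
Proof.
move=> [k00 hk] d0.
have [e|del del0 h] := @fin_delta (fun e r => forall k, 0 <= k -> `|k - k0| = r ->
   `|al k e - al k0 e| <= d /\ `|be k e - be k0 e| <= d).
  have hh : len e / (2 * P.+2%:R) * k0 < pi / 2 by rewrite -hangE.
  have [d1 d10 h1] := near_cot (cE e) d0 k00 hh.
  have [d2 d20 h2] := near_tan (ltW (cE e)) d0 (ltW k00) hh.
  exists (Num.min d1 d2); first by rewrite lt_min d10.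
  move=> r; rewrite lt_min => /andP[r1 r2] k kge hr; rewrite /al /be !hangE.
  by split; [apply: h1 => //; rewrite hr|apply: h2 => //; rewrite hr].
by exists del => // k kge /h hk' e; apply: hk'.
Qed.

Definition vec (f : E -> R -> R) (g : V -> R) : nodeT -> R := fun s =>
  match s with inl v => g v | inr (e, i) => f e (i.+1%:R * len e / P.+2%:R) end.

Lemma vec_node f g e i : f e 0 = g (src e) -> f e (len e) = g (tgt e) -> (i <= P.+2)%N ->
  vec f g (node e i) = f e (i%:R * len e / P.+2%:R).
Proof.
move=> h0 h1; case: i => [|i] hi; first by rewrite /node /= !mul0r.
rewrite /node; case: ifP => hP /=; first by rewrite inordK.
have -> : i = P.+1 by apply/eqP; rewrite eqn_leq -ltnS hi leqNgt hP.
by rewrite -h1 mulrAC divff ?mul1r // pnatr_eq0.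
Qed.

(** On samples of a solution each piece gives exactly the boundary term of an integration by parts,
    and these terms telescope along an edge. *)
Lemma qform_trig k (w h : nodeT -> R) (A B : E -> R) : fine_grid k ->
  (forall e i, (i <= P.+2)%N -> w (node e i) = trigf k (A e) (B e) (i%:R * len e / P.+2%:R)) ->
  Qk k w h = 2 / k * \sum_e (h (inl (tgt e)) * trigf' k (A e) (B e) (len e)
                           - h (inl (src e)) * trigf' k (A e) (B e) 0).
Proof.
move=> [k0 hk] hw; rewrite /Qk /qform.
pose T e (i : nat) := h (node e i) * trigf' k (A e) (B e) (i%:R * len e / P.+2%:R).
have pN : P.+2%:R != 0 :> R by rewrite pnatr_eq0.
transitivity (\sum_(j : pieceT) 2 / k * (T j.1 j.2.+1 - T j.1 j.2)).
  apply: eq_bigr => -[e i] _ /=; rewrite /node_diff /node_sum /=.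
  rewrite !hw ?(ltnW (ltn_ord i)) ?ltn_ord // /T.
  set H := half_step k e; set phi := (2 * i%:R + 1) * H.
  have H0 : 0 < H by exact: half_step_gt0. have H1 := hk e; rewrite -/H in H1.
  have s0 : sin H != 0 by rewrite gt_eqF // sin_gt0_pihalf // H0.
  have c0 : cos H != 0.
    by rewrite gt_eqF // cos_gt0_pihalf // H1 andbT; apply: lt_trans H0; rewrite oppr_lt0 pi2_gt0.
  have e1 : k * (i%:R * len e / P.+2%:R) = phi - H by rewrite /phi /H /half_step; field.
  have e2 : k * (i.+1%:R * len e / P.+2%:R) = phi + H by rewrite /phi /H /half_step -natr1; field.
  rewrite /trigf /trigf' e1 e2 /al /be -/H /tan invf_div.
  rewrite (cosB phi) (sinB phi) (cosD phi) (sinD phi); field.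
  by rewrite s0 c0 gt_eqF.
rewrite -mulr_sumr -(pair_bigA _ (fun e (i : 'I_P.+2) => T e i.+1 - T e i)) /=.
congr (_ * _); apply: eq_bigr => e _.
rewrite -(big_mkord xpredT (fun i => T e i.+1 - T e i)) telescope_sumr // /T.
rewrite mulrAC divff // mul1r !mul0r /node ltnn.
by [].
Qed.

Lemma vertex_sum (h : V -> R) (u v : E -> R) :
  \sum_e (h (tgt e) * u e - h (src e) * v e) =
  - \sum_x h x * (\sum_(e | src e == x) v e - \sum_(e | tgt e == x) u e).
Proof.
rewrite sumrB; under [in RHS]eq_bigr do rewrite mulrBr.
rewrite sumrB opprB; congr (_ - _).
  rewrite (partition_big tgt xpredT) //=; apply: eq_bigr => x _.
  by rewrite mulr_sumr; apply: eq_bigr => e /eqP <-.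
rewrite (partition_big src xpredT) //=; apply: eq_bigr => x _.
by rewrite mulr_sumr; apply: eq_bigr => e /eqP <-.
Qed.

Lemma eig_trig k f : k != 0 -> is_eigsol src tgt len (k ^+ 2) f ->
  forall e, f e = trigf k (f e 0) (derive1 (f e) 0 / k).
Proof. by move=> k0 [h _] e; apply: ode_trig => // x; apply: h. Qed.

Lemma eig_null k f g : fine_grid k -> is_eigsol src tgt len (k ^+ 2) f ->
  (forall e, f e 0 = g (src e) /\ f e (len e) = g (tgt e)) ->
  forall h, Qk k (vec f g) h = 0.
Proof.
move=> ok hf hg h; have k0 : k != 0 by rewrite gt_eqF; case: ok.
have ft := eig_trig k0 hf.
rewrite (@qform_trig k _ h (fun e => f e 0) (fun e => derive1 (f e) 0 / k)) //; last first.
  by move=> e i hi; have [g1 g2] := hg e; rewrite vec_node // [in LHS]ft.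
rewrite (vertex_sum (fun v => h (inl v))) big1 ?oppr0 ?mulr0 // => v _.
have [_ [_ /(_ v) hk]] := hf; have D e : trigf' k (f e 0) (derive1 (f e) 0 / k) = derive1 (f e).
  by rewrite [in RHS]ft derive1_trigf.
by under eq_bigr do rewrite D; under [X in _ - X]eq_bigr do rewrite D; rewrite hk mulr0.
Qed.

(** At an inner node the kernel equation is the three-term recurrence of cosine and sine with step 2
    [half_step], so the first two nodes of an edge fix a solution through all of them; testing at
    the vertices gives Kirchhoff's condition. *)
Lemma null_eig k (w : nodeT -> R) : fine_grid k -> (forall h, Qk k w h = 0) ->
  exists A B : E -> R, is_eigsol src tgt len (k ^+ 2) (fun e => trigf k (A e) (B e)) /\
   (forall e i, (i <= P.+2)%N -> w (node e i) = trigf k (A e) (B e) (i%:R * len e / P.+2%:R)).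
Proof.
move=> ok hw; have [k0 hk] := ok.
pose A e := w (inl (src e)).
pose B e := (w (node e 1) - A e * cos (2 * half_step k e)) / sin (2 * half_step k e).
have S0 e : sin (2 * half_step k e) != 0.
  rewrite gt_eqF // sin_gt0_pi // mulr_gt0 ?half_step_gt0 //=.
  by have := hk e; lra.
have pN : P.+2%:R != 0 :> R by rewrite pnatr_eq0.
have xE e (i : nat) : k * (i%:R * len e / P.+2%:R) = i%:R * (2 * half_step k e).
  by rewrite /half_step; field.
have nodes e i : (i <= P.+2)%N -> w (node e i) = trigf k (A e) (B e) (i%:R * len e / P.+2%:R).
  elim/ltn_ind: i => -[|[|i]] IH hi.
  - by rewrite /trigf !mul0r mulr0 cos0 sin0 mulr1 mulr0 addr0.
  - by rewrite /trigf xE mul1r /B; field.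
  have iP : (i < P.+1)%N by [].
  have := hw (dirac1 R (inr (e, Ordinal iP))).
  rewrite /Qk qform_inner /op /om /node_diff /node_sum /= /bump leq0n add1n.
  rewrite (IH i.+1) ?(ltnW hi) // (IH i) //; last by apply: leq_trans hi; apply: leqW.
  set y := w _; rewrite /trigf !xE.
  set H := half_step k e; set phi := i.+1%:R * (2 * H).
  have H0 : 0 < H by exact: half_step_gt0. have H1 := hk e; rewrite -/H in H1.
  have s0 : sin H != 0 by rewrite gt_eqF // sin_gt0_pihalf // H0.
  have c0 : cos H != 0.
    by rewrite gt_eqF // cos_gt0_pihalf // H1 andbT; apply: lt_trans H0; rewrite oppr_lt0 pi2_gt0.
  have -> : i%:R * (2 * H) = phi - (H + H) by rewrite /phi -natr1; ring.
  have -> : i.+2%:R * (2 * H) = phi + (H + H) by rewrite /phi -[i.+2%:R]natr1; ring.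
  rewrite (cosB phi) (sinB phi) (cosD phi) (sinD phi) (cosD H) (sinD H).
  rewrite /al /be -/H /tan invf_div.
  move: (cos phi) (sin phi) (A e) (B e) => cp sp a b.
  move: (cos2Dsin2 H) s0 c0; move: (cos H) (sin H) => c s cell_start s0 c0 E0.
  have E1 : (c ^+ 2 + s ^+ 2) * y = 2 * (c ^+ 2 - s ^+ 2) * (a * cp + b * sp) - (c ^+ 2 + s ^+ 2) *
     (a * (cp * (c * c - s * s) + sp * (s * c + c * s)) + b * (sp * (c * c - s * s) - cp * (s * c + c * s)))
     - s * c * 0.
    by rewrite -E0; field; rewrite ?s0 ?c0.
  by move: E1; rewrite cell_start; lra.
exists A, B; split=> //; split; first by move=> e x; exact: trigf_ode.
have bd e : trigf k (A e) (B e) 0 = w (inl (src e)) /\ trigf k (A e) (B e) (len e) = w (inl (tgt e)).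
  split; first by rewrite -[RHS]/(w (node e 0)) nodes // !mul0r.
  have := nodes e P.+2 (leqnn _); rewrite mulrAC divff // mul1r => <-.
  by rewrite /node ltnn.
split; first by exists (fun v => w (inl v)).
move=> v; have := hw (dirac1 R (inl v)).
rewrite (qform_trig _ ok nodes) => /eqP; rewrite mulf_eq0 gt_eqF ?divr_gt0 //= => /eqP.
rewrite (vertex_sum (fun u => dirac1 R (inl v) (inl u))) => /eqP; rewrite oppr_eq0 => /eqP H.
under eq_bigr do rewrite derive1_trigf; under [X in _ - X]eq_bigr do rewrite derive1_trigf.
rewrite -[RHS]H (bigD1 v) //= [X in _ = _ + X]big1 => [|u uv].
  by rewrite addr0 /dirac1 eqxx mul1r.
rewrite /dirac1 (_ : (inl u == inl v) = false) ?mul0r //.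
by apply/negbTE.
Qed.

Definition QM k := Qm src tgt (P := P) (al k) (be k).

Lemma bil_QM k g h : bil (QM k) g h = Qk k g h. Proof. exact: bil_Qm. Qed.

Lemma QM_sym k : symf (QM k). Proof. exact: Qm_sym. Qed.

Lemma nullfam_eig k N : fine_grid k -> nullfam (QM k) N ->
  exists F : 'I_N -> E -> R -> R, (forall i, is_eigsol src tgt len (k ^+ 2) (F i)) /\ lin_indep len F.
Proof.
move=> ok [g [gn gi]].
have /boolp.choice[AB hAB] : forall i, exists AB : (E -> R) * (E -> R),
   is_eigsol src tgt len (k ^+ 2) (fun e => trigf k (AB.1 e) (AB.2 e)) /\
   (forall e j, (j <= P.+2)%N -> g i (node e j) = trigf k (AB.1 e) (AB.2 e) (j%:R * len e / P.+2%:R)).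
  move=> i; have [|A [B hAB]] := @null_eig k (g i) ok; last by exists (A, B).
  by move=> h; rewrite -bil_QM; apply: gn.
exists (fun i e => trigf k ((AB i).1 e) ((AB i).2 e)); split=> [i|c hc]; first by case: (hAB i).
apply: gi => t.
have nd e j : (j <= P.+2)%N -> lincomb c g (node e j) = 0.
  move=> hj; rewrite -[RHS](hc e (j%:R * len e / P.+2%:R)); last first.
    rewrite mulr_ge0 ?invr_ge0 ?mulr_ge0 ?(ltW (lpos _)) //= ler_pdivrMr ?ltr0n // mulrC.
    by rewrite ler_pM2l // ler_nat.
  by apply: eq_bigr => i _; case: (hAB i) => _ ->.
have [[e [j hj]] []] := node_cover inc t; move=> /= ->; apply: nd => //.
exact: ltnW.
Qed.

Lemma eig_nullfam k N (F : 'I_N -> E -> R -> R) : fine_grid k ->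
  (forall i, is_eigsol src tgt len (k ^+ 2) (F i)) -> lin_indep len F -> nullfam (QM k) N.
Proof.
move=> ok hF iF; have [k0 hk] := ok; have kn : k != 0 by rewrite gt_eqF.
have /boolp.choice[g hg] : forall i, exists g : V -> R, forall e, F i e 0 = g (src e) /\ F i e (len e) = g (tgt e).
  by move=> i; case: (hF i) => _ [].
exists (fun i => vec (F i) (g i)); split=> [i h|c hc].
  by rewrite bil_QM; apply: eig_null => //; apply: hg.
apply: iF => e x _.
pose A := \sum_i c i * F i e 0; pose B := \sum_i c i * (derive1 (F i e) 0 / k).
have sE y : \sum_i c i * F i e y = trigf k A B y.
  rewrite /trigf /A /B !mulr_suml -big_split /=; apply: eq_bigr => i _.
  by rewrite [in LHS](eig_trig kn (hF i)) /trigf; ring.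
have nd j : (j <= P.+2)%N -> trigf k A B (j%:R * len e / P.+2%:R) = 0.
  move=> hj; rewrite -sE -[RHS](hc (node e j)); apply: eq_bigr => i _.
  by have [g1 g2] := hg i e; rewrite vec_node.
have A0 : A = 0 by have := nd 0%N isT; rewrite /trigf !mul0r mulr0 cos0 sin0; lra.
have B0 : B = 0.
  have := nd 1%N isT; rewrite /trigf A0 mul0r add0r => /eqP; rewrite mulf_eq0 => /orP[/eqP //|].
  have -> : k * (1 * len e / P.+2%:R) = 2 * half_step k e by rewrite /half_step; field; rewrite ?pnatr_eq0.
  have := hk e; have := half_step_gt0 e k0 => h1 h2.
  by rewrite gt_eqF // sin_gt0_pi //; apply/andP; split; lra.
by rewrite sE /trigf A0 B0; ring.
Qed.

(** Q is at most 0 on the sum of the two families, so the smaller form is negative there off the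
    zero vector; negativity of the first family and independence of the second show that only the
    zero combination gives that vector. *)
Lemma neg_null (T : finType) (Q Q' : T -> T -> R) M1 M2 : symf Q ->
  (forall g, (exists s, g s != 0) -> bil Q' g g < bil Q g g) ->
  negfam Q M1 -> nullfam Q M2 -> negfam Q' (M1 + M2).
Proof.
move=> sQ lt [f hf] [g [gn gi]].
pose F (i : 'I_M1 + 'I_M2) := match i with inl a => f a | inr b => g b end.
apply: (@negfam_sub _ _ _ _ F); first by rewrite card_sum !card_ord.
move=> c [i ci].
pose u := lincomb (fun i => c (inl i)) f; pose v := lincomb (fun i => c (inr i)) g.
have Fe : lincomb c F = (fun t => u t + v t) by apply/funext => t; rewrite lincomb_sum.
have vn h : bil Q v h = 0 by rewrite bil_lcl big1 // => j _; rewrite gn mulr0.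
have qform : bil Q (lincomb c F) (lincomb c F) = bil Q u u.
  by rewrite Fe bilDl vn addr0 bilDr [X in _ + X]bilC // vn addr0.
have le0 : bil Q u u <= 0.
  have [[j weight]|nc] := pselect (exists j, c (inl j) != 0); first by apply/ltW/hf; exists j.
  have -> : u = fun=> 0 by apply: lincomb0 => j; apply/eqP/negPn/negP => weight; apply: nc; exists j.
  by rewrite bil0l.
suff nz : exists s, lincomb c F s != 0 by apply: lt_le_trans (lt _ nz) _; rewrite qform.
apply/boolp.not_existsP => hz.
have z : lincomb c F = fun=> 0 by apply/funext => s; apply/eqP/negPn/negP/hz.
have uz : bil Q u u = 0 by rewrite -qform z bil0l.
have cu j : c (inl j) = 0.
  apply/eqP/negPn/negP => weight; have := hf (fun i => c (inl i)) (ex_intro _ j weight).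
  by rewrite -/u uz ltxx.
have u0 : u = fun=> 0 by apply: lincomb0.
have cv : forall j, c (inr j) = 0.
  by apply: gi => t; move: Fe; rewrite z u0 => /(congr1 (@^~ t)) /=; rewrite add0r => /esym.
by case: i ci => j; rewrite ?cu ?cv eqxx.
Qed.

Lemma QM_lt k k' : 0 < k -> k < k' -> fine_grid k' ->
  forall g, (exists s, g s != 0) -> bil (QM k') g g < bil (QM k) g g.
Proof. by move=> k0 kk ok g gn; rewrite !bil_QM; apply: Qk_lt. Qed.

(* The eigenfunctions for the largest eigenvalue k1 ^ 2 lie in the kernel of the
   form at k1, which dominates the form at k. *)
Lemma eig_negfam N k : fine_grid k -> indep_eig src tgt len (fun mu => mu < k ^+ 2) N -> negfam (QM k) N.
Proof.
elim/ltn_ind: N k => N IH k ok [F [/boolp.choice[m hm] iF]].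
case: N => [|N] in IH F m hm iF *; first by exists (fun i _ => 0) => c [[]].
have [i0 _ max] := @arg_maxP _ R 'I_N.+1 ord0 xpredT m isT.
have [mu0|mu0] := leP (m i0) 0.
  have /boolp.choice[c hc] : forall i, exists c, forall e x, 0 <= x <= len e -> F i e x = c.
    move=> i; have [_] := hm i; apply: nonpos_eig_const => //.
    by apply: le_trans mu0; apply: max.
  have iF' b : \sum_i b i * c i = 0 -> forall i, b i = 0.
    by move=> hb; apply: iF => e x hx; rewrite -[RHS]hb; apply: eq_bigr => i _; rewrite hc.
  have N0 : N = 0%N.
    apply/eqP; rewrite -leqn0 leqNgt; apply/negP => N0.
    have [|b [[i bi] hb]] := @dependent R 'I_N.+1 unit (fun i _ => c i).
      by rewrite card_unit card_ord.
    by move: bi; rewrite (iF' b (hb tt)) eqxx.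
  have [e0] : exists e0 : E, True.
    apply/boolp.not_existsP => hE; have := iF (fun=> 1) _ i0.
    by move=> h; have /eqP := h (fun e => False_ind _ (hE e I)); rewrite oner_eq0.
  move=> _; apply: (@negfam_sub _ _ _ 'I_1 (fun _ _ => 1)); first by rewrite card_ord N0.
  move=> b [i bi]; rewrite bil_QM /Qk /qform.
  rewrite (_ : lincomb b _ = fun=> b i); last first.
    by apply/funext => t; rewrite /lincomb big_ord1 mulr1 (ord1 i).
  rewrite -oppr_gt0 -sumrN (bigD1 (e0, ord0)) //= ltr_wpDr //.
    apply: sumr_ge0 => j _; rewrite /node_diff /node_sum subrr !mul0r mulr0 sub0r opprK.
    by rewrite mulr_ge0 ?(ltW (be_gt0 _ ok)) // -expr2 sqr_ge0.
  rewrite /node_diff /node_sum subrr !mul0r mulr0 sub0r opprK mulr_gt0 ?be_gt0 //.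
  by rewrite -expr2 exprn_even_gt0 //= -mulr2n mulrn_eq0.
pose k1 := Num.sqrt (m i0).
have k10 : 0 < k1 by rewrite sqrtr_gt0.
have k1E : k1 ^+ 2 = m i0 by rewrite sqr_sqrtr // ltW.
have kk : k1 < k.
  have [h _] := hm i0; move: h; rewrite -k1E ltr_pXn2r // nnegrE ltW //; by case: ok.
have ok1 : fine_grid k1 := fine_grid_le k10 (ltW kk) ok.
pose S1 := [set i | m i < m i0]%SET.
have eqN : (#|S1| + #|~: S1|)%N = N.+1 by rewrite cardsC card_ord.
rewrite -eqN; apply: (neg_null (@QM_sym k1) (QM_lt k10 kk ok)).
  apply: IH => //.
    have : (0 < #|~: S1|)%N by rewrite card_gt0; apply/set0Pn; exists i0; rewrite !inE ltxx.
    by move: eqN; clear; lia.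
  exists (fun j => F (enum_val (A := mem S1) j)); split=> [j|]; last by apply: lin_indep_sub => //; exact: enum_val_inj.
  exists (m (enum_val j)); split; last by case: (hm (enum_val j)).
  by rewrite k1E; have := enum_valP j; rewrite inE.
apply: (@eig_nullfam _ _ (fun j => F (enum_val (A := mem (~: S1)) j)) ok1).
  move=> j; have := enum_valP j; rewrite !inE -leNgt => h.
  have -> : k1 ^+ 2 = m (enum_val j) by rewrite k1E; apply/eqP; rewrite eq_le h; apply: max.
  by case: (hm (enum_val j)).
by apply: lin_indep_sub => //; exact: enum_val_inj.
Qed.

(** Let s be the supremum of the k up to which S holds. S holds at s by the limit clause, and s < K
    would contradict the progress clause. *)
Lemma real_ind (K : R) (S : R -> Prop) : 0 < K ->
  (exists2 d : R, 0 < d & forall k, 0 < k -> k < d -> k <= K -> S k) ->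
  (forall k0, 0 < k0 -> k0 < K -> S k0 ->
     exists2 d : R, 0 < d & forall k, k0 < k -> k < k0 + d -> k <= K -> S k) ->
  (forall k0, 0 < k0 -> k0 <= K -> (forall k, 0 < k -> k < k0 -> S k) -> S k0) -> S K.
Proof.
move=> K0 [d d0 hd] prog lim.
pose A := [set k : R | (0 < k <= K) /\ forall k', 0 < k' -> k' <= k -> S k'].
have A1 : A (Num.min (d / 2) K).
  split; first by rewrite lt_min K0 divr_gt0 //= ge_min lexx orbT.
  move=> k' k'0; rewrite le_min => /andP[h1 h2]; apply: hd => //.
  by apply: le_lt_trans h1 _; lra.
have sA : has_sup A.
  by split; [exists (Num.min (d / 2) K)|exists K => k [/andP[]]].
set s := sup A.
have As k : A k -> k <= s by apply: sup_upper_bound.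
have s0 : 0 < s by apply: lt_le_trans (As _ A1); case: A1 => /andP[].
have sK : s <= K by apply: ge_sup => [|k [/andP[]]//]; case: sA.
have below k : 0 < k -> k < s -> S k.
  move=> k0 ks; have ks' : 0 < s - k by rewrite subr_gt0.
  by have [k1 [_ h1]] := sup_adherent ks' sA; rewrite subKr => /ltW h2; apply: h1.
have Ss : S s by apply: lim.
move: sK; rewrite le_eqVlt => /orP[/eqP <- //|sK].
have [d1 d10 h1] := prog s s0 sK Ss.
pose k2 := Num.min (s + d1 / 2) K.
have : A k2.
  split; first by rewrite /k2 lt_min ge_min lexx orbT K0 !andbT; lra.
  move=> k' k'0; rewrite le_min => /andP[h2 h3].
  have [ks|ks] := ltP k' s; first exact: below.
  by move: ks; rewrite le_eqVlt => /orP[/eqP <- //|ks]; apply: h1 => //; lra.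
move=> /As; rewrite ge_min => /orP[]; first by lra.
by rewrite leNgt sK.
Qed.

Lemma dl0_const (u : nodeT -> R) : (forall j, node_diff src tgt u j = 0) -> forall s t, u s = u t.
Proof.
move=> d0.
have nd e j : (j <= P.+2)%N -> u (node e j) = u (inl (src e)).
  elim: j => // j IH hj; rewrite -IH ?(ltnW hj) //.
  by have := d0 (e, Ordinal hj); rewrite /node_diff /= => /eqP; rewrite subr_eq0 => /eqP.
have vc v v' : u (inl v) = u (inl v').
  apply: (connected_const (u := fun v => u (inl v)) conn) => e.
  by rewrite -(nd e P.+2) // /node ltnn.
move=> s t.
have [[e [j hj]] hs] := node_cover inc s; have [[e' [j' hj']] ht] := node_cover inc t.
transitivity (u (inl (src e))); first by case: hs => /= ->; apply: nd; rewrite // ltnW.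
rewrite (vc _ (src e')); apply/esym; by case: ht => /= ->; apply: nd; rewrite // ltnW.
Qed.

(** As k tends to 0, [be] tends to 0 but [al] blows up, so [al] is frozen at its smaller value at K.
    The limiting form is a sum of squares whose kernel consists of constants, and [neg_jump] leaves
    an index of at most 1. *)
Lemma psd_start K : fine_grid K -> exists2 d : R, 0 < d & forall k, 0 < k -> k < d -> k <= K ->
  forall N : nat, negfam (QM k) N -> (N <= 1)%N.
Proof.
move=> ok; pose Q0 := Qm src tgt (P := P) (al K) (fun=> 0).
have Q0E g : bil Q0 g g = \sum_j al K j.1 * (node_diff src tgt g j * node_diff src tgt g j).
  by rewrite bil_Qm; apply: eq_bigr => j _; rewrite mul0r subr0.
have aK e : 0 < al K e by rewrite invr_gt0 be_gt0.
have [eps eps0 hj] := neg_jump (Qm_sym src tgt (al K) (fun=> 0) : symf Q0).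
have [dq dq0 hq] := Qm_close src tgt P eps0.
have [e|d d0 hd] := @fin_delta (fun e r => 0 <= r -> `|be r e| <= dq).
  have h0 : len e / (2 * P.+2%:R) * 0 < pi / 2 by rewrite mulr0 pi2_gt0.
  have [d d0 h] := near_tan (ltW (cE e)) dq0 (lexx 0) h0.
  by exists d => // r rd r0; move: (h r r0); rewrite subr0 mulr0 tan0 subr0 ger0_norm // => /(_ rd); rewrite /be hangE.
exists d => // k k0 kd kK N [g hg].
have ng : negfam (Qm src tgt (P := P) (al K) (be k)) N.
  exists g => c /hg; apply: le_lt_trans; rewrite bil_QM bil_Qm; apply: ler_sum => j _.
  rewrite lerD2r ler_wpM2r // -?expr2 ?sqr_ge0 //.
  by move: kK; rewrite le_eqVlt => /orP[/eqP -> //|kK]; apply/ltW/al_lt.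
have cl e : `|al K e - al K e| <= dq /\ `|be k e - 0| <= dq.
  by rewrite subrr normr0 ltW // subr0; split => //; apply: hd => //; exact: ltW.
have [M [MN nM nN]] := hj _ (hq _ _ _ _ cl) N ng.
have M0 : M = 0%N.
  case: M nM {MN nN} => // M [f hf]; exfalso.
  have := hf (fun=> 1) (ex_intro _ ord0 (oner_neq0 R)); rewrite Q0E ltNge => /negP; apply.
  by apply: sumr_ge0 => j _; rewrite mulr_ge0 ?(ltW (aK _)) // -expr2 sqr_ge0.
move: nN; rewrite M0 subn0 => -[f [fn fi]].
have cst i : forall s t, f i s = f i t.
  have d0' : forall j, node_diff src tgt (f i) j = 0.
    move=> j; have := fn i (f i); rewrite Q0E => /eqP.
    rewrite psumr_eq0 => [/allP /(_ j)|j' _]; last by rewrite mulr_ge0 ?(ltW (aK _)) // -expr2 sqr_ge0.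
    by rewrite mem_index_enum /= mulf_eq0 gt_eqF //= mulf_eq0 orbb => /(_ isT)/eqP.
  exact: dl0_const.
rewrite leqNgt; apply/negP => N1.
have [s0|nos] := pselect (exists s0 : nodeT, True); last first.
  by have := fi (fun=> 1) _ (Ordinal N1); move=> h; have /eqP := h (fun t => False_ind _ (nos (ex_intro _ t I))); rewrite oner_eq0.
have [|b [[i bi] hb]] := @dependent R (ordinal N) unit (fun i _ => f i (projT1 (cid s0))).
  by rewrite card_unit card_ord.
by move: bi; rewrite (fi b) ?eqxx // => t; rewrite -[RHS](hb tt); apply: eq_bigr => j _; congr (_ * _); exact: cst.
Qed.

Lemma const_eig : inhabited E -> indep_eig src tgt len (fun mu => mu = 0) 1.
Proof.
move=> [e0]; exists (fun _ _ _ => 1); split.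
  move=> _; exists 0; split=> //; split; last split.
  - move=> e x; have D : derive1 (fun _ : R => 1 : R) = fun=> 0.
      by apply/funext => y; rewrite derive1_cst.
    by rewrite D derive1_cst mulr1 oppr0; split; [|split].
  - by exists (fun=> 1).
  - move=> v; rewrite big1 => [|e _]; last by rewrite derive1_cst.
    by rewrite big1 ?subrr // => e _; rewrite derive1_cst.
move=> c hc i; have := hc e0 0; rewrite lexx (ltW (lpos e0)) big_ord1 mulr1 => /(_ isT).
by rewrite (ord1 i).
Qed.

(* Real induction on k: the index only grows across a k0 at which the form is
   degenerate, and there the kernel provides eigenfunctions for k0 ^ 2. *)
Lemma negfam_eig K : fine_grid K -> forall N, negfam (QM K) N ->
  indep_eig src tgt len (fun mu => mu < K ^+ 2) N.
Proof.
move=> ok; have [K0 _] := ok.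
apply: (@real_ind K (fun k => forall N, negfam (QM k) N -> indep_eig src tgt len (fun mu => mu < k ^+ 2) N)) => //.
- have [d d0 hd] := psd_start ok; exists d => // k k0 kd kK N nf.
  have := hd k k0 kd kK N nf; case: N nf => [|[|//]] nf _.
    by exists (fun _ _ _ => 0); split => [[]|c _ []].
  apply: (@indep_eig_mono _ _ _ _ _ _ (fun mu => mu = 0)) => [mu ->|]; first by rewrite exprn_gt0.
  apply: const_eig; case: nf => g hg.
  have [[s gs]|no] := pselect (exists s, g ord0 s != 0).
    by have [[e _] _] := node_cover inc s; exists.
  have := hg (fun=> 1) (ex_intro _ ord0 (oner_neq0 R)).
  rewrite (_ : lincomb _ _ = fun=> 0) ?bil0l ?ltxx //.
  apply/funext => s; rewrite /lincomb big_ord1 mul1r; apply/eqP/negPn/negP => h.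
  by apply: no; exists s.
- move=> k0 k00 k0K IH; have ok0 := fine_grid_le k00 (ltW k0K) ok.
  have [eps eps0 hj] := neg_jump (@QM_sym k0).
  have [dq dq0 hq] := Qm_close src tgt P eps0.
  have [d d0 hd] := coef_cont ok0 dq0.
  exists d => // k kk kd kK N nf.
  have kg : 0 <= k by apply/ltW/(lt_trans k00).
  have dk : `|k - k0| < d by rewrite gtr0_norm ?subr_gt0 // ltrBlDl.
  have [M [MN /IH nM nN]] := hj _ (hq _ _ _ _ (hd k kg dk)) N nf.
  have [F [hF iF]] := nullfam_eig ok0 nN.
  rewrite -(subnKC MN); apply: (indep_eig_glue lpos _ nM hF iF).
  by rewrite ltr_pXn2r // nnegrE ltW.
- move=> k0 k00 k0K IH N nf; have ok0 := fine_grid_le k00 k0K ok.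
  (* A negative family at k0 survives slightly to the left of k0, where the assertion is already
     known. *)
  have [eps eps0 hj] := neg_open (@QM_sym k0) nf.
  have [dq dq0 hq] := Qm_close src tgt P eps0.
  have [d d0 hd] := coef_cont ok0 dq0.
  have [mm [mp m1 m2]] : exists mm : R, [/\ 0 < mm, mm <= d / 2 & mm <= k0 / 2].
    exists (Num.min (d / 2) (k0 / 2)); split; last by rewrite ge_min lexx orbT.
      by rewrite lt_min !divr_gt0.
    by rewrite ge_min lexx.
  pose k := k0 - mm.
  have kp : 0 < k by rewrite subr_gt0; apply: le_lt_trans m2 _; rewrite ltr_pdivrMr // ltr_pMr // ltr1n.
  have kk : k < k0 by rewrite ltrBlDr ltrDl.
  have dk : `|k - k0| < d.
    by rewrite ltr0_norm ?subr_lt0 // opprB subKr; apply: le_lt_trans m1 _; rewrite ltr_pdivrMr // ltr_pMr // ltr1n.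
  have := IH k kp kk N (hj _ (hq _ _ _ _ (hd k (ltW kp) dk))).
  apply: indep_eig_mono => mu h; apply: lt_trans h _.
  by rewrite ltr_pXn2r // nnegrE ltW.
Qed.

Lemma index_negfam k N : fine_grid k -> negfam (QM k) N -> ~ negfam (QM k) N.+1 ->
  count_below src tgt len (k ^+ 2) N.
Proof. by move=> ok h1 h2; split; [exact: negfam_eig|move=> /(eig_negfam ok)]. Qed.

Lemma simple_nullfam k : fine_grid k -> nullfam (QM k) 1 -> ~ nullfam (QM k) 2 ->
  simple_eig src tgt len (k ^+ 2).
Proof.
move=> ok /(nullfam_eig ok) [F [hF iF]] h2; split; first by exists F; split=> // i; exists (k ^+ 2).
move=> [G [hG iG]]; apply: h2; apply: (@eig_nullfam _ _ G) => // i.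
by have [mu [<-]] := hG i.
Qed.

End Spectrum.

(** * The index as a number of sign changes on a tree *)

Section Index.
Variables (R : realType) (V E : finType) (src tgt : E -> V) (len : E -> R) (P : nat).
Hypothesis lpos : forall e, 0 < len e.
Hypothesis conn : connected_graph src tgt.
Hypothesis tree : (#|E|.+1 = #|V|)%N.
Hypothesis inc : forall v, exists e, src e = v \/ tgt e = v.
Local Notation nodeT := (nodeT V E P).
Local Notation pieceT := (pieceT E P).
Local Notation node := (@node V E src tgt P).
Local Notation dg := (node_diff src tgt).
Local Notation QM := (QM src tgt len (P := P)).

Lemma card_pieceT : #|pieceT|.+1 = #|nodeT|.
Proof. by rewrite card_sum !card_prod !card_ord -tree; lia. Qed.

(** Cutting j disconnects the tree, and u is a step across the cut. It is found by counting: there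
    is one node more than pieces, so a nonzero u can vanish at one node and have no step on the
    other pieces. *)
Lemma dirac_pot (j : pieceT) : exists2 u : nodeT -> R, dg u j != 0 & forall j', j' != j -> dg u j' = 0.
Proof.
have s0 : nodeT := node j.1 0.
pose g (s : nodeT) (t : option {j' : pieceT | j' != j}) : R :=
  if t is Some j' then dg (dirac1 R s) (val j') else dirac1 R s s0.
have [|u [[s us] hu]] := @dependent R nodeT (option {j' : pieceT | j' != j}) g.
  rewrite card_option card_sig -card_pieceT ltnS.
  rewrite [X in (X < _)%N](_ : _ = #|predC1 j|); last by apply: eq_card.
  by rewrite cardC1; have : (0 < #|pieceT|)%N by [apply/card_gt0P; exists j]; lia.
have dE j' : j' != j -> dg u j' = 0.
  move=> jj; rewrite -[RHS](hu (Some (exist _ j' jj))) /g /= -node_diff_sum.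
  by apply: eq_bigr => s' _; rewrite mulrC.
have u0 : u s0 = 0.
  by rewrite -[RHS](hu None) /g -[LHS]dirac_sum; apply: eq_bigr => s' _; rewrite mulrC.
exists u => //; apply/negP => /eqP dj; case/eqP: us; rewrite -u0; apply: dl0_const => // j'.
by have [->|/dE] := eqVneq j' j.
Qed.

Variables (k : R) (w : nodeT -> R).
Hypothesis ok : fine_grid len P k.
Hypothesis wnull : forall h, Qk src tgt len k w h = 0.
Hypothesis wnz : forall s, w s != 0.

Definition weight (j : pieceT) : R := (al len P k j.1 + be len P k j.1) * (w (node j.1 j.2) * w (node j.1 j.2.+1)).

(* Substituting w * u for a kernel vector w diagonalises the form. *)
Lemma Qk_mul (u v : nodeT -> R) :
  Qk src tgt len k (fun s => w s * u s) (fun s => w s * v s) = \sum_j weight j * (dg u j * dg v j).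
Proof.
rewrite -[RHS]addr0 -[X in _ + X](wnull (fun s => w s * (u s * v s))) /Qk /qform -big_split /=.
by apply: eq_bigr => j _; rewrite /weight /node_diff /node_sum; ring.
Qed.

Lemma ab_gt0 e : 0 < al len P k e + be len P k e.
Proof. by have b := be_gt0 lpos e ok; rewrite addr_gt0 // invr_gt0. Qed.

Lemma weight_nz j : weight j != 0.
Proof. by rewrite !mulf_neq0 // gt_eqF // ab_gt0. Qed.

Definition flips := [set j : pieceT | w (node j.1 j.2) * w (node j.1 j.2.+1) < 0]%SET.

Lemma weight_lt0 j : (weight j < 0) = (j \in flips).
Proof. by rewrite inE /weight pmulr_rlt0 // ab_gt0. Qed.

Lemma node_diff_lincomb (I : finType) (c : I -> R) (g : I -> nodeT -> R) j : dg (lincomb c g) j = \sum_i c i * dg (g i) j.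
Proof. by rewrite /node_diff /lincomb -sumrB; apply: eq_bigr => i _; rewrite mulrBr. Qed.

(** The step functions across the flipped pieces, multiplied by w, are orthogonal for the form and
    have negative values. *)
Lemma flips_negfam : negfam (QM k) #|flips|.
Proof.
have /boolp.choice[U hU] : forall j, exists u : nodeT -> R, dg u j != 0 /\ forall j', j' != j -> dg u j' = 0.
  by move=> j; have [u] := dirac_pot j; exists u.
pose g := fun i => U (enum_val (A := mem flips) i).
exists (fun i s => w s * g i s) => c [i0 ci].
have -> : lincomb c (fun i s => w s * g i s) = fun s => w s * lincomb c g s.
  by apply/funext => s; rewrite /lincomb mulr_sumr; apply: eq_bigr => i _; rewrite mulrCA.
rewrite bil_QM Qk_mul.
have D i : dg (lincomb c g) (enum_val i) = c i * dg (g i) (enum_val i).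
  rewrite node_diff_lincomb (bigD1 i) //= big1 ?addr0 // => i' ii; case: (hU (enum_val i')) => _ ->.
    by rewrite mulr0.
  by apply: contra_neq ii => /enum_val_inj.
rewrite -oppr_gt0 -sumrN (bigD1 (enum_val i0)) //= ltr_wpDr //.
  apply: sumr_ge0 => j _; have [jf|jf] := boolP (j \in flips).
    by rewrite oppr_ge0 mulr_le0_ge0 -?expr2 ?sqr_ge0 // ltW // weight_lt0.
  rewrite node_diff_lincomb big1 ?mul0r ?mulr0 ?oppr0 // => i _; case: (hU (enum_val i)) => _ ->.
    by rewrite mulr0.
  by apply: contraNneq jf => ->; exact: enum_valP.
rewrite oppr_gt0 nmulr_rlt0; last by rewrite weight_lt0 enum_valP.
by rewrite D -expr2 exprn_even_gt0 //= mulf_neq0 //; case: (hU (enum_val i0)).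
Qed.

Lemma wK (g : nodeT -> R) : g = fun s => w s * (g s / w s).
Proof. by apply/funext => s; rewrite mulrC divfK. Qed.

(** One function too many allows a combination whose quotient by w has no step on the flipped
    pieces, and all other weights are positive. *)
Lemma flips_max : ~ negfam (QM k) #|flips|.+1.
Proof.
move=> [g hg].
have [|c [cn hc]] := @dependent R 'I_#|flips|.+1 'I_#|flips|
   (fun i t => dg (fun s => g i s / w s) (enum_val (A := mem flips) t)).
  by rewrite !card_ord.
have := hg c cn; rewrite ltNge => /negP; apply.
rewrite bil_QM (wK (lincomb c g)) Qk_mul; apply: sumr_ge0 => j _.
have [jf|jf] := boolP (j \in flips).
  rewrite (_ : dg _ j = 0) ?mul0r ?mulr0 //.
  rewrite -[RHS](hc (enum_rank_in jf j)) enum_rankK_in // -node_diff_lincomb.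
  congr (dg _ j); apply/funext => s.
  by rewrite /lincomb mulr_suml; apply: eq_bigr => i _; rewrite mulrA.
by rewrite mulr_ge0 -?expr2 ?sqr_ge0 // leNgt weight_lt0.
Qed.

(** Testing against the step across j isolates the jump of g / w on j with a nonzero factor, so this
    quotient has no jumps at all. *)
Lemma null_mult g : (forall h, Qk src tgt len k g h = 0) -> exists a, g = fun s => a * w s.
Proof.
move=> gn; have cst : forall s t, g s / w s = g t / w t.
  apply: (dl0_const conn inc) => j; have [u uj hu] := dirac_pot j.
  have := gn (fun s => w s * u s); rewrite [in Qk _ _ _ _ g](wK g) Qk_mul (bigD1 j) //= big1 => [|j' jj].
    by rewrite addr0 => /eqP; rewrite mulf_eq0 (negbTE (weight_nz j)) /= mulf_eq0 (negbTE uj) orbF => /eqP.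
  by rewrite hu // !mulr0.
have [s0|no] := pselect (exists s0 : nodeT, True); last first.
  by exists 0; apply/funext => s; case: no; exists s.
exists (g (projT1 (cid s0)) / w (projT1 (cid s0))).
by apply/funext => s; rewrite -(cst s) divfK.
Qed.

Lemma null_simple : inhabited E -> nullfam (QM k) 1 /\ ~ nullfam (QM k) 2.
Proof.
move=> [e0]; split.
  exists (fun=> w); split=> [i h|c hc i]; first by rewrite bil_QM.
  have := hc (inl (src e0)); rewrite /lincomb big_ord1 (ord1 i) => /eqP.
  by rewrite mulf_eq0 (negbTE (wnz _)) orbF => /eqP.
move=> [g [gn gi]].
have /boolp.choice[a ha] : forall i, exists a, g i = fun s => a * w s.
  by move=> i; apply: null_mult => h; rewrite -bil_QM.
have [|c [[i ci] hc]] := @dependent R 'I_2 unit (fun i _ => a i).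
  by rewrite card_unit card_ord.
case/eqP: ci; apply: gi => s; rewrite /lincomb.
under eq_bigr do rewrite ha mulrA.
by rewrite -mulr_suml (hc tt) mul0r.
Qed.

Lemma index : inhabited E -> simple_eig src tgt len (k ^+ 2) /\ count_below src tgt len (k ^+ 2) #|flips|.
Proof.
move=> e0; have [n1 n2] := null_simple e0; split; first exact: simple_nullfam n1 n2.
apply: (@index_negfam _ _ _ _ _ _ P) => //; [exact: flips_negfam|exact: flips_max].
Qed.

End Index.

(** * Labels as numbers of zeros *)

Section Cosine.
Variable R : realType.
Local Notation pi := (@pi R).

(** Over less than one unit at most one integer is crossed, and the sine changes sign exactly there.
    Differences of floors are used because they telescope along an edge. *)
Lemma sin_flip (t t' : R) : t < t' -> t' < t + 1 -> sin (pi * t) != 0 -> sin (pi * t') != 0 ->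
  ((sin (pi * t) * sin (pi * t') < 0)%R : nat)%:Z = Num.floor t' - Num.floor t.
Proof.
move=> tt tt1 s0 s1; pose n := Num.floor t.
have /andP[n1 n2] : n%:~R <= t < (n + 1)%:~R by exact: floor_itv.
have [s [ss hs _]] := @pi_shift R n.
have p0 := pi_gt0 R.
have pos (r : R) : 0 < r < 1 -> 0 < sin (pi * r).
  by move=> /andP[r0 r1]; apply: sin_gt0_pi; rewrite mulr_gt0 //= gtr_pMr.
have r0 : t != n%:~R.
  apply: contra_neq s0 => ->; rewrite -[pi * _]add0r hs sin0 mulr0 //.
rewrite intrD in n2.
have tr : 0 < t - n%:~R < 1.
  by rewrite subr_gt0 lt_neqAle eq_sym r0 n1 /= ltrBlDl.
have e1 : sin (pi * t) = s * sin (pi * (t - n%:~R)) by rewrite -hs; congr sin; ring.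
have e2 : sin (pi * t') = s * sin (pi * (t' - n%:~R)) by rewrite -hs; congr sin; ring.
have -> : sin (pi * t) * sin (pi * t') = sin (pi * (t - n%:~R)) * sin (pi * (t' - n%:~R)).
  by rewrite e1 e2 mulrACA ss mul1r.
rewrite pmulr_rlt0 ?pos //.
have [c|c] := ltP t' (n%:~R + 1).
  have -> : Num.floor t' = n.
    by apply: floor_def; rewrite intrD c andbT; apply: le_trans n1 (ltW tt).
  rewrite subrr ltNge ltW // pos // subr_gt0 ltrBlDl c andbT.
  exact: le_lt_trans n1 tt.
have -> : Num.floor t' = n + 1.
  apply: floor_def; rewrite !intrD c /=; apply: lt_trans tt1 _; by rewrite ltrD2r.
rewrite addrAC subrr add0r.
have cn : t' != n%:~R + 1.
  apply: contra_neq s1 => ->; have := hs pi; rewrite sinpi mulr0 => <-.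
  by congr sin; rewrite mulrDr mulr1 addrC.
have -> : sin (pi * (t' - n%:~R)) = - sin (pi * (t' - n%:~R - 1)).
  rewrite -[in LHS](subrK 1 (t' - n%:~R)) mulrDr mulr1 sinDpi //.
rewrite oppr_lt0 pos //.
by apply/andP; split; [rewrite subr_gt0 ltrBrDl lt_neqAle eq_sym cn|move: tt1 n2; lra].
Qed.
End Cosine.

Section Count.
Variables (R : realType) (V E : finType) (src tgt : E -> V) (len : E -> R).
Hypothesis lpos : forall e, 0 < len e.
Hypothesis conn : connected_graph src tgt.
Hypothesis tree : (#|E|.+1 = #|V|)%N.
Hypothesis inc : forall v, exists e : E, src e = v \/ tgt e = v.
Local Notation pi := (@pi R).

(* A number is of the form n / p with 0 < n < p for at most one prime p. *)
Lemma eventually_prime (I : finType) (x : I -> R) : exists N, forall p, prime p -> (N < p)%N ->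
  forall i n, (0 < n < p)%N -> x i != n%:R / p%:R.
Proof.
have /boolp.choice[N hN] : forall i, exists N, forall p, prime p -> (N < p)%N ->
    forall n, (0 < n < p)%N -> x i != n%:R / p%:R.
  move=> i.
  have [[p0 [n0 [/andP[n00 n0p] pr0 E0]]]|no] := pselect (exists p0 n0 : nat,
     [/\ (0 < n0 < p0)%N, prime p0 & x i = n0%:R / p0%:R]); last first.
    exists 0%N => p pr _ n np; apply/negP => /eqP En; apply: no.
    by exists p, n.
  exists p0 => p pr pp n /andP[n1 np]; rewrite E0; apply/negP.
  have p0z : p0%:R != 0 :> R by rewrite pnatr_eq0 -lt0n prime_gt0.
  have pz : p%:R != 0 :> R by rewrite pnatr_eq0 -lt0n prime_gt0.
  rewrite eqr_div // -!natrM eqr_nat => /eqP En.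
  have : (p %| n * p0)%N by rewrite -En dvdn_mull.
  by rewrite Euclid_dvdM // => /orP[/(dvdn_leq n1)|/(dvdn_leq (prime_gt0 pr0))]; lia.
exists (\max_i N i)%N => p pr Np i; apply: hN => //.
by apply: leq_ltn_trans Np; apply: leq_bigmax.
Qed.

Variables (k : R) (A B : E -> R).
Hypothesis k0 : 0 < k.
Let f e x := A e * cos (k * x - B e).
Hypothesis fe : is_eigsol src tgt len (k ^+ 2) f.
Hypothesis fnz : forall e, f e 0 != 0 /\ f e (len e) != 0.

(** Scaled so that f is a multiple of sin (pi [turns]): it vanishes where [turns] is an integer. *)
Definition turns e x : R := (k * x - B e) / pi + 1 / 2.

Lemma pine0 : pi != 0. Proof. by rewrite gt_eqF // pi_gt0. Qed.

Lemma fE e x : f e x = A e * sin (pi * turns e x).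
Proof.
rewrite /f -sinDpihalf; congr (_ * sin _); rewrite /turns.
by move: pine0; generalize pi => p p0; field.
Qed.

(** The index formula asks for nonzero values at all nodes. Cutting each edge into a prime number p
    of pieces puts the inner nodes at the fractions n / p, and finitely many zeros obstruct only
    finitely many primes. *)
Lemma choose_P : exists P, fine_grid len P k /\
  forall e i, (i <= P.+2)%N -> f e (i%:R * len e / P.+2%:R) != 0.
Proof.
have kl e : 0 < k * len e by rewrite mulr_gt0.
(* A bound for the absolute value of [turns] on every edge: the zeros are numbered by integers
   between - M and M, and [x] lists their relative positions. *)
pose S := \sum_e ((k * len e + `|B e|) / pi + 1).
have T0 e : 0 <= (k * len e + `|B e|) / pi + 1.
  by rewrite addr_ge0 // divr_ge0 ?pi_ge0 // addr_ge0 // ltW.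
have S0 : 0 <= S by apply: sumr_ge0.
have Se e : (k * len e + `|B e|) / pi + 1 <= S.
  by rewrite /S (bigD1 e) //= lerDl; apply: sumr_ge0.
set M := Num.bound S; have SM : S < M%:R by apply: archi_boundP.
pose x (j : E * 'I_(2 * M).+1) : R :=
  (pi * ((j.2%:R - M%:R) - 1 / 2) + B j.1) / (k * len j.1).
have [N hN] := eventually_prime x.
have [p pb pr] := prime_above (maxn N M).
have p1 := prime_gt1 pr.
exists (p - 2)%N; have -> : (p - 2).+2 = p by lia.
have p0 : 0 < p%:R :> R by rewrite ltr0n; lia.
split.
  split=> // e; rewrite /half_step; have -> : (p - 2).+2 = p by lia.
  have Mp : M%:R <= p%:R :> R by rewrite ler_nat; lia.
  have h1 : k * len e / pi < p%:R.
    apply: lt_le_trans Mp; apply: le_lt_trans SM; apply: le_trans (Se e).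
    by rewrite mulrDl -addrA lerDl addr_ge0 // divr_ge0 ?pi_ge0.
  rewrite ltr_pdivrMr ?mulr_gt0 //; move: h1; rewrite ltr_pdivrMr ?pi_gt0 // => h1.
  by rewrite (_ : pi / 2 * (2 * p%:R) = p%:R * pi) //; generalize pi => q; field.
move=> e i ip; have [f0 fl] := fnz e.
have A0 : A e != 0 by apply: contraNneq f0; rewrite /f => ->; rewrite mul0r.
have [i0|i0] := posnP i; first by rewrite i0 !mul0r.
move: ip; rewrite leq_eqVlt => /orP[/eqP ->|ip].
  by rewrite mulrAC divff ?mul1r // gt_eqF.
rewrite fE mulf_neq0 //; apply/negP => /eqP /sin_pi_eq0 [z hz].
have zM : (`|z| < M)%N.
  rewrite -(ltr_nat R) natr_absz intr_norm -hz; apply: le_lt_trans SM; apply: le_trans (Se e).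
  apply: (le_trans (ler_normD _ _)); apply: lerD.
    rewrite normrM normfV (gtr0_norm (pi_gt0 R)) ler_pM2r ?invr_gt0 ?pi_gt0 //.
    apply: (le_trans (ler_normB _ _)); rewrite lerD2r ger0_norm.
      rewrite ler_pM2l // -mulrA mulrC -mulrA ler_piMr ?(ltW (lpos e)) //.
      by rewrite mulrC ler_pdivrMr // mul1r ler_nat ltnW.
    by rewrite mulr_ge0 ?(ltW k0) // mulr_ge0 ?invr_ge0 ?(ltW p0) // mulr_ge0 // ltW.
  by rewrite ger0_norm; lra.
have mP : (`|(z + M%:Z)%R| < (2 * M).+1)%N by lia.
have := hN p pr _ (e, Ordinal mP) i; rewrite i0 ip; move/(_ _ isT)/negP; apply; first by lia.
apply/eqP; rewrite /x /=.
have -> : (`|(z + M%:Z)%R|%N)%:R = z%:~R + M%:R :> R.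
  rewrite -[M%:R]/(M%:Z%:~R) -intrD natr_absz ger0_norm //; lia.
have kn : k != 0 by rewrite gt_eqF. have ln : len e != 0 by rewrite gt_eqF.
have pn : p%:R != 0 :> R by rewrite gt_eqF.
rewrite addrK -hz /turns; move: pine0; generalize pi => q q0; field; by rewrite ?q0 ?kn ?ln ?pn.
Qed.

(** A flipped piece is one on which [turns] passes an integer; summing over the pieces of an edge
    leaves the floors at its two ends. *)
Lemma eigen_index : inhabited E -> simple_eig src tgt len (k ^+ 2) /\
  exists2 N, count_below src tgt len (k ^+ 2) N &
    N%:Z = \sum_e (Num.floor (turns e (len e)) - Num.floor (turns e 0)).
Proof.
move=> e0; have [P [ok nz]] := choose_P.
have [_ [[g hg] _]] := fe.
pose w := vec len (P := P) f g.
have wn e i : (i <= P.+2)%N -> w (node src tgt P e i) = f e (i%:R * len e / P.+2%:R).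
  by move=> hi; have [h1 h2] := hg e; apply: vec_node.
have wnz s : w s != 0.
  have [[e [i hi]] []] := node_cover inc s; move=> /= ->; rewrite wn ?nz //.
    exact: ltnW. exact: ltnW.
have wnull h : Qk src tgt len k w h = 0 by apply: eig_null.
have [si cb] := index lpos conn tree inc ok wnull wnz e0.
split=> //; exists #|flips src tgt w| => //.
have pN : P.+2%:R != 0 :> R by rewrite pnatr_eq0.
rewrite -sum1_card (big_morph Posz PoszD (erefl _)) big_mkcond /=.
rewrite [LHS](_ : _ = \sum_(j : pieceT E P) (Num.floor (turns j.1 (j.2.+1%:R * len j.1 / P.+2%:R)) - Num.floor (turns j.1 (j.2%:R * len j.1 / P.+2%:R)))).
  rewrite -(pair_bigA _ (fun e (i : 'I_P.+2) => Num.floor (turns e (i.+1%:R * len e / P.+2%:R)) - Num.floor (turns e (i%:R * len e / P.+2%:R)))) /=.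
  apply: eq_bigr => e _.
  rewrite -(big_mkord xpredT (fun i => Num.floor (turns e (i.+1%:R * len e / P.+2%:R)) - Num.floor (turns e (i%:R * len e / P.+2%:R)))).
  by rewrite telescope_sumr // mulrAC divff // mul1r !mul0r.
apply: eq_bigr => -[e [i hi]] _; rewrite inE /=.
have nz1 := nz e i (ltnW hi); have nz2 := nz e i.+1 hi.
have A0 : A e != 0 by apply: contraNneq nz1; rewrite /f => ->; rewrite mul0r.
rewrite !wn //; last exact: ltnW.
have d1 : turns e (i.+1%:R * len e / P.+2%:R) = turns e (i%:R * len e / P.+2%:R) + 2 * half_step len P k e / pi.
  rewrite /turns /half_step -[i.+1%:R]natr1; move: pine0 pN; generalize pi (P.+2%:R : R) => p q p0 q0; field; by rewrite /= ?p0 -natrD pnatr_eq0.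
have h0 := half_step_gt0 P lpos e k0; have h1 := proj2 ok e.
move: nz1 nz2; rewrite !fE mulf_eq0 negb_or => /andP[_ s1]; rewrite mulf_eq0 negb_or => /andP[_ s2].
rewrite -sin_flip //.
- rewrite mulrACA -expr2 pmulr_rlt0 ?exprn_even_gt0 //.
  by case: (_ < 0).
- by rewrite d1 ltrDl divr_gt0 ?pi_gt0 ?mulr_gt0.
- by rewrite d1 ltrD2l ltr_pdivrMr ?pi_gt0 // mul1r; move: h1; lra.
Qed.

End Count.

(** * Phases along a progression of frequencies *)

(* A branch: its first edge, the far vertex of this edge, and, unless that vertex
   is a leaf, the two branches beyond it. *)
Inductive btree (V E : Type) := L of E & V | N of E & V & btree V E & btree V E.
Arguments L {V E}. Arguments N {V E}.

Section Trees.
Variables (R : realType) (V E : finType) (len : E -> R).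
Local Notation pi := (@pi R).
Local Notation btree := (btree V E).

Definition rt (t : btree) : E := match t with L e _ => e | N e _ _ _ => e end.

Fixpoint edges (t : btree) : seq E :=
  match t with L e _ => [:: e] | N e _ a b => e :: edges a ++ edges b end.

(* On the first edge of t a solution is proportional to cos (k * y + psi t), where y
   is the distance from the far vertex; ph is the argument at the near end. *)
Fixpoint ph (t : btree) (k : R) : R :=
  match t with L e _ => k * len e | N e _ a b => k * len e + join_phase (ph a k) (ph b k) end.

(** The recursion of [ph] written as a composition of shears, in units of pi. Both children come
    first, so that their coordinates already hold phases when e is sheared. *)
Fixpoint shear_phases (t : btree) (x : E -> nat -> R) : E -> nat -> R :=
  match t with
  | L _ _ => x
  | N e _ a b => let y := shear_phases b (shear_phases a x) in
     fun e' j => if e' == e then y e j + join_phase (pi * y (rt a) j) (pi * y (rt b) j) / pi else y e' j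
  end.

Lemma rt_edges t : rt t \in edges t.
Proof. by case: t => [e v|e v a b]; rewrite /= inE eqxx. Qed.

Lemma shear_phases_out t x e' : e' \notin edges t -> shear_phases t x e' = x e'.
Proof.
elim: t x => //= e v a IHa b IHb x; rewrite inE negb_or mem_cat negb_or => /and3P[ne na nb].
by apply/funext => j; rewrite (negbTE ne) IHb // IHa.
Qed.

Lemma shear_phases_equidist t x : uniq (edges t) -> equidist x -> equidist (shear_phases t x).
Proof.
elim: t x => //= e v a IHa b IHb x /andP[ne]; rewrite cat_uniq => /and3P[ua /hasPn ab ub] hx.
move: ne; rewrite mem_cat negb_or => /andP[na nb].
apply: (@shear _ _ (fun u v => join_phase (pi * u) (pi * v) / pi)) => //.
- by apply: contraNneq na => ->; apply: rt_edges.
- by apply: contraNneq nb => ->; apply: rt_edges.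
- by apply: contraTneq (rt_edges a) => ->; apply: ab; apply: rt_edges.
- exact: join_phase_cont.
- by apply: IHb => //; apply: IHa.
Qed.

Fixpoint consist (t : btree) (x : E -> nat -> R) (j : nat) (k : R) : Prop :=
  match t with
  | L e _ => x e j = ph t k / pi
  | N e _ a b => [/\ x e j = ph t k / pi, consist a x j k & consist b x j k]
  end.

Lemma consist_rt t x j k : consist t x j k -> x (rt t) j = ph t k / pi.
Proof. by case: t => //= e v a b []. Qed.

Lemma consist_ext t x x' j k : (forall e, e \in edges t -> x' e j = x e j) ->
  consist t x j k -> consist t x' j k.
Proof.
elim: t => [e v|e v a IHa b IHb] /= h; first by rewrite h ?inE.
move=> [h1 h2 h3]; split; first by rewrite h ?inE ?eqxx.
  by apply: IHa h2 => e' he; rewrite h // inE mem_cat he orbT.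
by apply: IHb h3 => e' he; rewrite h // inE mem_cat he !orbT.
Qed.

Lemma shear_phases_consist t x (d : R) j : uniq (edges t) ->
  (forall e, e \in edges t -> x e j = j%:R * d * len e / pi) ->
  consist t (shear_phases t x) j (j%:R * d).
Proof.
elim: t x => [e v|e v a IHa b IHb] x; first by move=> _ /= ->; rewrite ?inE.
move=> /= /andP[ne]; rewrite cat_uniq => /and3P[ua /hasPn ab ub] hx.
move: ne; rewrite mem_cat negb_or => /andP[na nb].
have ca : consist a (shear_phases b (shear_phases a x)) j (j%:R * d).
  apply: consist_ext (IHa x ua _) => [e' he|e' he]; last by rewrite hx // inE mem_cat he orbT.
  by rewrite shear_phases_out //; apply: contraL he; apply: ab.
have cb : consist b (shear_phases b (shear_phases a x)) j (j%:R * d).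
  apply: IHb => // e' he; rewrite shear_phases_out; first by rewrite hx // inE mem_cat he !orbT.
  exact: ab.
split=> /=.
- rewrite eqxx (consist_rt ca) (consist_rt cb) !(mulrC pi) !divfK ?gt_eqF ?pi_gt0 //.
  by rewrite shear_phases_out // shear_phases_out // hx ?inE ?eqxx // [RHS]mulrDl.
- by apply: consist_ext ca => e' he; rewrite /= ifN //; apply: contraTneq he => ->.
- by apply: consist_ext cb => e' he; rewrite /= ifN //; apply: contraTneq he => ->.
Qed.

(* An arc of a is stored as (edge, (start, length)). *)
Definition in_arcs (x : E -> nat -> R) (a : seq (E * (R * R))) (j : nat) : bool :=
  all (fun p => inarc p.2.1 p.2.2 (x p.1 j)) a.

Lemma equidist_list x (a : seq (E * (R * R))) : equidist x -> uniq (unzip1 a) ->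
  (forall p, p \in a -> 0 <= p.2.2 <= 1) ->
  lower_mean (fun j => (in_arcs x a j)%:R) (\prod_(p <- a) p.2.2).
Proof.
move=> hx ua ha.
(* Big operators serve as lookup: at most one arc belongs to e, and an edge without an arc gets the
   empty product 1, the whole circle. *)
pose s e := \sum_(p <- a | p.1 == e) p.2.1.
pose lam e := \prod_(p <- a | p.1 == e) p.2.2.
have one p : p \in a -> [seq q <- a | q.1 == p.1] = [:: p].
  move=> pa; elim: a ua {ha s lam} pa => //= q a IH /andP[nq ua]; rewrite inE => /orP[/eqP ->|pa].
    rewrite eqxx; congr (_ :: _); apply/eqP; rewrite -[_ == _]negbK -has_filter; apply/hasPn => r ra.
    by apply: contraNneq nq => <-; apply: map_f.
  rewrite IH // ifN //; apply: contraNneq nq => ->; exact: map_f.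
have sE p : p \in a -> s p.1 = p.2.1 by move=> pa; rewrite /s -big_filter one // big_seq1.
have lE p : p \in a -> lam p.1 = p.2.2 by move=> pa; rewrite /lam -big_filter one // big_seq1.
have l1 e : e \notin unzip1 a -> lam e = 1.
  move=> ne; rewrite /lam big_seq_cond big1 // => p /andP[pa /eqP pe].
  by case/negP: ne; rewrite -pe; apply: map_f.
have l01 e : 0 <= lam e <= 1.
  have [/mapP[p pa ->]|/l1 ->] := boolP (e \in unzip1 a); first by rewrite lE // ha.
  by rewrite lexx ler01.
have := equidist_lower hx s l01.
have -> : \prod_e lam e = \prod_(p <- a) p.2.2.
  rewrite (bigID (mem (unzip1 a))) /= [X in _ * X]big1 => [|e]; last exact: l1.
  rewrite mulr1 -big_uniq // big_map; apply: eq_big_seq => p pa; exact: lE.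
rewrite (_ : (fun j => [forall e, inarc (s e) (lam e) (x e j)]%:R) = (fun j => (in_arcs x a j)%:R)) //.
apply/funext => j; congr (_%:R); congr nat_of_bool; apply/forallP/allP => [h p pa|h e].
  by rewrite -sE // -lE.
have [/mapP[p pa ->]|/l1 ->] := boolP (e \in unzip1 a); last exact: inarc1.
by rewrite sE // lE // h.
Qed.

End Trees.

(** * Lower means and an intermediate value theorem *)

Section Real.
Variable R : realType.

Lemma lower_mean_le (f g : nat -> R) c d : (forall j, f j <= g j) -> d <= c -> lower_mean f c -> lower_mean g d.
Proof.
move=> fg dc hf eta eta0; have [J0 h] := hf eta eta0; exists J0 => J pieceT.
apply: le_trans (le_trans (h J pieceT) _); last by apply: ler_sum.
by rewrite ler_wpM2r // lerD2r.
Qed.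

Lemma lower_mean0 : lower_mean (fun=> 0 : R) 0.
Proof. by move=> eta eta0; exists 0%N => J _; rewrite big1 // sub0r mulNr oppr_le0 mulr_ge0 // ltW. Qed.

Lemma lower_meanD (f g : nat -> R) c d : lower_mean f c -> lower_mean g d -> lower_mean (fun j => f j + g j) (c + d).
Proof.
move=> hf hg eta eta0; have e2 : 0 < eta / 2 by rewrite divr_gt0.
have [J1 h1] := hf _ e2; have [J2 h2] := hg _ e2; exists (maxn J1 J2) => J.
rewrite geq_max => /andP[/h1 {}h1 /h2 {}h2]; rewrite big_split /=.
apply: le_trans (lerD h1 h2); rewrite -mulrDl ler_wpM2r //; lra.
Qed.

Lemma lower_mean_sum (I : Type) (r : seq I) (Pr : pred I) (F : I -> nat -> R) (c : I -> R) :
  (forall i, Pr i -> lower_mean (F i) (c i)) ->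
  lower_mean (fun j => \sum_(i <- r | Pr i) F i j) (\sum_(i <- r | Pr i) c i).
Proof.
move=> h; elim: r => [|i r IH].
  by apply: lower_mean_le lower_mean0 => [j|]; rewrite big_nil.
rewrite big_cons; case: ifP => Pi.
  by apply: lower_mean_le (lower_meanD (h i Pi) IH) => // j; rewrite big_cons Pi.
by apply: lower_mean_le IH => // j; rewrite big_cons Pi.
Qed.

Lemma lip_cont (g : R -> R) M : (forall x y, `|g x - g y| <= M * `|x - y|) -> continuous g.
Proof.
move=> h x; apply/cvgrPdist_lt => e e0; have M1 : 0 < `|M| + 1 by rewrite ltr_wpDl.
near=> y; apply: le_lt_trans (h x y) _.
have : `|x - y| < e / (`|M| + 1).
  by near: y; apply/nbhs_ballP; exists (e / (`|M| + 1)); [exact: divr_gt0|].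
rewrite ltr_pdivlMr //; apply: le_lt_trans; rewrite mulrC ler_wpM2l //.
by apply: le_trans (ler_norm M) _; rewrite lerDl.
Unshelve. all: end_near. Qed.

(** Phases may jump elsewhere, so the Lipschitz bound is available on [a, b] only; composing with
    the clip onto [a, b] extends it to the line. *)
Lemma ivt_lip (f : R -> R) (M a b y : R) : 0 <= M -> a <= b ->
  (forall x x', a <= x -> x <= x' -> x' <= b -> 0 <= f x' - f x <= M * (x' - x)) ->
  f a < y <= f b -> exists2 c, a < c <= b & f c = y.
Proof.
move=> M0 ab h /andP[fa fb].
pose cl x := Num.max a (Num.min b x).
have clab x : a <= cl x <= b by rewrite /cl le_max lexx /= ge_max ab ge_min lexx.
have clm x x' : x <= x' -> 0 <= cl x' - cl x <= x' - x.
  move=> xx; rewrite /cl.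
  have [h1|h1] := leP b x'; have [h2|h2] := leP b x; try by (exfalso; move: h1 h2 xx; clear; lra).
  - by rewrite subrr lexx subr_ge0.
  - have [h3|h3] := leP a b; last by exfalso; move: h3 ab; clear; lra.
    by have [h4|h4] := leP a x; apply/andP; split; lra.
  - by have [h3|h3] := leP a x'; have [h4|h4] := leP a x; apply/andP; split; lra.
pose g x := f (cl x).
have gl x x' : x <= x' -> `|g x' - g x| <= M * `|x' - x|.
  move=> xx; have /andP[c1 c2] := clm _ _ xx; have /andP[a1 _] := clab x; have /andP[_ b1] := clab x'.
  rewrite /g (ger0_norm (_ : 0 <= x' - x)) ?subr_ge0 //.
  have /andP[f1 f2] : 0 <= f (cl x') - f (cl x) <= M * (cl x' - cl x) by apply: h => //; rewrite -subr_ge0.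
  by rewrite ger0_norm //; apply: le_trans f2 _; rewrite ler_wpM2l.
have gc : continuous g.
  apply: (@lip_cont _ M) => x x'; have [xx|/ltW xx] := leP x' x; first exact: gl.
  by rewrite distrC [`|x - x'|]distrC; exact: gl.
have cla : cl a = a by rewrite /cl min_r // maxxx.
have clb : cl b = b by rewrite /cl minxx max_r.
have [|c] := @IVT R g a b y ab (continuous_subspaceT gc).
  by rewrite /g cla clb ge_min le_max fb (ltW fa) orbT.
rewrite in_itv /= => /andP[ac cb]; rewrite /g.
have -> : cl c = c by rewrite /cl min_r // max_r.
move=> fc; exists c => //; rewrite cb andbT lt_neqAle ac andbT.
by apply: contraTneq fa => ->; rewrite fc ltxx.
Qed.

Lemma mu_pi (a p Q : R) : p != 0 -> Q != 0 -> 2 * a / (p * Q) * p = 2 * (a / Q).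
Proof. by move=> p0 Q0; field; rewrite p0 Q0. Qed.

Lemma cell_start_mu (a p Q c : R) : p != 0 -> Q != 0 ->
  (- a + 2 * a * c / Q) / p = - (a / p) + 2 * a / (p * Q) * c.
Proof. by move=> p0 Q0; field; rewrite p0 Q0. Qed.

Lemma mu_q (a p Q : R) : p != 0 -> Q != 0 -> 2 * a / (p * Q) * Q = 2 * (a / p).
Proof. by move=> p0 Q0; field; rewrite p0 Q0. Qed.

Lemma sub_budget (l C A B d r : R) : 0 < l -> 1 <= C -> 0 <= A -> 0 <= B -> 0 <= d ->
  (l + C * (A + B)) * d <= r -> A * d <= r /\ B * d <= r.
Proof.
move=> l0 C1 A0 B0 d0 h; have CM : A + B <= C * (A + B) by rewrite ler_peMl // addr_ge0.
by split; apply: le_trans h; rewrite ler_wpM2r //; lra.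
Qed.

Lemma low_combine (l w1 w2 ra rb D xa xb G : R) : w1 * xa + w2 * xb <= G ->
  w1 * (ra * D) <= w1 * xa -> w2 * (rb * D) <= w2 * xb ->
  (l + (w1 * ra + w2 * rb)) * D <= D * l + G.
Proof. lra. Qed.

Lemma up_combine (l C A B D xa xb G : R) : G <= C * (xa + xb) ->
  C * (xa + xb) <= C * (A * D + B * D) -> D * l + G <= (l + C * (A + B)) * D.
Proof. lra. Qed.

Lemma arc_same (x A m c c' q : R) (z z' : int) : A < 1 / 2 -> m * q = 2 * A ->
  0 <= m * c -> 0 <= m * c' -> m * c + m <= m * q -> m * c' + m <= m * q ->
  - A + m * c <= x - z%:~R -> x - z%:~R < - A + m * c + m ->
  - A + m * c' <= x - z'%:~R -> x - z'%:~R < - A + m * c' + m -> z = z'.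
Proof.
move=> A1 mq l1 l2 l3 l4 z1 z2 w1 w2.
by apply/eqP; rewrite eq_le -!ltzD1 -!(ltr_int R) !intrD; apply/andP; split; lra.
Qed.

Lemma arc_same_idx (x A m z : R) (c c' : nat) : 0 < m ->
  - A + m * c%:R <= x - z -> x - z < - A + m * c'%:R + m -> (c <= c')%N.
Proof.
move=> m0 h1 h2; rewrite -ltnS -(ltr_nat R) -[_.+1%:R]natr1 -(ltr_pM2l m0) mulrDr mulr1; lra.
Qed.

Lemma step_le (M k k' d r : R) : 0 <= M -> k' <= k + d -> M * d <= r -> M * (k' - k) <= r.
Proof. by move=> M0 h h2; apply: le_trans h2; rewrite ler_wpM2l //; lra. Qed.

Lemma last_step (r u w z : R) : r <= u - w -> - r <= w - z -> z <= u.
Proof. lra. Qed.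

End Real.

(** * Cells, speeds and hits of the root phase *)

Section Cells.
Variables (R : realType) (V E : finType) (len : E -> R).
Hypothesis lpos : forall e, 0 < len e.
Local Notation pi := (@pi R).
Local Notation btree := (btree V E).
Local Notation ph := (@ph R V E len).
Variables (a0 : R) (q : nat) (W1 W2 : 'I_q -> 'I_q -> R) (C h : R).
Let mu := 2 * a0 / (pi * q%:R).
Hypothesis a00 : 0 < a0 < pi / 2.
Hypothesis q0 : (0 < q)%N.
Hypothesis C1 : 1 <= C.
Hypothesis W0 : forall c1 c2, 0 <= W1 c1 c2 /\ 0 <= W2 c1 c2.
Hypothesis h0 : 0 <= h.
Hypothesis masses : forall s, [/\ h <= mu ^+ 2 * cellsum W1 s, h <= mu ^+ 2 * cellsum W2 s &
  h <= mu ^+ 2 * @cellsum R q (fun _ _ => 1) s].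
Hypothesis local : forall (c1 c2 : 'I_q) x y x' y', cell_good q c1 c2 ->
     `|x - mid a0 q c1| <= 2 * a0 / q%:R -> `|x' - mid a0 q c1| <= 2 * a0 / q%:R ->
     `|y - mid a0 q c2| <= 2 * a0 / q%:R -> `|y' - mid a0 q c2| <= 2 * a0 / q%:R ->
     x <= x' -> y <= y' ->
     W1 c1 c2 * (x' - x) + W2 c1 c2 * (y' - y) <= join_phase x' y' - join_phase x y <=
     C * ((x' - x) + (y' - y)).
Hypothesis signs : forall (c1 c2 : 'I_q) x y, cell_good q c1 c2 ->
     `|x - mid a0 q c1| <= 2 * a0 / q%:R -> `|y - mid a0 q c2| <= 2 * a0 / q%:R ->
     [/\ - (pi / 2) < x < pi / 2, - (pi / 2) < y < pi / 2 &
     [/\ tan x != 0, tan y != 0, tan x + tan y != 0 &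
      (tan x * tan y * (tan x + tan y) < 0) = eps q c1 c2]].

Fixpoint cellT (t : btree) : finType :=
  match t with L _ _ => unit | N _ _ a b => ('I_q * 'I_q * (cellT a * cellT b))%type end.

Fixpoint patternT (t : btree) : finType :=
  match t with L _ _ => unit | N _ _ a b => (bool * (patternT a * patternT b))%type end.

Fixpoint good (t : btree) : cellT t -> bool :=
  match t with
  | L _ _ => fun=> true
  | N _ _ a b => fun c => cell_good q c.1.1 c.1.2 && (good c.2.1 && good c.2.2) end.

Fixpoint pat (t : btree) : cellT t -> patternT t :=
  match t with
  | L _ _ => fun=> tt
  | N _ _ a b => fun c => (eps q c.1.1 c.1.2, (pat c.2.1, pat c.2.2)) end.

(** The chain rule along the branch, with the lower bounds [W1] and [W2] in place of the partial
    derivatives of [join_phase]. *)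
Fixpoint min_speed (t : btree) : cellT t -> R :=
  match t with
  | L e _ => fun=> len e
  | N e _ a b => fun c => len e + (W1 c.1.1 c.1.2 * min_speed c.2.1 + W2 c.1.1 c.1.2 * min_speed c.2.2) end.

Fixpoint max_speed (t : btree) : R :=
  match t with L e _ => len e | N e _ a b => len e + C * (max_speed a + max_speed b) end.

Fixpoint inner_count (t : btree) : nat := match t with L _ _ => 0%N | N _ _ a b => (inner_count a + inner_count b).+1 end.

Fixpoint total_length (t : btree) : R := match t with L e _ => len e | N e _ a b => len e + (total_length a + total_length b) end.

(** The left end of a cell in units of pi. *)
Definition cell_start (c : 'I_q) : R := (- a0 + 2 * a0 * c%:R / q%:R) / pi.

Fixpoint arcs (t : btree) : cellT t -> seq (E * (R * R)) :=
  match t with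
  | L _ _ => fun=> [::]
  | N _ _ a b => fun c => (rt a, (cell_start c.1.1, mu)) :: (rt b, (cell_start c.1.2, mu)) :: arcs c.2.1 ++ arcs c.2.2
  end.

(** Poles and zeros are excluded because at an inner vertex they mean a vanishing value or a
    vanishing derivative of the eigenfunction. *)
Fixpoint has_pattern (t : btree) : patternT t -> R -> Prop :=
  match t with
  | L _ _ => fun _ _ => True
  | N _ _ a b => fun p k =>
    [/\ cos (ph a k) != 0, cos (ph b k) != 0,
     [/\ tan (ph a k) != 0, tan (ph b k) != 0, tan (ph a k) + tan (ph b k) != 0 &
         (tan (ph a k) * tan (ph b k) * (tan (ph a k) + tan (ph b k)) < 0) = p.1],
     has_pattern p.2.1 k & has_pattern p.2.2 k]
  end.

Lemma min_speed_ge0 t (c : cellT t) : 0 <= min_speed c.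
Proof.
elim: t c => [e v|e v a IHa b IHb] /= c; first exact: ltW.
by have [w1 w2] := W0 c.1.1 c.1.2; rewrite addr_ge0 ?(ltW (lpos _)) // addr_ge0 // mulr_ge0.
Qed.

Lemma total_length_ge0 t : 0 <= total_length t.
Proof. by elim: t => [e v|e v a IHa b IHb] /=; rewrite ?addr_ge0 // ltW. Qed.

Lemma max_speed_ge0 t : 0 <= max_speed t.
Proof.
elim: t => [e v|e v a IHa b IHb] /=; first exact: ltW.
by rewrite addr_ge0 ?(ltW (lpos _)) // mulr_ge0 ?addr_ge0 //; exact: le_trans C1.
Qed.

Lemma sum3 (A B D : finType) (pa : pred A) (pb : pred B) (pd : pred D) (f : A -> R) (g : B -> R) (l : D -> R) :
  \sum_(c : A * (B * D) | pa c.1 && (pb c.2.1 && pd c.2.2)) f c.1 * (g c.2.1 * l c.2.2) =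
  (\sum_(x | pa x) f x) * ((\sum_(x | pb x) g x) * (\sum_(x | pd x) l x)).
Proof.
rewrite [X in _ = _ * X]big_distrlr /= pair_big /= big_distrlr /= pair_big /=.
by apply: eq_bigl => -[x [y z]].
Qed.

Lemma cellsum_pair (F : 'I_q -> 'I_q -> R) s :
  cellsum F s = \sum_(c : 'I_q * 'I_q | cell_good q c.1 c.2 && (eps q c.1 c.2 == s)) F c.1 c.2.
Proof. by rewrite /cellsum pair_big_dep. Qed.

Definition cell_mass t (p : patternT t) (F : cellT t -> R) : R :=
  (mu ^+ 2) ^+ inner_count t * \sum_(c | good c && (pat c == p)) F c.

Lemma cell_mass_N e v a b (s : bool) (pa : patternT a) (pb : patternT b) (f : 'I_q -> 'I_q -> R)
  (g : cellT a -> R) (l : cellT b -> R) :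
  @cell_mass (N e v a b) (s, (pa, pb)) (fun c => f c.1.1 c.1.2 * (g c.2.1 * l c.2.2)) =
  mu ^+ 2 * cellsum f s * (cell_mass pa g * cell_mass pb l).
Proof.
rewrite /cell_mass /= cellsum_pair exprS exprD.
rewrite (eq_bigl (fun c : 'I_q * 'I_q * (cellT a * cellT b) => (cell_good q c.1.1 c.1.2 && (eps q c.1.1 c.1.2 == s)) &&
   ((good c.2.1 && (pat c.2.1 == pa)) && (good c.2.2 && (pat c.2.2 == pb))))); last first.
  move=> c; rewrite !xpair_eqE /=.
  by case: (cell_good _ _ _); case: (eps _ _ _ == s); case: (good _); case: (good _); case: (_ == pa).
by rewrite (sum3 (fun c : 'I_q * 'I_q => cell_good q c.1 c.2 && (eps q c.1 c.2 == s)) (fun c : cellT a => good c && (pat c == pa))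
  (fun c : cellT b => good c && (pat c == pb)) (fun c : 'I_q * 'I_q => f c.1 c.2) g l); ring.
Qed.

(** Weighted volumes are products over the inner vertices, each factor at least h. When [min_speed]
    is expanded over the edges, every edge contributes its length times such a product, with [W1] or
    [W2] at the vertices between it and the root. *)
Lemma cell_mass_lower t (p : patternT t) : h ^+ inner_count t <= cell_mass p (fun=> 1) /\ h ^+ inner_count t * total_length t <= cell_mass p (@min_speed t).
Proof.
elim: t p => [e v|e v a IHa b IHb] p.
  rewrite /cell_mass /= expr0 !mul1r.
  by rewrite [X in _ <= X /\ _](big_pred1 tt) ?[X in _ /\ _ <= X](big_pred1 tt) //= => -[]; rewrite eq_sym; case: p.
case: p => s [pa pb]; have [a1 aL] := IHa pa; have [b1 bL] := IHb pb.
have [m1 m2 m3] := masses s.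
have hp n : 0 <= h ^+ n by exact: exprn_ge0.
rewrite /= exprS exprD; split.
  rewrite [cell_mass _ _](_ : _ = @cell_mass (N e v a b) (s, (pa, pb)) (fun c => 1 * (1 * 1))).
    rewrite (cell_mass_N e v s pa pb (fun _ _ => 1) (fun=> 1) (fun=> 1)).
    by apply: ler_pM; rewrite ?mulr_ge0 //; apply: ler_pM.
  by congr (_ * _); apply: eq_bigr => c _; rewrite !mul1r.
have -> : @cell_mass (N e v a b) (s, (pa, pb)) (@min_speed (N e v a b)) =
   len e * @cell_mass (N e v a b) (s, (pa, pb)) (fun c => 1 * (1 * 1)) +
   (@cell_mass (N e v a b) (s, (pa, pb)) (fun c => W1 c.1.1 c.1.2 * (min_speed c.2.1 * 1)) +
    @cell_mass (N e v a b) (s, (pa, pb)) (fun c => W2 c.1.1 c.1.2 * (1 * min_speed c.2.2))).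
  rewrite /cell_mass mulrCA -!mulrDr; congr (_ * _).
  rewrite mulr_sumr -!big_split /=; apply: eq_bigr => c _; ring.
rewrite (cell_mass_N e v s pa pb (fun _ _ => 1) (fun=> 1) (fun=> 1)).
rewrite (cell_mass_N e v s pa pb W1 (@min_speed a) (fun=> 1)) (cell_mass_N e v s pa pb W2 (fun=> 1) (@min_speed b)).
rewrite !mulrDr; apply: lerD; [|apply: lerD].
- rewrite mulrC ler_wpM2l ?(ltW (lpos _)) //.
  by apply: ler_pM; rewrite ?mulr_ge0 //; apply: ler_pM.
- rewrite -mulrA [_ * h ^+ _ * _]mulrAC; apply: ler_pM => //; first by rewrite !mulr_ge0 ?total_length_ge0.
  by apply: ler_pM; rewrite ?mulr_ge0 ?total_length_ge0.
- rewrite -mulrA -mulrA; apply: ler_pM => //; first by rewrite !mulr_ge0 ?total_length_ge0.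
  by apply: ler_pM; rewrite ?mulr_ge0 ?total_length_ge0.
Qed.

Lemma arcs_perm t (c : cellT t) : perm_eq (rt t :: unzip1 (arcs c)) (edges t).
Proof.
elim: t c => [e v|e v a IHa b IHb] c //=; rewrite ?perm_cons.
rewrite /unzip1 map_cat -!/(unzip1 _).
apply: (@perm_trans _ ((rt a :: unzip1 (arcs c.2.1)) ++ (rt b :: unzip1 (arcs c.2.2)))).
  by rewrite /= perm_cons perm_sym perm_catC /= perm_cons perm_catC.
exact: perm_cat.
Qed.

Lemma mu_bd : 0 <= mu <= 1.
Proof.
move/andP: a00 => [a1 a2]; have p0 := pi_gt0 R; have qp : 0 < q%:R :> R by rewrite ltr0n.
rewrite /mu divr_ge0 ?mulr_ge0 ?(ltW a1) ?(ltW p0) //=.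
rewrite ler_pdivrMr ?mulr_gt0 // mul1r; apply: (@le_trans _ _ (pi * 1)); first by rewrite mulr1; lra.
by rewrite ler_pM2l // ler1n.
Qed.

Lemma arcs_snd t (c : cellT t) p : p \in arcs c -> p.2.2 = mu.
Proof.
elim: t c => [e v|e v a IHa b IHb] c //=; rewrite !inE mem_cat.
by case/or4P => [/eqP ->|/eqP ->|/IHa|/IHb].
Qed.

Lemma arcs_prod t (c : cellT t) : \prod_(p <- arcs c) p.2.2 = (mu ^+ 2) ^+ inner_count t.
Proof.
elim: t c => [e v|e v a IHa b IHb] c /=; first by rewrite big_nil.
by rewrite !big_cons big_cat /= IHa IHb [in RHS]exprS exprD; ring.
Qed.

Definition incell (x : R) (c : 'I_q) := exists z : int, `|x + pi * z%:~R - mid a0 q c| <= a0 / q%:R.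

Lemma incell_arc (x : R) c : inarc (cell_start c) mu (x / pi) -> incell x c.
Proof.
have p0 := pi_gt0 R; have qp : 0 < q%:R :> R by rewrite ltr0n.
move/inarcP => []; first by case/andP: mu_bd.
move=> z /andP[z1 z2]; exists (- z).
have e1 : cell_start c * pi = - a0 + 2 * a0 * c%:R / q%:R by rewrite /cell_start divfK // gt_eqF.
have e2 : mu * pi = 2 * (a0 / q%:R) by apply: mu_pi; rewrite gt_eqF.
have e3 : x / pi * pi = x by rewrite divfK // gt_eqF.
have m1 : mid a0 q c = - a0 + 2 * a0 * c%:R / q%:R + a0 / q%:R.
  by rewrite /mid natr_mid; field; rewrite gt_eqF.
have y1 : cell_start c * pi <= (x / pi - z%:~R) * pi by rewrite ler_pM2r.
have y2 : (x / pi - z%:~R) * pi < (cell_start c + mu) * pi by rewrite ltr_pM2r.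
rewrite mulrBl e3 e1 in y1; rewrite mulrBl mulrDl e3 e1 e2 in y2.
rewrite ler_norml m1 rmorphN /= mulrN; apply/andP; split; move: y1 y2; rewrite [pi * _]mulrC; lra.
Qed.

Lemma arc_disj (x : R) (c c' : 'I_q) : inarc (cell_start c) mu x -> inarc (cell_start c') mu x -> c = c'.
Proof.
have p0 := pi_gt0 R; have qp : 0 < q%:R :> R by rewrite ltr0n.
have [/andP[a1 a2] /andP[mu0 mu1]] := (a00, mu_bd).
move/inarcP => /(_ mu1) [z /andP[z1 z2]] /inarcP => /(_ mu1) [z' /andP[w1 w2]].
have csE d : cell_start d = - (a0 / pi) + mu * d%:R.
  by apply: cell_start_mu; rewrite gt_eqF.
have mp : 0 < mu by rewrite divr_gt0 ?mulr_gt0.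
have mq : mu * q%:R = 2 * (a0 / pi) by apply: mu_q; rewrite gt_eqF.
have ap : a0 / pi < 1 / 2 by rewrite ltr_pdivrMr //; lra.
have hi (d : 'I_q) : mu * d%:R + mu <= mu * q%:R.
  by rewrite -[X in _ + X]mulr1 -mulrDr ler_pM2l // natr1 ler_nat.
have lo (d : 'I_q) : 0 <= mu * d%:R by rewrite mulr_ge0.
rewrite !csE in z1 z2 w1 w2.
have zz := arc_same ap mq (lo c) (lo c') (hi c) (hi c') z1 z2 w1 w2.
rewrite -zz in w1 w2.
by apply/val_inj/eqP; rewrite eqn_leq (arc_same_idx mp z1 w2) (arc_same_idx mp w1 z2).
Qed.

Lemma in_arcs_disj x t (c c' : cellT t) j : in_arcs x (arcs c) j -> in_arcs x (arcs c') j -> c = c'.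
Proof.
elim: t c c' => [e v|e v a IHa b IHb]; first by do 2!case.
move=> [[c1 c2] [ca cb]] [[d1 d2] [da db]]; rewrite /in_arcs /= !all_cat.
move=> /and4P[h1 h2 h3 h4] /and4P[g1 g2 g3 g4].
by rewrite (arc_disj h1 g1) (arc_disj h2 g2) (IHa _ _ h3 g3) (IHb _ _ h4 g4).
Qed.

Fixpoint cellk (t : btree) : cellT t -> R -> Prop :=
  match t with
  | L _ _ => fun _ _ => True
  | N _ _ a b => fun c k =>
     [/\ incell (ph a k) c.1.1, incell (ph b k) c.1.2, cellk c.2.1 k & cellk c.2.2 k]
  end.

Lemma join_phase_shift (x y : R) (z w : int) : join_phase (x + pi * z%:~R) (y + pi * w%:~R) = join_phase x y.
Proof. by rewrite /join_phase !tan_shift. Qed.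

Lemma cos_nz (x : R) (z : int) : - (pi / 2) < x + pi * z%:~R < pi / 2 -> cos x != 0.
Proof.
have [s [ss _ hc]] := @pi_shift R z => hx.
have := cos_gt0_pihalf hx; rewrite hc; case: eqP => // ->.
by rewrite mulr0 ltxx.
Qed.

(** The phases of the child branches start within a0 / q of a midpoint and move by at most a0 / q,
    so they stay where the local estimates hold. As C is at least 1, the bound on [max_speed t * d]
    passes to both children. *)
Lemma movement t (c : cellT t) k d : cellk c k -> good c -> max_speed t * d <= a0 / q%:R ->
  forall k1 k2, k <= k1 -> k1 <= k2 -> k2 <= k + d ->
  min_speed c * (k2 - k1) <= ph t k2 - ph t k1 <= max_speed t * (k2 - k1).
Proof.
elim: t c => [e v|e v a IHa b IHb] c /=.
  by move=> _ _ _ k1 k2 _ _ _; rewrite -mulrBl mulrC lexx.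
move=> [[z hz] [w hw] ka kb] /and3P[g ga gb] Md k1 k2 kk1 kk2 kk3.
have Ma := max_speed_ge0 a; have Mb := max_speed_ge0 b; have le := lpos e.
have d0 : 0 <= d by rewrite -(lerDl k); apply: le_trans kk1 (le_trans kk2 kk3).
have [Mad Mbd] := sub_budget le C1 Ma Mb d0 Md.
have na := IHa c.2.1 ka ga Mad; have nb := IHb c.2.2 kb gb Mbd.
have near (f : R -> R) (M m : R) (rr : R) (zz : int) : 0 <= rr -> 0 <= M -> M * d <= a0 / q%:R ->
   (forall k1 k2, k <= k1 -> k1 <= k2 -> k2 <= k + d -> rr * (k2 - k1) <= f k2 - f k1 <= M * (k2 - k1)) ->
   `|f k + pi * zz%:~R - m| <= a0 / q%:R -> forall k', k <= k' -> k' <= k + d ->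
   `|f k' + pi * zz%:~R - m| <= 2 * a0 / q%:R.
  move=> rr0 M0 hM hf hm k' kk' kk''; have /andP[f1 f2] := hf k k' (lexx _) kk' kk''.
  have f3 : 0 <= f k' - f k by apply: le_trans f1; rewrite mulr_ge0 // subr_ge0.
  have f4 : f k' - f k <= a0 / q%:R.
    exact: le_trans f2 (step_le M0 kk'' hM).
  have -> : f k' + pi * zz%:~R - m = (f k + pi * zz%:~R - m) + (f k' - f k) by ring.
  apply: le_trans (ler_normD _ _) _; rewrite (ger0_norm f3).
  by rewrite -mulrA [2 * _]mulr_natl mulr2n lerD.
have hna := near (ph a) _ _ _ z (min_speed_ge0 c.2.1) Ma Mad na hz.
have hnb := near (ph b) _ _ _ w (min_speed_ge0 c.2.2) Mb Mbd nb hw.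
have kk12 : k <= k2 := le_trans kk1 kk2.
have kk13 : k1 <= k + d := le_trans kk2 kk3.
have /andP[a1 a2] := na _ _ kk1 kk2 kk3; have /andP[b1 b2] := nb _ _ kk1 kk2 kk3.
have k21 : 0 <= k2 - k1 by rewrite subr_ge0.
have xa : ph a k1 + pi * z%:~R <= ph a k2 + pi * z%:~R.
  by rewrite lerD2r -subr_ge0; apply: le_trans a1; rewrite mulr_ge0 // min_speed_ge0.
have xb : ph b k1 + pi * w%:~R <= ph b k2 + pi * w%:~R.
  by rewrite lerD2r -subr_ge0; apply: le_trans b1; rewrite mulr_ge0 // min_speed_ge0.
have := local g (hna _ kk1 kk13) (hna _ kk12 kk3) (hnb _ kk1 kk13) (hnb _ kk12 kk3) xa xb.
rewrite !join_phase_shift.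
have -> : ph a k2 + pi * z%:~R - (ph a k1 + pi * z%:~R) = ph a k2 - ph a k1 by ring.
have -> : ph b k2 + pi * w%:~R - (ph b k1 + pi * w%:~R) = ph b k2 - ph b k1 by ring.
move=> /andP[l1 l2].
have [w1 w2] := W0 c.1.1 c.1.2.
have l3 := ler_wpM2l w1 a1; have l4 := ler_wpM2l w2 b1.
have C0 : 0 <= C by apply: le_trans C1.
have l5 := ler_wpM2l C0 (lerD a2 b2).
have -> : k2 * len e + join_phase (ph a k2) (ph b k2) - (k1 * len e + join_phase (ph a k1) (ph b k1)) =
   (k2 - k1) * len e + (join_phase (ph a k2) (ph b k2) - join_phase (ph a k1) (ph b k1)) by ring.
by apply/andP; split; [exact: low_combine l1 l3 l4|exact: up_combine l2 l5].
Qed.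

Lemma hit_pat t (c : cellT t) k d k' : cellk c k -> good c -> max_speed t * d <= a0 / q%:R ->
  k <= k' -> k' <= k + d -> has_pattern (pat c) k'.
Proof.
elim: t c => [e v|e v a IHa b IHb] c //=.
move=> [[z hz] [w hw] ka kb] /and3P[g ga gb] Md kk1 kk2.
have Ma := max_speed_ge0 a; have Mb := max_speed_ge0 b; have le := lpos e.
have d0 : 0 <= d by rewrite -(lerDl k); apply: le_trans kk1 kk2.
have [Mad Mbd] := sub_budget le C1 Ma Mb d0 Md.
have near (f : R -> R) (M m : R) (zz : int) : 0 <= M -> M * d <= a0 / q%:R ->
   0 <= f k' - f k <= M * (k' - k) ->
   `|f k + pi * zz%:~R - m| <= a0 / q%:R -> `|f k' + pi * zz%:~R - m| <= 2 * a0 / q%:R.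
  move=> M0 hM /andP[f3 f2] hm.
  have f4 : f k' - f k <= a0 / q%:R.
    exact: le_trans f2 (step_le M0 kk2 hM).
  have -> : f k' + pi * zz%:~R - m = (f k + pi * zz%:~R - m) + (f k' - f k) by ring.
  apply: le_trans (ler_normD _ _) _; rewrite (ger0_norm f3).
  by rewrite -mulrA [2 * _]mulr_natl mulr2n lerD.
have pos u (cu : cellT u) : cellk cu k -> good cu -> max_speed u * d <= a0 / q%:R -> 0 <= ph u k' - ph u k <= max_speed u * (k' - k).
  move=> h1 h2 h3; have /andP[f1 ->] := movement h1 h2 h3 (lexx k) kk1 kk2.
  by rewrite andbT; apply: le_trans f1; rewrite mulr_ge0 ?min_speed_ge0 // subr_ge0.
have ha := near _ _ _ z Ma Mad (pos _ _ ka ga Mad) hz.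
have hb := near _ _ _ w Mb Mbd (pos _ _ kb gb Mbd) hw.
have [s1 s2] := signs g ha hb; rewrite !tan_shift => s3.
split => //; [exact: cos_nz s1|exact: cos_nz s2|exact: IHa|exact: IHb].
Qed.

Lemma in_arcs_cellk t (c : cellT t) x j k : consist len t x j k -> in_arcs x (arcs c) j -> cellk c k.
Proof.
elim: t c => [e v|e v a IHa b IHb] c //= [_ ka kb]; rewrite /in_arcs /= all_cat.
move=> /and4P[]; rewrite (consist_rt ka) (consist_rt kb) => h1 h2 h3 h4.
by split; [exact: incell_arc|exact: incell_arc|exact: IHa|exact: IHb].
Qed.

(** The intervals are half-open, so that different j have different k. *)
Definition hit t (p : patternT t) (d : R) (j : nat) := exists k,
  [/\ j%:R * d < k, k <= j%:R * d + d, sin (ph t k) = 0 & has_pattern p k].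

(** The arc of the root edge puts the phase below a multiple of pi by no more than it is sure to
    travel during the step; the intermediate value theorem gives the crossing. *)
Lemma cell_hit t (c : cellT t) x d j : 0 < d -> min_speed c * d / pi <= 1 -> max_speed t * d <= a0 / q%:R -> good c ->
  consist len t x j (j%:R * d) ->
  in_arcs x ((rt t, (- (min_speed c * d / pi), min_speed c * d / pi)) :: arcs c) j -> hit (pat c) d j.
Proof.
move=> d0 R1 Md gc cx; rewrite /in_arcs /= => /andP[/inarcP hr /(in_arcs_cellk cx) ck].
have p0 := pi_gt0 R; have [z] := hr R1; rewrite (consist_rt cx) addNr => /andP[z1 z2].
have mv := movement ck gc Md; set k := j%:R * d in mv z1 z2 ck *.
have kd : k <= k + d by rewrite lerDl ltW.
have /andP[m1 _] := mv k (k + d) (lexx _) kd (lexx _).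
have e3 : ph t k / pi * pi = ph t k by rewrite divfK // gt_eqF.
have e4 : min_speed c * d / pi * pi = min_speed c * d by rewrite divfK // gt_eqF.
have y1 : - (min_speed c * d / pi) * pi <= (ph t k / pi - z%:~R) * pi by rewrite ler_pM2r.
have y2 : (ph t k / pi - z%:~R) * pi < 0 * pi by rewrite ltr_pM2r.
rewrite mulNr mulrBl e3 e4 in y1; rewrite mulrBl e3 mul0r subr_lt0 in y2.
have y3 : z%:~R * pi <= ph t (k + d).
  have kdk : k + d - k = d by rewrite addrC addKr.
  rewrite kdk in m1; exact: last_step m1 y1.
have lip k1 k2 : k <= k1 -> k1 <= k2 -> k2 <= k + d -> 0 <= ph t k2 - ph t k1 <= max_speed t * (k2 - k1).
  move=> h1 h2 h3; have /andP[f1 ->] := mv k1 k2 h1 h2 h3; rewrite andbT.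
  by apply: le_trans f1; rewrite mulr_ge0 ?min_speed_ge0 // subr_ge0.
have yy : ph t k < z%:~R * pi <= ph t (k + d) by rewrite y2.
have [k' /andP[k1 k2] fk] := ivt_lip (max_speed_ge0 t) kd lip yy.
exists k'; split=> //; last by apply: hit_pat ck gc Md (ltW k1) k2.
have [s [_ hs _]] := @pi_shift R z.
by rewrite fk -[_ * pi]add0r [_ * pi]mulrC hs sin0 mulr0.
Qed.

Lemma hit_freq_h t : uniq (edges t) -> exists2 d0 : R, 0 < d0 & forall d, 0 < d -> d < d0 ->
  nonresonant (fun e => d * len e / pi) -> forall p : patternT t,
  lower_mean (fun j => (`[< hit p d j >])%:R) (d / pi * (h ^+ inner_count t * total_length t)).
Proof.
move=> ut; have p0 := pi_gt0 R; have qp : 0 < q%:R :> R by rewrite ltr0n.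
have M0 := max_speed_ge0 t; pose RS := \sum_(c : cellT t) min_speed c.
have RS0 : 0 <= RS by apply: sumr_ge0 => c _; apply: min_speed_ge0.
have RSc (c : cellT t) : min_speed c <= RS by rewrite /RS (bigD1 c) //= lerDl; apply: sumr_ge0 => c' _; apply: min_speed_ge0.
have M1 : 0 < max_speed t + 1 by rewrite ltr_wpDl.
have R1 : 0 < RS + 1 by rewrite ltr_wpDl.
have aq : 0 < a0 / q%:R by rewrite divr_gt0 //; case/andP: a00.
exists (Num.min (a0 / q%:R / (max_speed t + 1)) (pi / (RS + 1))).
  by rewrite lt_min; apply/andP; split; apply: divr_gt0.
move=> d d0; rewrite lt_min (ltr_pdivlMr _ _ M1) (ltr_pdivlMr _ _ R1) => /andP[hM hR] nr p.
have Md : max_speed t * d <= a0 / q%:R.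
  by apply: le_trans (ltW hM); rewrite mulrC ler_wpM2l ?(ltW d0) // lerDl.
have Rd (c : cellT t) : min_speed c * d / pi <= 1.
  rewrite ler_pdivrMr // mul1r; apply: le_trans (ltW hR).
  rewrite mulrC ler_wpM2l ?(ltW d0) //; apply: le_trans (RSc c) _; by rewrite lerDl.
pose x := shear_phases t (fun e j => j%:R * (d * len e / pi)).
have JX : equidist x by apply: shear_phases_equidist ut _; apply: weyl.
have cx j : consist len t x j (j%:R * d).
  by apply: shear_phases_consist => // e _; ring.
(* One box per cell: the side for the root edge is as long as the speed on that cell guarantees. *)
pose A (c : cellT t) := (rt t, (- (min_speed c * d / pi), min_speed c * d / pi)) :: arcs c.
have fA c : lower_mean (fun j => (in_arcs x (A c) j)%:R) (\prod_(p <- A c) p.2.2).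
  apply: equidist_list => //; first by move: ut; rewrite -(perm_uniq (arcs_perm c)).
  move=> pp; rewrite inE => /orP[/eqP ->|/arcs_snd ->]; last exact: mu_bd.
  by rewrite Rd andbT divr_ge0 ?(ltW p0) // mulr_ge0 ?min_speed_ge0 // ltW.
have fS := @lower_mean_sum R (cellT t) (index_enum _) (fun c => good c && (pat c == p)) _ _ (fun c _ => fA c).
apply: lower_mean_le fS => [j|].
  (* The boxes of different cells are disjoint, so at most one summand is nonzero. *)
  have [[c /andP[/andP[gc /eqP pc] ec]]|no] := pselect (exists c : cellT t, good c && (pat c == p) && in_arcs x (A c) j).
    rewrite (bigD1 c) ?gc ?pc ?eqxx //= big1 => [|c' /andP[_ cc]].
      move: (ec); rewrite /in_arcs /= => ->; rewrite addr0; case: asboolP => //; case; rewrite -pc.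
      by apply: cell_hit (cx j) ec.
    have [ec'|] := boolP (in_arcs x (A c') j); last by rewrite /in_arcs /= => /negbTE ->.
    case/eqP: cc.
    by move: ec ec'; rewrite /in_arcs /= => /andP[_ e1] /andP[_ e2]; apply: in_arcs_disj e2 e1.
  rewrite big1 ?ler0n // => c hc; case: (boolP (in_arcs x (A c) j)) => // ec.
  by case: no; exists c; rewrite hc ec.
have [_ low] := cell_mass_lower p.
apply: (@le_trans _ _ (d / pi * cell_mass p (@min_speed t))).
  by rewrite ler_wpM2l // divr_ge0 ?(ltW d0) ?(ltW p0).
rewrite /cell_mass !mulr_sumr; apply: ler_sum => c _.
rewrite /A big_cons arcs_prod /= le_eqVlt; apply/orP; left; apply/eqP; ring.
Qed.

End Cells.

Lemma hit_freq (R : realType) (V E : finType) (len : E -> R) (eta : R) (t : btree V E) :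
  (forall e, 0 < len e) -> 0 < eta < 1 -> uniq (edges t) ->
  exists2 d0 : R, 0 < d0 & forall d, 0 < d -> d < d0 ->
  nonresonant (fun e => d * len e / pi) -> forall p : patternT t,
  lower_mean (fun j => (`[< hit len p d j >])%:R) (d / pi * (((1 - eta) / 2) ^+ inner_count t * total_length len t)).
Proof.
move=> lpos eta01 ut.
have [a [q [W1 [W2 [C [[a01 q0 C0 W0] [masses [local signs]]]]]]]] := grid eta01.
have h0 : 0 <= (1 - eta) / 2 by case/andP: eta01 => e0 e1; rewrite divr_ge0 // subr_ge0 ltW.
(* [grid] gives a nonnegative constant, while the estimates on cells take one that is at least 1. *)
apply: (@hit_freq_h R V E len lpos a q W1 W2 (C + 1) ((1 - eta) / 2)) => //.
- by rewrite lerDr.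
- move=> c1 c2 x y x' y' g h1 h2 h3 h4 xx yy.
  have /andP[l1 l2] := local c1 c2 x y x' y' g h1 h2 h3 h4 xx yy; rewrite l1 /=.
  apply: (le_trans l2); rewrite ler_wpM2r ?lerDl // addr_ge0 // subr_ge0 //.
Qed.

(** * Rooting the tree *)

Section Rooting.
Variables (R : realType) (V E : finType) (src tgt : E -> V).
Hypothesis conn : connected_graph src tgt.
Hypothesis tree : (#|E|.+1 = #|V|)%N.
Hypothesis cubic : forall v, deg src tgt v = 1%N \/ deg src tgt v = 3%N.
Local Notation btree := (btree V E).

Definition joins (e : E) (x y : V) : bool :=
  ((src e == x) && (tgt e == y)) || ((src e == y) && (tgt e == x)).

Definition touches (e : E) (v : V) : bool := (src e == v) || (tgt e == v).

Lemma joinsC e x y : joins e x y = joins e y x.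
Proof. by rewrite /joins orbC. Qed.

Lemma joins_src e x y : joins e x y -> touches e x.
Proof. by rewrite /joins /touches => /orP[] /andP[/eqP -> /eqP ->]; rewrite eqxx ?orbT. Qed.

Lemma joins_touches e x y v : joins e x y -> touches e v -> v = x \/ v = y.
Proof.
by rewrite /joins /touches => /orP[] /andP[/eqP -> /eqP ->] /orP[] /eqP ->; (by left) || by right.
Qed.

Lemma touches_joins e v : touches e v -> exists w, joins e v w.
Proof.
by rewrite /touches /joins => /orP[] /eqP <-; [exists (tgt e)|exists (src e)]; rewrite !eqxx ?orbT.
Qed.

Definition adjx (e : E) : rel V := fun x y => [exists e', (e' != e) && joins e' x y].

(** The connected component of v after e has been removed. *)
Definition side (e : E) (v : V) : {set V} := [set w | connect (adjx e) v w]%SET.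

Lemma connect_closed (T : finType) (r : rel T) (Pr : T -> Prop) x : Pr x ->
  (forall y z, Pr y -> r y z -> Pr z) -> forall y, connect r x y -> Pr y.
Proof.
move=> + h y /connectP[p + ->]; elim: p x => //= z p IH x Px /andP[xz pz].
by apply: IH pz; apply: h Px xz.
Qed.

(* In algebraic terms: every edge of a tree is a bridge. *)
Lemma potential e : exists u : V -> R, u (src e) != u (tgt e) /\
  forall e', e' != e -> u (src e') = u (tgt e').
Proof.
pose g (s : V) (t : option {e' : E | e' != e}) : R :=
  if t is Some e' then (s == src (val e'))%:R - (s == tgt (val e'))%:R else (s == src e)%:R.
have [|u [[s us] hu]] := @dependent R V (option {e' : E | e' != e}) g.
  rewrite card_option card_sig -tree ltnS.
  rewrite [X in (X < _)%N](_ : _ = #|predC1 e|); last by apply: eq_card.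
  by rewrite cardC1; have : (0 < #|E|)%N by [apply/card_gt0P; exists e]; lia.
have ev w : \sum_s u s * (s == w)%:R = u w.
  by rewrite (bigD1 w) //= eqxx mulr1 big1 ?addr0 // => s' /negbTE ->; rewrite mulr0.
have ue e' : e' != e -> u (src e') = u (tgt e').
  move=> ee; have := hu (Some (exist _ e' ee)); rewrite /g /=.
  under eq_bigr do rewrite mulrBr.
  by rewrite sumrB !ev => /eqP; rewrite subr_eq0 => /eqP.
exists u; split=> //; apply/negP => /eqP E0; case/eqP: us.
rewrite -(hu None) /g ev; apply: (connected_const (u := u) conn) => e'.
by have [->|/ue] := eqVneq e' e.
Qed.

Lemma no_loop e : src e != tgt e.
Proof. by have [u [+ _]] := potential e; apply: contraNneq => ->. Qed.

Lemma joins_neq e x y (T : eqType) (u : V -> T) : u (src e) != u (tgt e) -> joins e x y -> u x != u y.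
Proof. by move=> ne /orP[] /andP[/eqP <- /eqP <-] //; rewrite eq_sym. Qed.

Lemma joins_eq e x y (T : eqType) (u : V -> T) : u (src e) = u (tgt e) -> joins e x y -> u x = u y.
Proof. by move=> ne /orP[] /andP[/eqP <- /eqP <-]. Qed.

Lemma side_self e v : v \in side e v.
Proof. by rewrite inE connect0. Qed.

Lemma side_notin e v w : joins e v w -> v \notin side e w.
Proof.
move=> jo; have [u [ne ue]] := potential e; apply/negP; rewrite inE => h.
have := joins_neq ne jo; suff -> : u v = u w by rewrite eqxx.
move: v h {jo}; apply: connect_closed => // y z <- /existsP[e' /andP[ee jo]].
by apply/esym/(joins_eq _ jo); apply: ue.
Qed.

Lemma side_step e w y z e' : e' != e -> joins e' y z -> y \in side e w -> z \in side e w.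
Proof.
move=> ee jo; rewrite !inE => h; apply: connect_trans h _; apply: connect1.
by apply/existsP; exists e'; rewrite ee.
Qed.

Lemma side_sub e e1 v w : e1 != e -> touches e v -> joins e1 v w -> {subset side e1 w <= side e v}.
Proof.
move=> ne te jo x; have vn := side_notin jo.
rewrite [x \in side e1 w]inE; move: x.
suff h : forall x, connect (adjx e1) w x -> x \in side e1 w /\ x \in side e v by move=> x /h[].
apply: connect_closed.
  by split; [exact: side_self|apply: side_step ne jo (side_self _ _)].
move=> y z [y1 y2] /existsP[e' /andP[ee jo']].
have z1 : z \in side e1 w := side_step ee jo' y1.
split=> //; apply: (side_step _ jo' y2); apply: contraNneq vn => E0.
by rewrite -E0 in te; case: (joins_touches jo' te) => ->.
Qed.

(** The potential that jumps across e1 alone is constant on each of the two sides; on the second it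
    has its value at v, on the first a different one. *)
Lemma side_disj e1 e2 v w1 w2 : e1 != e2 -> joins e1 v w1 -> joins e2 v w2 ->
  forall x, x \in side e1 w1 -> x \in side e2 w2 -> False.
Proof.
move=> ne j1 j2 x h1 h2; have [u [n1 ue]] := potential e1.
have v2 := side_notin j2.
have c1 : forall x, connect (adjx e1) w1 x -> u x = u w1.
  apply: connect_closed => // y z <- /existsP[e' /andP[ee jo]].
  by apply/esym/(joins_eq _ jo); apply: ue.
have c2 : forall x, connect (adjx e2) w2 x -> x \in side e2 w2 /\ u x = u w2.
  apply: connect_closed; first by rewrite side_self.
  move=> y z [y1 <-] /existsP[e' /andP[ee jo]].
  have z1 : z \in side e2 w2 := side_step ee jo y1.
  split=> //; apply/esym/(joins_eq _ jo); apply: ue; apply: contraNneq v2 => E0.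
  by have := joins_src j1; rewrite -E0 => /(joins_touches jo)[] ->.
move: h1 h2; rewrite !inE => /c1 e1x /c2 [_ e2x].
have := joins_neq n1 j1; rewrite -e1x e2x; rewrite eq_sym in ne.
by rewrite (joins_eq (ue _ ne) j2) eqxx.
Qed.

Lemma deg_touches v : deg src tgt v = #|[set e | touches e v]%SET|.
Proof.
rewrite /deg -cardsUI [X in (_ + X)%N](_ : _ = 0%N) ?addn0.
  by apply: eq_card => e; rewrite !inE.
apply/eqP; rewrite cards_eq0; apply/eqP/setP => e; rewrite !inE.
by apply/negP => /andP[/eqP h1 /eqP h2]; have := no_loop e; rewrite h1 h2 eqxx.
Qed.

Fixpoint verts (t : btree) : seq V :=
  match t with L _ v => [:: v] | N _ v a b => v :: verts a ++ verts b end.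

(** Listing all the edges at v turns Kirchhoff's condition there into a condition on these edges
    alone. *)
Fixpoint well_rooted (t : btree) (u : V) : Prop :=
  match t with
  | L e v => [/\ joins e u v, deg src tgt v = 1%N & forall e', touches e' v -> e' = e]
  | N e v a b => [/\ joins e u v, deg src tgt v = 3%N,
      forall e', touches e' v -> e' \in [:: e; rt a; rt b], well_rooted a v & well_rooted b v]
  end.

Lemma build n e u v : (#|side e v| < n)%N -> joins e u v -> exists t,
  [/\ well_rooted t u, rt t = e, uniq (edges t) & uniq (verts t)] /\
  [/\ {subset verts t <= side e v} &
  forall e', e' \in edges t -> e' = e \/ (src e' \in side e v /\ tgt e' \in side e v)].
Proof.
elim: n e u v => // n IH e u v; rewrite ltnS => hn jo.
have te : touches e v by move: jo; rewrite joinsC; exact: joins_src.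
have := cubic v; rewrite deg_touches => -[] hd.
  move/eqP/cards1P : (hd) => [e' Ee].
  have only e'' : touches e'' v -> e'' = e.
    have h x : touches x v = (x == e') by have := congr1 (fun A : {set E} => x \in A) Ee; rewrite !inE.
    by move: te; rewrite !h => /eqP -> /eqP ->.
  exists (L e v); split; split=> //=; first by split=> //; rewrite deg_touches hd.
    by move=> x; rewrite inE => /eqP ->; rewrite side_self.
  by move=> x; rewrite inE => /eqP; left.
have : #|[set e | touches e v] :\ e|%SET == 2 by move: hd; rewrite (cardsD1 e) inE te add1n => /eqP; rewrite eqSS.
move=> /cards2P [e1 [e2 [e12 Ee]]].
have in12 x : (x \in [set e1; e2]%SET) = (x != e) && touches x v by rewrite -Ee !inE.
have /andP[n1 t1] : (e1 != e) && touches e1 v by rewrite -in12 !inE eqxx.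
have /andP[n2 t2] : (e2 != e) && touches e2 v by rewrite -in12 !inE eqxx orbT.
have [w1 j1] := touches_joins t1; have [w2 j2] := touches_joins t2.
have s1 := side_sub n1 te j1; have s2 := side_sub n2 te j2.
have v1 := side_notin j1; have v2 := side_notin j2.
have lt1 : (#|side e1 w1| < #|side e v|)%N.
  by apply/proper_card/properP; split; [exact/fintype.subsetP|exists v; rewrite // side_self].
have lt2 : (#|side e2 w2| < #|side e v|)%N.
  by apply/proper_card/properP; split; [exact/fintype.subsetP|exists v; rewrite // side_self].
have [a [[wa ra ua va] [sa ea]]] := IH _ _ _ (leq_trans lt1 hn) j1.
have [b [[wb rb ub vb] [sb eb]]] := IH _ _ _ (leq_trans lt2 hn) j2.
have nv f w x : joins f v w -> v \notin side f w -> touches x v ->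
   src x \in side f w /\ tgt x \in side f w -> False.
  by move=> _ vn tx [h1 h2]; move: vn; case/orP: tx => /eqP <-; rewrite ?h1 ?h2.
have dj := side_disj e12 j1 j2.
exists (N e v a b); split; split=> //=.
- split=> //; first by rewrite deg_touches hd.
  move=> e' te'; rewrite ra rb !inE; case: eqVneq => //= ne.
  by have := in12 e'; rewrite ne te' !inE.
- rewrite mem_cat negb_or cat_uniq ua ub /= andbT; apply/andP; split; first (apply/andP; split).
  + by apply/negP => /ea[h|]; [rewrite h eqxx in n1|exact: nv j1 v1 te].
  + by apply/negP => /eb[h|]; [rewrite h eqxx in n2|exact: nv j2 v2 te].
  + apply/hasPn => x /eb hb; apply/negP => /ea ha.
    case: ha hb => [->|ha] [h|hb].
    * by rewrite h eqxx in e12.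
    * exact: nv j2 v2 t1 hb.
    * by rewrite h in ha; exact: nv j1 v1 t2 ha.
    * by apply: (dj (src x)); [case: ha|case: hb].
- rewrite mem_cat negb_or cat_uniq va vb /= andbT; apply/andP; split; first (apply/andP; split).
  + by apply: contra v1; apply: sa.
  + by apply: contra v2; apply: sb.
  + by apply/hasPn => x /sb hb; apply/negP => /sa ha; exact: dj ha hb.
- move=> x; rewrite inE mem_cat => /or3P[/eqP ->|/sa/s1//|/sb/s2//]; exact: side_self.
- have end1 f w x : joins f v w -> f != e -> {subset side f w <= side e v} ->
      x = f \/ (src x \in side f w /\ tgt x \in side f w) -> src x \in side e v /\ tgt x \in side e v.
    move=> jf nf sf [->|[/sf h1 /sf h2]] //.
    have vv := side_self e v; have ww := side_step nf jf vv.
    by move: jf => /orP[] /andP[/eqP -> /eqP ->].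
  move=> x; rewrite inE mem_cat => /or3P[/eqP ->|/ea h|/eb h]; first by left.
    by right; apply: end1 h.
  by right; apply: end1 h.
Qed.

Lemma well_rooted_touch t u x e : well_rooted t u -> x \in verts t -> touches e x -> e \in edges t.
Proof.
elim: t u => [e0 v|e0 v a IHa b IHb] u /=; first by move=> [_ _ h]; rewrite !inE => /eqP -> /h ->.
move=> [_ _ h wa wb]; rewrite !inE !mem_cat => /or3P[/eqP ->|xa|xb] te.
- by have := h e te; rewrite !inE => /or3P[/eqP ->|/eqP ->|/eqP ->]; rewrite ?eqxx ?rt_edges ?orbT.
- by rewrite (IHa v) ?orbT.
- by rewrite (IHb v) ?orbT.
Qed.

Lemma well_rooted_ends t u e x : well_rooted t u -> e \in edges t -> touches e x -> x \in u :: verts t.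
Proof.
elim: t u => [e0 v|e0 v a IHa b IHb] u /=.
  by move=> [jo _ _]; rewrite !inE => /eqP -> /(joins_touches jo)[] ->; rewrite eqxx ?orbT.
move=> [jo _ _ wa wb]; rewrite inE mem_cat => /or3P[/eqP ->|ea|eb] te.
- by case: (joins_touches jo te) => ->; rewrite !inE eqxx ?orbT.
- have := IHa v wa ea te; rewrite !inE mem_cat => /orP[] ->; rewrite ?orbT //.
- have := IHb v wb eb te; rewrite !inE mem_cat => /orP[] ->; rewrite ?orbT //.
Qed.

Lemma sum_deg : (\sum_v deg src tgt v = 2 * #|E|)%N.
Proof.
have h (f : E -> V) : (\sum_v #|[set e | f e == v]%SET| = #|E|)%N.
  rewrite -sum1_card (partition_big f xpredT) //=; apply: eq_bigr => v _.
  by rewrite -sum1_card; apply: eq_bigl => e; rewrite inE.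
by rewrite /deg big_split /= !h mul2n addnn.
Qed.

Lemma sum_deg_bdry : (\sum_v deg src tgt v + 2 * #|bdry src tgt| = 3 * #|V|)%N.
Proof.
have -> : #|bdry src tgt| = (\sum_v (v \in bdry src tgt))%N.
  by rewrite -sum1_card big_mkcond /=; apply: eq_bigr => v _; case: (v \in _).
transitivity (\sum_v (deg src tgt v + 2 * (v \in bdry src tgt)))%N.
  by rewrite [RHS]big_split; congr addn; rewrite big_distrr.
by rewrite mulnC -sum_nat_const; apply: eq_bigr => v _; rewrite inE; case: (cubic v) => ->.
Qed.

Lemma size_edges (t : btree) : size (edges t) = (2 * inner_count t).+1.
Proof. by elim: t => //= e v a IHa b IHb; rewrite size_cat IHa IHb; lia. Qed.

Lemma rooted : exists t r, [/\ well_rooted t r, uniq (edges t), uniq (r :: verts t),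
   (forall e, e \in edges t) & (forall v, v \in r :: verts t)] /\
   [/\ deg src tgt r = 1%N, (forall e, touches e r -> e = rt t) & #|bdry src tgt| = (inner_count t + 2)%N].
Proof.
have d1 := sum_deg; have d2 := sum_deg_bdry.
(* Together with |E| + 1 = |V| the two degree counts give 2 |bdry| = |V| + 2. *)
have /card_gt0P[r] : (0 < #|bdry src tgt|)%N by lia.
rewrite inE => /eqP dr; move: (dr); rewrite deg_touches => /eqP/cards1P[e0 Ee].
have only e : touches e r -> e = e0.
  by move=> h; have := congr1 (fun A : {set E} => e \in A) Ee; rewrite !inE h => /esym/eqP.
have t0 : touches e0 r by have := congr1 (fun A : {set E} => e0 \in A) Ee; rewrite !inE eqxx.
have [v jo] := touches_joins t0.
have [t [[wt rt0 ut vt] [st et]]] := build (leqnn _) jo.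
have rn : r \notin verts t by apply: contra (side_notin jo); apply: st.
have allv x : x \in r :: verts t.
  move: x (conn r x); apply: connect_closed; first by rewrite inE eqxx.
  move=> y z; rewrite inE => hy /existsP[e je].
  have ty : touches e y := joins_src je.
  have tz : touches e z by apply: (@joins_src e z y); rewrite joinsC.
  have ee : e \in edges t.
    case/orP: hy => [/eqP yr|yt]; last exact: well_rooted_touch wt yt ty.
    by rewrite (only e) -?yr // -rt0 rt_edges.
  exact: well_rooted_ends wt ee tz.
have alle e : e \in edges t.
  have := allv (src e); rewrite inE => /orP[/eqP sr|sv].
    have := allv (tgt e); rewrite inE => /orP[/eqP tr|tv].
      by have := no_loop e; rewrite sr tr eqxx.
    by apply: well_rooted_touch wt tv _; rewrite /touches eqxx orbT.
  by apply: well_rooted_touch wt sv _; rewrite /touches eqxx.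
exists t, r; split; split=> //; first by rewrite /= rn.
  by move=> e /only ->.
have : #|E| = (2 * inner_count t).+1.
  rewrite -size_edges -(card_uniqP ut); apply: eq_card => e; rewrite inE; exact/esym/alle.
lia.
Qed.

End Rooting.

(** * From phases to eigenfunctions *)

Section Wave.
Variable R : realType.
Local Notation pi := (@pi R).

Definition wave (k c B x : R) := c * cos (k * x - B).

Lemma waveE k c B : wave k c B = trigf k (c * cos B) (c * sin B).
Proof. by apply/funext => x; rewrite /wave /trigf cosB; ring. Qed.

Lemma derive1_wave k c B x : derive1 (wave k c B) x = - (k * c * sin (k * x - B)).
Proof. by rewrite waveE derive1_trigf /trigf' sinB; ring. Qed.

Lemma floor_eq (x : R) (n : int) : n%:~R <= x < n%:~R + 1 -> Num.floor x = n.
Proof. by move=> h; apply: floor_def; rewrite intrD. Qed.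

Lemma mod_pi (x : R) : cos x != 0 -> exists n : int, - (pi / 2) < x - pi * n%:~R < pi / 2.
Proof.
move=> cx; have p0 := pi_gt0 R; pose n := Num.floor (x / pi + 1 / 2).
have /andP[n1 n2] : n%:~R <= x / pi + 1 / 2 < (n + 1)%:~R by exact: floor_itv.
have e1 : x / pi * pi = x by rewrite divfK // gt_eqF.
have m1 : n%:~R * pi <= (x / pi + 1 / 2) * pi by rewrite ler_pM2r.
have m2 : (x / pi + 1 / 2) * pi < (n + 1)%:~R * pi by rewrite ltr_pM2r.
rewrite mulrDl e1 in m1 m2; rewrite intrD in m2.
exists n; rewrite lt_neqAle; apply/andP; split; last by move: m2; lra.
apply/andP; split; last by move: m1; lra.
apply: contraNneq cx => h; have -> : x = - (pi / 2) + pi * n%:~R by rewrite h; ring.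
by have [s [_ _ hc]] := @pi_shift R n; rewrite hc cosN cos_pihalf mulr0.
Qed.

(** The points solve k y + ps = pi z with ps < pi z < ph. The test is weak at [ps] and strict at
    [ph]: at a leaf [ps] is 0 and at the root [ph] lies in pi Z, and these end points do not
    count. *)
Lemma edge_points (k l ps ph : R) : 0 < k -> 0 < l -> - (pi / 2) < ps < pi / 2 ->
  ph = k * l + ps -> forall n : int, - (pi / 2) < ph - pi * n%:~R < pi / 2 ->
  exists s : seq R, [/\ uniq s, (forall y, (y \in s) <-> (0 < y < l /\ sin (k * y + ps) = 0)) &
   (size s)%:Z = n + ((0 < tan ph)%R : nat)%:Z - ((0 <= tan ps)%R : nat)%:Z].
Proof.
move=> k0 l0 psb phE n nb; have p0 := pi_gt0 R.
have kl : 0 < k * l by rewrite mulr_gt0.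
have tph : (0 < tan ph) = (0 < ph - pi * n%:~R).
  by rewrite -(tan_gt0E nb) -(tan_shift n (ph - _)) subrK.
have tps : (0 <= tan ps) = (0 <= ps) by rewrite !leNgt (tan_lt0E psb).
rewrite tph tps; case/andP: psb => ps1 ps2; case/andP: nb => n1 n2.
have zle (a b : int) : a%:~R * pi < b%:~R * pi + pi -> a <= b.
  move=> h; rewrite -ltzD1 -(ltr_int R) intrD -(ltr_pM2r p0) mulrDl mul1r; exact: h.
pose rp := (0 < ph - pi * n%:~R); pose sp := (0 <= ps).
pose z0 : int := (sp : nat)%:Z; pose z1 : int := n - 1 + (rp : nat)%:Z.
have low z : ps < pi * z%:~R -> z0 <= z.
  rewrite /z0 /sp => h; have [s0|s0] := leP 0 ps; apply: zle; rewrite ?mul1r ?mul0r; last by lra.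
  have : 0 < z%:~R * pi by rewrite mulrC; apply: le_lt_trans h.
  rewrite pmulr_lgt0 // ltr0z => z1'; have : 1 <= z%:~R * pi / pi.
    by rewrite mulfK ?gt_eqF // ler1z.
  rewrite ler_pdivlMr // mul1r; lra.
have low' z : z0 <= z -> ps < pi * z%:~R.
  rewrite /z0 /sp -(ler_int R) -(ler_pM2l p0); have [s0|s0] := leP 0 ps => /=; rewrite ?mulr1 ?mulr0; lra.
have up z : pi * z%:~R < ph -> z <= z1.
  rewrite /z1 /rp => h; have [s0|s0] := ltP 0 (ph - _); apply: zle; rewrite !intrD mulrNz /=; lra.
have up' z : z <= z1 -> pi * z%:~R < ph.
  rewrite /z1 /rp -(ler_int R) -(ler_pM2l p0) !intrD mulrNz; have [s0|s0] := ltP 0 (ph - _) => /=; lra.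
have z01 : z0 <= z1 + 1.
  have [//|h] := leP z0 (z1 + 1).
  have a1 : ~~ (z0 <= z1 + 1) by rewrite -ltNge.
  have : ps < pi * (z1 + 1)%:~R.
    apply: lt_le_trans (_ : ph <= _); first by rewrite phE; lra.
    rewrite leNgt; apply/negP => /up; rewrite -ltzD1 ltxx //.
  by move=> /low; rewrite (negbTE a1).
pose m := absz (z1 + 1 - z0)%R.
have mE : m%:Z = z1 + 1 - z0 by rewrite /m abszE ger0_norm // subr_ge0.
exists [seq (pi * (z0 + i%:Z)%:~R - ps) / k | i <- iota 0 m]; split.
- rewrite map_inj_uniq ?iota_uniq // => i j /(congr1 (fun x => x * k)).
  rewrite !divfK ?gt_eqF // => /addIr /(mulfI (lt0r_neq0 p0)) /intr_inj /addrI; by case.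
- move=> y; split.
    move=> /mapP[i]; rewrite mem_iota add0n => /andP[_ im] ->.
    have i1 : z0 <= z0 + i%:Z by rewrite lerDl.
    have i2 : z0 + i%:Z <= z1 by rewrite -ltzD1 -ltrBrDl -mE ltz_nat.
    split; last first.
      rewrite mulrCA divff ?gt_eqF // mulr1 subrK -[pi * _]add0r.
      by have [s [_ hs _]] := @pi_shift R (z0 + i%:Z); rewrite hs sin0 mulr0.
    apply/andP; split; first by rewrite divr_gt0 // subr_gt0; apply: low'.
    by rewrite ltr_pdivrMr // ltrBlDr [l * k]mulrC -phE; apply: up'.
  move=> [/andP[y1 y2] hs].
  have [|z hz] := @sin_pi_eq0 R ((k * y + ps) / pi); first by rewrite mulrCA divff ?gt_eqF // mulr1.
  have kz : k * y + ps = pi * z%:~R by rewrite -hz mulrCA divff ?gt_eqF // mulr1.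
  have a1 : z0 <= z by apply: low; rewrite -kz ltrDr mulr_gt0.
  have a2 : z <= z1 by apply: up; rewrite -kz phE ltrD2r ltr_pM2l.
  apply/mapP; exists (absz (z - z0)%R).
    by rewrite mem_iota add0n /= -ltz_nat mE abszE ger0_norm ?subr_ge0 // ltrD2r ltzD1.
  have -> : z0 + (absz (z - z0)%R)%:Z = z by rewrite abszE ger0_norm ?subr_ge0 // [z0 + _]addrC subrK.
  rewrite -kz addrK mulrAC divff ?mul1r //.
  by rewrite gt_eqF.
- rewrite size_map size_iota mE /z1 /z0 /rp /sp; ring.
Qed.

(** The last bracket is the excess of the critical points over the zeros counted by the floors. B is
    [ph] or [- ps] according to whether x starts at the near or at the far end. *)
Lemma edge_count (k l ps ph c B : R) : 0 < k -> 0 < l -> - (pi / 2) < ps < pi / 2 ->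
  ph = k * l + ps -> cos ph != 0 -> c != 0 -> B = ph \/ B = - ps ->
  exists s : seq R, [/\ uniq s,
    (forall x, (x \in s) <-> (0 < x < l /\ derive1 (wave k c B) x = 0)) &
   (size s)%:Z = Num.floor ((k * l - B) / pi + 1 / 2) - Num.floor ((k * 0 - B) / pi + 1 / 2) +
      (((0 < tan ph)%R : nat)%:Z - ((0 <= tan ps)%R : nat)%:Z)].
Proof.
move=> k0 l0 psb phE cph c0 hB; have p0 := pi_gt0 R; have [n nb] := mod_pi cph.
have [s [us ms ss]] := edge_points k0 l0 psb phE nb.
have dw B' x : (derive1 (wave k c B') x = 0) <-> (sin (k * x - B') = 0).
  rewrite derive1_wave; split => [/eqP|->]; last by rewrite mulr0 oppr0.
  by rewrite oppr_eq0 !mulf_eq0 (gt_eqF k0) (negbTE c0) => /eqP.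
have fl (x : R) (z : int) : pi * z%:~R <= x + pi / 2 -> x + pi / 2 < pi * z%:~R + pi ->
    Num.floor (x / pi + 1 / 2) = z.
  move=> h1 h2; apply: floor_eq; rewrite -(ler_pM2r p0) -(ltr_pM2r p0) mulrDl divfK ?gt_eqF //.
  rewrite [(_ + 1) * pi]mulrDl; apply/andP; split; [move: h1|move: h2]; lra.
case/andP: (psb) => ps1 ps2; case/andP: (nb) => n1 n2.
case: hB => ->; last first.
  exists s; split=> //.
    by move=> x; rewrite dw opprK; exact: ms.
  have f1 : Num.floor (ph / pi + 1 / 2) = n by apply: fl; move: n1 n2; clear; lra.
  have f2 : Num.floor (ps / pi + 1 / 2) = 0 by apply: fl; rewrite mulr0; move: ps1 ps2; clear; lra.
  by rewrite ss opprK -phE mulr0 add0r f1 f2 subr0 addrA.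
exists [seq l - y | y <- s]; split.
- by rewrite map_inj_uniq // => x y /addrI /oppr_inj.
- move=> x; rewrite dw; have sE : sin (k * x - ph) = - sin (k * (l - x) + ps).
    by rewrite -sinN; congr sin; rewrite phE; ring.
  have -> : (x \in [seq l - y | y <- s]) = (l - x \in s).
    have inj : injective (fun y : R => l - y) by move=> u v /addrI /oppr_inj.
    by rewrite -[RHS](mem_map inj) /= subKr.
  rewrite ms sE; split=> -[/andP[h1 h2] h3]; split; try (apply/andP; split; lra).
    by rewrite h3 oppr0.
  by apply/eqP; rewrite -oppr_eq0 h3.
- have f1 : Num.floor (- ph / pi + 1 / 2) = - n.
    by apply: fl; rewrite mulrNz; move: n1 n2; clear; lra.
  have f2 : Num.floor ((k * l - ph) / pi + 1 / 2) = 0.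
    by apply: fl; rewrite phE mulr0; move: ps1 ps2; clear; lra.
  by rewrite size_map ss mulr0 add0r f1 f2 sub0r opprK addrA.
Qed.

End Wave.

(** * The solution on the tree built from its phases *)

Section Lift.
Variables (R : realType) (V E : finType) (src tgt : E -> V) (len : E -> R).
Hypothesis lpos : forall e, 0 < len e.
Hypothesis noloop : forall e, src e != tgt e.
Local Notation pi := (@pi R).
Local Notation btree := (btree V E).
Variable k : R.
Hypothesis k0 : 0 < k.
Local Notation ph t := (ph len t k).

Definition psi (t : btree) : R := match t with L _ _ => 0 | N _ _ a b => join_phase (ph a) (ph b) end.

Definition far (t : btree) : V := match t with L _ v => v | N _ v _ _ => v end.

Lemma ph_psi t : ph t = k * len (rt t) + psi t.
Proof. by case: t => //= e v; rewrite addr0. Qed.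

Lemma psi_bd t : - (pi / 2) < psi t < pi / 2.
Proof.
case: t => [e v|e v a b] /=; first exact: zero_itv.
by rewrite /join_phase atan_gtNpi2 atan_ltpi2.
Qed.

(* amplitude, phase shift and Neumann surplus of the solution on the first edge *)
Definition piece (t : btree) (c : R) : R * R * int :=
  (c, if tgt (rt t) == far t then ph t else - psi t,
   ((0 < tan (ph t))%R : nat)%:Z - ((0 <= tan (psi t))%R : nat)%:Z).

(** Continuity at the far vertex of t, where the value is c cos (psi t), fixes the amplitude on the
    branch s. *)
Definition child (c : R) (t s : btree) : R := c * cos (psi t) / cos (ph s).

Fixpoint sol (t : btree) (c : R) : E -> R * R * int :=
  match t with
  | L _ _ => fun=> piece t c
  | N e _ a b => fun e' =>
     if e' == e then piece t c else
     if e' \in edges a then sol a (child c t a) e' else sol b (child c t b) e'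
  end.

Fixpoint vertex_val (t : btree) (c : R) : V -> R :=
  match t with
  | L _ _ => fun=> c * cos (psi t)
  | N _ v a b => fun x =>
     if x == v then c * cos (psi t) else
     if x \in verts a then vertex_val a (child c t a) x else vertex_val b (child c t b) x
  end.

Fixpoint nb (t : btree) : patternT t -> nat :=
  match t with L _ _ => fun=> 0%N | N _ _ a b => fun p => (p.1 + (nb p.2.1 + nb p.2.2))%N end.

Lemma sol_rt t c : sol t c (rt t) = piece t c.
Proof. by case: t => //= e v a b; rewrite eqxx. Qed.

(** The share of e in the Kirchhoff sum at v, written so that the orientation of e need not be
    known. *)
Definition out (S : E -> R * R * int) (e : E) (v : V) : R :=
  (src e == v)%:R * derive1 (wave k (S e).1.1 (S e).1.2) 0 -
  (tgt e == v)%:R * derive1 (wave k (S e).1.1 (S e).1.2) (len e).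

Lemma ends t u c S : joins src tgt (rt t) u (far t) -> S (rt t) = piece t c ->
  [/\ out S (rt t) u = k * c * sin (ph t), out S (rt t) (far t) = - (k * c * sin (psi t)) &
   let w := wave k (S (rt t)).1.1 (S (rt t)).1.2 in
   forall G : V -> R, G u = c * cos (ph t) -> G (far t) = c * cos (psi t) ->
     w 0 = G (src (rt t)) /\ w (len (rt t)) = G (tgt (rt t))].
Proof.
move=> jo SE; rewrite /out SE /piece /=; set e := rt t in jo *.
have nl := noloop e; have nl' : (tgt e == src e) = false by rewrite eq_sym; apply/negbTE.
rewrite !derive1_wave /wave; have pE := ph_psi t; rewrite -/e in pE.
case/orP: jo => /andP[/eqP <- /eqP <-].
  rewrite !eqxx (negbTE nl) nl' mul1r !mul0r mulr0 sub0r !subr0 mul1r.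
  have -> : k * len e - ph t = - psi t by rewrite pE; ring.
  by rewrite !sinN !cosN; split; [ring|ring|move=> G -> ->].
rewrite !eqxx (negbTE nl) nl' mul1r !mul0r mulr0 sub0r mul1r !opprK subr0 add0r -pE.
by split=> // G -> ->.
Qed.

Definition Good (S : E -> R * R * int) (e : E) := exists s : seq R, [/\ uniq s,
    (forall x, (x \in s) <-> (0 < x < len e /\ derive1 (wave k (S e).1.1 (S e).1.2) x = 0)) &
   (size s)%:Z = Num.floor ((k * len e - (S e).1.2) / pi + 1 / 2) -
                 Num.floor ((k * 0 - (S e).1.2) / pi + 1 / 2) + (S e).2].

Lemma good_rt t c S : c != 0 -> cos (ph t) != 0 -> S (rt t) = piece t c -> Good S (rt t).
Proof.
move=> c0 cp SE; rewrite /Good SE /piece /=; apply: edge_count => //; first exact: psi_bd.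
  exact: ph_psi.
by case: ifP; [left|right].
Qed.

Lemma cos_psi t : cos (psi t) != 0.
Proof. by rewrite gt_eqF // cos_gt0_pihalf // psi_bd. Qed.

Lemma joins_far t u : well_rooted src tgt t u -> joins src tgt (rt t) u (far t).
Proof. by case: t => [e v|e v a b] []. Qed.

Lemma out_notouch S e v : ~~ touches src tgt e v -> out S e v = 0.
Proof. by rewrite /touches negb_or /out => /andP[/negbTE -> /negbTE ->]; rewrite !mul0r subrr. Qed.

(** Up to a factor, Kirchhoff's condition at an inner vertex says that tan (psi t) is the sum of the
    tangents of the children. In the total surplus each leaf beyond contributes - 1, and at an inner
    vertex the three indicators combine to 1 minus the bit of the pattern; there is one such leaf
    more than inner vertices. *)
Lemma sol_ok t u c (p : patternT t) S G : well_rooted src tgt t u -> uniq (edges t) -> uniq (verts t) ->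
  has_pattern len p k -> c != 0 -> cos (ph t) != 0 ->
  (forall e, e \in edges t -> S e = sol t c e) -> (forall v, v \in verts t -> G v = vertex_val t c v) ->
  G u = c * cos (ph t) ->
  [/\ forall e, e \in edges t ->
        wave k (S e).1.1 (S e).1.2 0 = G (src e) /\ wave k (S e).1.1 (S e).1.2 (len e) = G (tgt e),
      forall v, v \in verts t -> \sum_e out S e v = 0 /\ G v != 0,
      forall v e, v \in verts t -> deg src tgt v != 1%N -> touches src tgt e v -> out S e v != 0,
      forall e, e \in edges t -> Good S e &
      \sum_(e <- edges t) (S e).2 = ((0 < tan (ph t))%R : nat)%:Z - 1 - (nb p)%:Z].
Proof.
elim: t u c p => [e v|e v a IHa b IHb] u c p.
  move=> wt _ _ _ c0 cp hS hG Gu; have jo := joins_far wt; case: wt => _ d1 only.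
  have SE : S e = piece (L e v) c by rewrite hS // inE.
  have [q1 q2 we] := ends jo SE.
  have Gv : G v = c * cos (psi (L e v)) by rewrite hG // inE.
  split.
  - by move=> e'; rewrite inE => /eqP ->; apply: (we G).
  - move=> v'; rewrite inE => /eqP ->; rewrite Gv mulf_neq0 ?cos_psi //; split=> //.
    rewrite (bigD1 e) //= big1 ?addr0 => [|e' ne].
      by move: q2 => /= ->; rewrite sin0 mulr0 oppr0.
    by apply: out_notouch; apply: contraNN ne => /only ->.
  - by move=> v' e'; rewrite inE => /eqP ->; rewrite d1.
  - by move=> e'; rewrite inE => /eqP ->; apply: good_rt SE.
  - by rewrite big_seq1 SE /= tan0 lexx subr0.
move=> wt /= /andP[ne]; rewrite cat_uniq => /and3P[ua /hasPn ab ub].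
move=> /andP[nv]; rewrite cat_uniq => /and3P[va /hasPn vab vb].
move: ne nv; rewrite !mem_cat !negb_or => /andP[na nb'] /andP[nva nvb].
move=> [ca cb [ta tb tab pp] ga gb] c0 cp hS hG Gu.
have jo := joins_far wt; case: (wt) => _ d3 only wa wb.
have ja := joins_far wa; have jb := joins_far wb.
set t := N e v a b in wt jo cp hS hG Gu *.
have SE : S e = piece t c by rewrite hS ?inE ?eqxx //= eqxx.
have Sa e' : e' \in edges a -> S e' = sol a (child c t a) e'.
  move=> he; rewrite hS ?inE ?mem_cat ?he ?orbT //= ifN //.
  by apply: contraTneq he => ->.
have Sb e' : e' \in edges b -> S e' = sol b (child c t b) e'.
  move=> he; rewrite hS ?inE ?mem_cat ?he ?orbT //= ifN ?ifN //; first exact: ab.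
  by apply: contraTneq he => ->.
have Ga v' : v' \in verts a -> G v' = vertex_val a (child c t a) v'.
  move=> he; rewrite hG ?inE ?mem_cat ?he ?orbT //= ifN //.
  by apply: contraTneq he => ->.
have Gb v' : v' \in verts b -> G v' = vertex_val b (child c t b) v'.
  move=> he; rewrite hG ?inE ?mem_cat ?he ?orbT //= ifN ?ifN //; first exact: vab.
  by apply: contraTneq he => ->.
have Gv : G v = c * cos (psi t) by rewrite hG ?inE ?eqxx //= eqxx.
have a0 : child c t a != 0 by rewrite !mulf_neq0 ?invr_neq0 ?cos_psi.
have b0 : child c t b != 0 by rewrite !mulf_neq0 ?invr_neq0 ?cos_psi.
have chE s : cos (ph s) != 0 -> child c t s * cos (ph s) = c * cos (psi t).
  by move=> cell_start; rewrite /child divfK.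
have Gva : G v = child c t a * cos (ph a) by rewrite chE.
have Gvb : G v = child c t b * cos (ph b) by rewrite chE.
have [a1 a2 a3 a4 a5] := IHa v _ p.2.1 wa ua va ga a0 ca Sa Ga Gva.
have [b1 b2 b3 b4 b5] := IHb v _ p.2.2 wb ub vb gb b0 cb Sb Gb Gvb.
have SrA : S (rt a) = piece a (child c t a) by rewrite Sa ?rt_edges // sol_rt.
have SrB : S (rt b) = piece b (child c t b) by rewrite Sb ?rt_edges // sol_rt.
have [q1 q2 we] := ends jo SE.
have [qa _ _] := ends ja SrA; have [qb _ _] := ends jb SrB.
have tanpsi : tan (psi t) = tan (ph a) + tan (ph b) by rewrite /= /join_phase atanK.
have sc s : cos (ph s) != 0 -> k * child c t s * sin (ph s) = k * (c * cos (psi t)) * tan (ph s).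
  by move=> cell_start; rewrite -(chE s cell_start) /tan; field.
rewrite sc // in qa; rewrite sc // in qb.
have q2' : out S e v = - (k * (c * cos (psi t)) * tan (psi t)).
  have E1 : cos (psi t) * tan (psi t) = sin (psi t) by rewrite /tan mulrC divfK // cos_psi.
  by rewrite -[out S e v]/(out S (rt t) (far t)) q2 -E1 !mulrA.
have ea : rt a != e by apply: contraNneq na => <-; apply: rt_edges.
have eb : rt b != e by apply: contraNneq nb' => <-; apply: rt_edges.
have eab : rt b != rt a by apply: contraTneq (rt_edges a) => <-; apply: ab; apply: rt_edges.
have kc : k * (c * cos (psi t)) != 0 by rewrite mulf_neq0 ?(gt_eqF k0) // mulf_neq0 ?cos_psi.
have cp0 := cos_psi t.
split.
- move=> e'; rewrite inE mem_cat => /or3P[/eqP ->|/a1//|/b1//].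
  exact: (we G).
- move=> v'; rewrite inE mem_cat => /or3P[/eqP ->|/a2//|/b2//].
  split; last by rewrite Gv mulf_neq0.
  rewrite (bigD1 e) //= (bigD1 (rt a)) //= (bigD1 (rt b)) /=; last by rewrite eb eab.
  rewrite big1 ?addr0 => [|e' /andP[/andP[n1 n2] n3]].
    by rewrite qa qb q2' tanpsi; ring.
  apply: out_notouch; apply/negP => /only; rewrite !inE.
  by rewrite (negbTE n1) (negbTE n2) (negbTE n3).
- move=> v' e'; rewrite inE mem_cat => /or3P[/eqP ->|/a3//|/b3//]; last 2 first.
    exact.
    exact.
  move=> _ /only; rewrite !inE => /or3P[/eqP ->|/eqP ->|/eqP ->].
  + by rewrite q2' oppr_eq0 mulf_neq0 // tanpsi.
  + by rewrite qa mulf_neq0.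
  + by rewrite qb mulf_neq0.
- move=> e'; rewrite inE mem_cat => /or3P[/eqP ->|/a4//|/b4//].
  exact: good_rt SE.
- rewrite big_cons big_cat /= a5 b5 SE /piece /= -/(psi t) tanpsi -pp.
  move: ta tb tab; move: (tan (ph a)) (tan (ph b)) => X Y X0 Y0 XY.
  rewrite mul3_lt0 // !PoszD.
  have -> : (0 <= X + Y) = ~~ (X + Y < 0) by rewrite leNgt.
  have gt (x : R) : x != 0 -> (0 < x) = ~~ (x < 0) by move=> x0; rewrite -leNgt le0r (negbTE x0).
  rewrite (gt X) // (gt Y) //.
  have xy : X < 0 -> Y < 0 -> X + Y < 0 by move=> h1 h2; have := ltrD h1 h2; rewrite addr0.
  have xy' : ~~ (X < 0) -> ~~ (Y < 0) -> ~~ (X + Y < 0) by rewrite -!leNgt; exact: addr_ge0.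
  move: xy xy'; case: (X < 0); case: (Y < 0); case: (X + Y < 0) => //= h1 h2; try ring.
  + by have := h1 isT isT.
  + by have := h2 isT isT.
Qed.

End Lift.

(** * From hits of the root phase to generic eigenfunctions *)

Section HitEigen.
Variables (R : realType) (V E : finType) (src tgt : E -> V) (len : E -> R).
Hypothesis lpos : forall e, 0 < len e.
Hypothesis conn : connected_graph src tgt.
Hypothesis tree : (#|E|.+1 = #|V|)%N.
Hypothesis cubic : forall v, deg src tgt v = 1%N \/ deg src tgt v = 3%N.
Local Notation pi := (@pi R).
Variables (t : btree V E) (r : V).
Hypothesis wt : well_rooted src tgt t r.
Hypothesis ut : uniq (edges t).
Hypothesis uv : uniq (r :: verts t).
Hypothesis alle : forall e, e \in edges t.
Hypothesis allv : forall v, v \in r :: verts t.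
Hypothesis degr : deg src tgt r = 1%N.
Hypothesis onlyr : forall e, touches src tgt e r -> e = rt t.

Lemma edges_sum (T : nmodType) (F : E -> T) : \sum_e F e = \sum_(e <- edges t) F e.
Proof.
apply: perm_big; apply: uniq_perm => //; first exact: index_enum_uniq.
by move=> e; rewrite mem_index_enum alle.
Qed.

Lemma total_length_sum (s : btree V E) : total_length len s = \sum_(e <- edges s) len e.
Proof.
by elim: s => [e v|e v a IHa b IHb] /=; rewrite ?big_seq1 // big_cons big_cat IHa IHb.
Qed.

Lemma out_sum k (S : E -> R * R * int) v : \sum_e out src tgt len k S e v =
  \sum_(e | src e == v) derive1 (wave k (S e).1.1 (S e).1.2) 0 -
  \sum_(e | tgt e == v) derive1 (wave k (S e).1.1 (S e).1.2) (len e).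
Proof.
rewrite /out sumrB; congr (_ - _); rewrite [RHS]big_mkcond; apply: eq_bigr => e _.
  by case: (src e == v); rewrite ?mul1r ?mul0r.
by case: (tgt e == v); rewrite ?mul1r ?mul0r.
Qed.

(** At the root the vanishing sine is Kirchhoff's condition for a leaf and forces a nonzero value
    there. The bound on n replaces differences of floors by k len / pi, losing at most 1 per
    edge. *)
Lemma hit_eigen k (p : patternT t) : 0 < k -> has_pattern len p k -> sin (ph len t k) = 0 ->
  exists n, [/\ omega_is src tgt len n (- 1 - (nb p)%:Z), count_below src tgt len (k ^+ 2) n,
    simple_eig src tgt len (k ^+ 2) & n%:R <= k * total_length len t / pi + #|E|%:R].
Proof.
move=> k0 gp s0.
have nl e : src e != tgt e by apply: (no_loop R conn tree).
have inc v : exists e, src e = v \/ tgt e = v.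
  have : (0 < deg src tgt v)%N by case: (cubic v) => ->.
  rewrite /deg addn_gt0 => /orP[] /card_gt0P[e]; rewrite inE => /eqP h; exists e; [by left|by right].
have cp : cos (ph len t k) != 0.
  by apply/eqP => h; have := cos2Dsin2 (ph len t k); rewrite h s0 !expr0n addr0 => /esym/eqP; rewrite oner_eq0.
have [rn vt] : r \notin verts t /\ uniq (verts t) by move: uv => /andP[].
pose S := sol tgt len k t 1; pose G v := if v == r then 1 * cos (ph len t k) else vertex_val len k t 1 v.
have GV v : v \in verts t -> G v = vertex_val len k t 1 v.
  by move=> h; rewrite /G ifN //; apply: contraNneq rn => <-.
have Gr : G r = 1 * cos (ph len t k) by rewrite /G eqxx.
have [c1 c2 c3 c4 c5] := @sol_ok R V E src tgt len lpos nl k k0 t r 1 p S G wt ut vt gp (oner_neq0 R) cp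
   (fun e _ => erefl) GV Gr.
pose A e := (S e).1.1; pose B e := (S e).1.2.
pose f e x := A e * cos (k * x - B e).
have fw e : f e = wave k (A e) (B e) by [].
have Gnz v : G v != 0.
  have := allv v; rewrite inE => /orP[/eqP ->|/c2[]//]; by rewrite Gr mul1r.
have fG e : f e 0 = G (src e) /\ f e (len e) = G (tgt e) by apply: c1.
have fnz e : f e 0 != 0 /\ f e (len e) != 0 by have [-> ->] := fG e.
have outr : out src tgt len k S (rt t) r = 0.
  have [-> _ _] := ends nl (joins_far wt) (sol_rt tgt len k t 1 : S (rt t) = _).
  by rewrite s0 mulr0.
have kir v : \sum_e out src tgt len k S e v = 0.
  have := allv v; rewrite inE => /orP[/eqP ->|/c2[]//].
  rewrite (bigD1 (rt t)) //= outr add0r big1 // => e ne.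
  by apply: out_notouch; apply: contraNN ne => /onlyr ->.
have fe : is_eigsol src tgt len (k ^+ 2) f.
  split; last split.
  - by move=> e x; rewrite fw waveE; exact: trigf_ode.
  - by exists G.
  - by move=> v; rewrite -[RHS](kir v) out_sum.
have [si [n cb nE]] := eigen_index lpos conn tree inc k0 fe fnz (inhabits (rt t)).
have gen : generic_eig src tgt len n f.
  exists (k ^+ 2); split=> //; split=> //; split=> //; split=> //.
  have key v e : v \notin bdry src tgt -> touches src tgt e v -> out src tgt len k S e v != 0.
    rewrite inE => dv te; apply: c3 te => //.
    have := allv v; rewrite inE => /orP[/eqP vr|//]; by rewrite vr degr in dv.
  split=> e /(key _ e).
    rewrite /touches eqxx => /(_ isT); rewrite /out eqxx [tgt e == _]eq_sym (negbTE (nl e)) mul1r mul0r subr0.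
    by rewrite fw.
  rewrite /touches eqxx orbT => /(_ isT); rewrite /out eqxx (negbTE (nl e)) mul1r mul0r sub0r.
  by rewrite oppr_eq0 fw.
have /boolp.choice[s hs] : forall e, Good len k S e by move=> e; apply: c4.
pose s' := [seq (e, x) | e <- enum E, x <- s e].
exists n; split=> //.
  exists f, (size s'); split=> //; split.
    exists s'; split; last split=> //.
      apply: allpairs_uniq_dep; first exact: enum_uniq.
        by move=> e _; case: (hs e).
      by move=> [e x] [e' x'] _ _ /= [<- <-].
    move=> [e x] /=; have [_ hx _] := hs e; rewrite -hx; split.
      by move=> /allpairsPdep[e' [x' [_ h [-> ->]]]].
    by move=> h; apply/allpairsPdep; exists e, x; rewrite mem_enum.
  have -> : (size s')%:Z = \sum_e (size (s e))%:Z.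
    rewrite size_allpairs_dep sumnE big_map (big_morph Posz PoszD (erefl _)) -big_enum //.
  have -> : \sum_e (size (s e))%:Z = n%:Z + \sum_e (S e).2.
    by rewrite nE -big_split /=; apply: eq_bigr => e _; have [_ _ ->] := hs e.
  have t0 : tan (ph len t k) = 0 by rewrite /tan s0 mul0r.
  by rewrite edges_sum c5 t0 ltxx addrAC subrr !add0r.
rewrite (_ : n%:R = (n%:Z)%:~R) // nE rmorph_sum /=.
rewrite total_length_sum -edges_sum -sum1_card natr_sum mulr_sumr mulr_suml -big_split /=.
apply: ler_sum => e _; rewrite rmorphB /=.
have h1 := Num.Theory.ge_floor (turns k B e (len e)); have h2 := floorD1_gt (turns k B e 0).
have h3 : turns k B e (len e) - turns k B e 0 = k * len e / pi by rewrite /turns; ring.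
move: h2; rewrite intrD => h2; rewrite -h3.
move: h1 h2; move: (turns k B e (len e)) (turns k B e 0) => x y.
by move: (Num.floor x) (Num.floor y) => a b h1 h2; lra.
Qed.

End HitEigen.

(** * Densities *)

Section Uniqueness.
Variables (R : realType) (V E : finType) (src tgt : E -> V) (len : E -> R).
Hypothesis lpos : forall e, 0 < len e.

Lemma count_below_lt lam lam' n n' : count_below src tgt len lam n -> simple_eig src tgt len lam ->
  count_below src tgt len lam' n' -> lam < lam' -> (n < n')%N.
Proof.
move=> [h1 _] [[F [hF iF]] _] [_ h2] ll; rewrite ltnNge; apply/negP => nn'; apply: h2.
have hF' j : is_eigsol src tgt len lam (F j) by have [mu [<-]] := hF j.
apply: (indep_eig_sub _ (indep_eig_glue lpos ll h1 hF' iF)).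
by rewrite addn1.
Qed.

Lemma count_below_inj lam lam' n : count_below src tgt len lam n -> simple_eig src tgt len lam ->
  count_below src tgt len lam' n -> simple_eig src tgt len lam' -> lam = lam'.
Proof.
move=> c s c' s'; have [h|h|//] := ltgtP lam lam'.
  by have := count_below_lt c s c' h; rewrite ltnn.
by have := count_below_lt c' s' c h; rewrite ltnn.
Qed.

(** The label determines the eigenvalue, simplicity makes the two eigenfunctions proportional on the
    edges, and proportional functions have the same critical points. *)
Lemma omega_unique n j j' : omega_is src tgt len n j -> omega_is src tgt len n j' -> j = j'.
Proof.
move=> [f [k [[lam [si [cb [ef [fn _]]]]] [[s [us [ss ms]]] <-]]]].
move=> [f' [k' [[lam' [si' [cb' [ef' [fn' _]]]]] [[s' [us' [ss' ms']]] <-]]]].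
have ll := count_below_inj cb si cb' si'; rewrite -ll in ef' => {si' cb' ll lam'}.
have [_ no2] := si.
pose F (i : 'I_2) := if i == ord0 then f else f'.
have /boolp.existsNP[c] : ~ lin_indep len F.
  move=> li; apply: no2; exists F; split=> // i; exists lam; split=> //.
  by rewrite /F; case: ifP.
move=> /boolp.not_implyP[hc /boolp.existsNP[i /eqP ci]].
have h e x : 0 <= x <= len e -> c ord0 * f e x + c (lift ord0 ord0) * f' e x = 0.
  by move=> hx; rewrite -[RHS](hc e x hx) !big_ord_recl big_ord0 addr0.
set a := c ord0 in h; set b := c (lift ord0 ord0) in h.
have ab : (a != 0) || (b != 0).
  have [i0|i1] : i = ord0 \/ i = lift ord0 ord0.
    by case: i {ci} => [[|[|//]] hi]; [left|right]; apply/val_inj.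
    by rewrite /a -i0 ci.
  by rewrite /b -i1 ci orbT.
have ab0 (e : E) : a != 0 /\ b != 0.
  have [f0 _] := fn e; have [f0' _] := fn' e.
  have := h e 0; rewrite lexx (ltW (lpos e)) => /(_ isT) h0.
  case/orP: ab => n0; split=> //; apply: contraTneq n0 => z; rewrite negbK.
    move/eqP: h0; rewrite z mul0r addr0 mulf_eq0 (negbTE f0) orbF //.
  move/eqP: h0; rewrite z mul0r add0r mulf_eq0 (negbTE f0') orbF //.
have dz e x : 0 < x < len e -> a * derive1 (f e) x + b * derive1 (f' e) x = 0.
  have d1 : der (f e) (derive1 (f e)) by apply: (ode_der1 (lam := lam)) => y; case: ef => /(_ e y).
  have d2 : der (f' e) (derive1 (f' e)) by apply: (ode_der1 (lam := lam)) => y; case: ef' => /(_ e y).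
  apply: (der_zero (lpos e) (derD (derZ a d1) (derZ b d2))) => y /andP[y0 y1].
  by apply: h; rewrite !ltW.
have eqm : s =i s'.
  move=> [e x]; have [an bn] := ab0 e; apply/idP/idP.
    move/ms => [/= hx d0]; apply/ms'; split=> //=.
    by move/eqP: (dz e x hx); rewrite d0 mulr0 add0r mulf_eq0 (negbTE bn) => /eqP.
  move/ms' => [/= hx d0]; apply/ms; split=> //=.
  by move/eqP: (dz e x hx); rewrite d0 mulr0 addr0 mulf_eq0 (negbTE an) => /eqP.
by rewrite -ss -ss' (perm_size (uniq_perm us us' eqm)).
Qed.

Lemma omega_inG n j : omega_is src tgt len n j -> inG src tgt len n.
Proof. by move=> [f [k [h _]]]; exists f. Qed.

Hypothesis indep : rat_indep len.

(** A resonant d is an integer multiple of pi divided by a nonzero integer combination of the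
    lengths; such numbers are countable, while an interval has positive measure. *)
Lemma nonresonant_small (d0 : R) : 0 < d0 -> exists d, [/\ 0 < d, d < d0 & nonresonant (fun e => d * len e / pi)].
Proof.
move=> d00; apply: contrapT => no; have p0 := pi_gt0 R.
pose g (x : {ffun E -> int} * int) : R := (x.2)%:~R * pi / (\sum_e (x.1 e)%:~R * len e).
have sub : [set` `]0, d0[%R] `<=` [set g x | x in setT].
  move=> d /=; rewrite in_itv /= => /andP[dp dd].
  have : ~ nonresonant (fun e => d * len e / pi) by move=> h; apply: no; exists d.
  move=> /boolp.existsNP[n /boolp.existsNP[z /boolp.not_implyP[hz /boolp.existsNP[e ne]]]].
  exists ([ffun e => n e], z) => //; rewrite /g /=; under eq_bigr do rewrite ffunE.
  set s := \sum_e _.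
  have s0 : s != 0.
    apply/eqP => s0; apply: ne; have := indep (q := fun e => (n e)%:Q).
    under eq_bigr do rewrite ratr_int.
    by move=> /(_ s0 e) /eqP; rewrite intr_eq0 => /eqP.
  have -> : z%:~R = d * s / pi.
    by rewrite -hz /s mulr_sumr mulr_suml; apply: eq_bigr => e' _; ring.
  by rewrite divfK ?gt_eqF // mulfK.
have cnt : countable [set` `]0, d0[%R].
  apply: sub_countable (subset_card_le sub) _.
  apply: sub_countable (card_image_le _ _) _; exact: countableP.
have := countable_lebesgue_measure0 cnt; rewrite lebesgue_measure_itv /= lte_fin d00 => /eqP.
by rewrite -EFinB eqe subr0 gt_eqF.
Qed.

End Uniqueness.

(** * The number of patterns with a given number of negative signs *)

Section Patterns.
Variables (R : realType) (V E : finType) (len : E -> R).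

Lemma has_pattern_inj (t : btree V E) (p p' : patternT t) k : has_pattern len p k -> has_pattern len p' k -> p = p'.
Proof.
elim: t p p' => [e v|e v a IHa b IHb]; first by do 2!case.
move=> [s [pa pb]] [s' [pa' pb']] [_ _ [_ _ _ /= <-] ga gb] [_ _ [_ _ _ /= <-] ga' gb'].
by rewrite (IHa _ _ ga ga') (IHb _ _ gb gb').
Qed.

(** The generating function of [nb] is multiplicative: each inner vertex contributes a factor X +
    1. *)
Lemma pat_poly (t : btree V E) : \sum_(p : patternT t) 'X^(nb p) = ('X + 1) ^+ inner_count t :> {poly int}.
Proof.
elim: t => [e v|e v a IHa b IHb] /=; first by rewrite (big_pred1 tt) // => -[].
rewrite exprS exprD -IHa -IHb.
rewrite (_ : 'X + 1 = \sum_(s : bool) 'X^s); last by rewrite big_bool /= expr1 expr0.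
rewrite [X in _ = _ * X]big_distrlr /= pair_big /= big_distrlr /= pair_big /=.
by apply: eq_bigr => -[s [pa pb]] _ /=; rewrite !exprD.
Qed.

Lemma pat_count (t : btree V E) b : #|[pred p : patternT t | nb p == b]| = 'C(inner_count t, b).
Proof.
have := congr1 (fun q : {poly int} => q`_b) (pat_poly t).
rewrite exprDn coef_sum coef_sum.
have -> : \sum_(p : patternT t) ('X^(nb p) : {poly int})`_b = (#|[pred p : patternT t | nb p == b]|)%:Z.
  have -> : #|[pred p : patternT t | nb p == b]| = (\sum_(p : patternT t) (nb p == b))%N.
    by rewrite -sum1_card big_mkcond /=; apply: eq_bigr => p _; rewrite inE; case: (nb p == b).
  rewrite (big_morph Posz PoszD (erefl _)); apply: eq_bigr => p _.
  by rewrite coefXn eq_sym; case: (nb p == b).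
have -> : \sum_(i < (inner_count t).+1) (('X^(inner_count t - i) * 1 ^+ i) *+ 'C(inner_count t, i) : {poly int})`_b = ('C(inner_count t, b))%:Z.
  under eq_bigr do rewrite expr1n mulr1 coefMn coefXn.
  have [bm|bm] := leqP b (inner_count t).
    have bm' : (inner_count t - b < (inner_count t).+1)%N by rewrite ltnS leq_subr.
    rewrite (bigD1 (Ordinal bm')) //= subKn // eqxx big1 ?addr0 => [|i].
      by rewrite bin_sub // natz.
    rewrite -val_eqE /= => ne; case: eqP => [h|]; last by rewrite mul0rn.
    by case/eqP: ne; have := ltn_ord i; rewrite h; lia.
  rewrite bin_small // big1 // => i _; case: eqP => [h|]; last by rewrite mul0rn.
  by move: bm; rewrite h; lia.
by case.
Qed.

End Patterns.

(** * From means per step to densities of labels *)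

Section Density.
Variable R : realType.

Definition lower_density (F : nat -> R) (c : R) := forall e : R, 0 < e ->
  exists N0 : nat, forall N : nat, (N0 <= N)%N -> (c - e) * N.+1%:R <= F N.

Lemma lower_density_closed F c : (forall e : R, 0 < e -> lower_density F (c - e)) -> lower_density F c.
Proof.
move=> h e e0; have e2 : 0 < e / 2 by rewrite divr_gt0.
have [N0 h0] := h _ e2 _ e2; exists N0 => N /h0; apply: le_trans.
by rewrite ler_wpM2r //; lra.
Qed.

Lemma bernoulli (x : R) n : 0 <= x <= 1 -> 1 - n%:R * x <= (1 - x) ^+ n.
Proof.
move=> /andP[x0 x1]; elim: n => [|n IH]; first by rewrite mul0r subr0 expr0.
rewrite exprS; have y0 : 0 <= 1 - x by lra.
apply: le_trans (ler_wpM2l y0 IH); rewrite -natr1.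
have : 0 <= n%:R * (x * x) by rewrite mulr_ge0 // mulr_ge0.
lra.
Qed.

(** The first J steps produce labels up to J s + K, so a mean c per step becomes a density c / s per
    label. *)
Lemma lower_density_sample (F : nat -> R) (G : nat -> R) (c s K : R) : 0 < s -> 0 <= K -> lower_mean G c ->
  (forall N, 0 <= F N) ->
  (forall N J : nat, J%:R * s + K <= N%:R -> \sum_(0 <= j < J) G j <= F N) ->
  lower_density F (c / s).
Proof.
move=> s0 K0 hG F0 hF e e0; have es : 0 < e * s / 2 by rewrite divr_gt0 // mulr_gt0.
have [J0 hJ] := hG _ es; set c' := c - e * s / 2 in hJ.
have [c'0|c'0] := leP c' 0.
  exists 0%N => N _; apply: le_trans (F0 N); rewrite mulr_le0_ge0 //.
  rewrite subr_le0 ler_pdivrMr //; move: c'0 es; rewrite /c'; clear; lra.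
(* [D] ensures at least J0 steps; [T] absorbs K, the rounding of J and the passage from N to N +
   1. *)
pose D := J0%:R * s + K + s; pose T := c' / s * (K + s + 1).
have D0 : 0 <= D by rewrite !addr_ge0 ?mulr_ge0 // ltW.
have T0 : 0 <= T by rewrite mulr_ge0 ?divr_ge0 ?(ltW s0) ?(ltW c'0) // !addr_ge0 // ltW.
exists (Num.bound D + Num.bound (T * 2 / e))%N => N hN.
have hD : D <= N%:R.
  apply: ltW; apply: lt_le_trans (archi_boundP D0) _; rewrite ler_nat; lia.
have hT : T * 2 / e <= N%:R.
  apply: ltW; apply: lt_le_trans (archi_boundP _) _; last by rewrite ler_nat; lia.
  by rewrite divr_ge0 ?(ltW e0) // mulr_ge0.
pose Y := (N%:R - K) / s.
have Y0 : 0 <= Y.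
  rewrite divr_ge0 ?(ltW s0) // subr_ge0; apply: le_trans hD; rewrite /D.
  have : 0 <= J0%:R * s by rewrite mulr_ge0 // ltW.
  by move: s0; clear; lra.
pose J := Num.truncn Y.
have /andP[J1 J2] : J%:R <= Y < J.+1%:R by apply: truncn_itv.
have JN : J%:R * s + K <= N%:R by rewrite -lerBrDr -ler_pdivlMr.
have pieceT : (J0 <= J)%N.
  rewrite -ltnS -(ltr_nat R); apply: le_lt_trans J2.
  by rewrite ler_pdivlMr // lerBrDr; apply: le_trans hD; rewrite /D lerDl ltW.
apply: le_trans (le_trans (hJ J pieceT) (hF N J JN)).
have h1 : c' * (Y - 1) <= c' * J%:R by rewrite ler_pM2l //; move: J2; rewrite -natr1; clear; lra.
apply: le_trans h1.
have -> : c' * (Y - 1) = (c / s - e / 2) * N.+1%:R - T.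
  by rewrite /Y /T /c' -natr1; field; rewrite gt_eqF.
rewrite ler_pdivrMr // in hT.
have : T <= e / 2 * N.+1%:R by rewrite -[N.+1%:R]natr1; move: hT e0; clear; lra.
by clear; lra.
Qed.

End Density.

(** * Lower densities of the values of omega *)

Section Counting.
Variables (R : realType) (V E : finType) (src tgt : E -> V) (len : E -> R).
Hypothesis lpos : forall e, 0 < len e.
Hypothesis conn : connected_graph src tgt.
Hypothesis tree : (#|E|.+1 = #|V|)%N.
Hypothesis cubic : forall v, deg src tgt v = 1%N \/ deg src tgt v = 3%N.
Hypothesis indep : rat_indep len.
Local Notation pi := (@pi R).
Variables (t : btree V E) (r : V).
Hypothesis wt : well_rooted src tgt t r.
Hypothesis ut : uniq (edges t).
Hypothesis uv : uniq (r :: verts t).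
Hypothesis alle : forall e, e \in edges t.
Hypothesis allv : forall v, v \in r :: verts t.
Hypothesis degr : deg src tgt r = 1%N.
Hypothesis onlyr : forall e, touches src tgt e r -> e = rt t.

(** Hits are mapped injectively to labels: a label determines the eigenvalue and hence k, and k
    determines both the interval j and the pattern. *)
Lemma hits_inject (b : nat) (d : R) (N J : nat) : 0 < d ->
  J%:R * (d * total_length len t / pi) + #|E|%:R <= N%:R :> R ->
  \sum_(0 <= j < J) \sum_(p : patternT t | nb p == b) (`[< hit len p d j >])%:R <=
  (cnt (fun n => omega_is src tgt len n (- 1 - b%:Z)) N)%:R :> R.
Proof.
move=> d0 hN; have p0 := pi_gt0 R.
pose A := [set x : 'I_J * patternT t | (nb x.2 == b) && `[< hit len x.2 d x.1 >]]%SET.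
have -> : \sum_(0 <= j < J) \sum_(p : patternT t | nb p == b) (`[< hit len p d j >])%:R = (#|A|%:R : R).
  rewrite big_mkord -sum1_card natr_sum pair_big_dep /= [LHS]big_mkcond [RHS]big_mkcond.
  apply: eq_bigr => x _; rewrite inE; case: (nb x.2 == b) => //=.
  by case: asboolP.
pose P (x : 'I_J * patternT t) (kn : R * nat) := [/\ (x.1 : nat)%:R * d < kn.1, kn.1 <= (x.1 : nat)%:R * d + d,
   has_pattern len x.2 kn.1, omega_is src tgt len kn.2 (- 1 - b%:Z) &
   [/\ count_below src tgt len (kn.1 ^+ 2) kn.2, simple_eig src tgt len (kn.1 ^+ 2) & (kn.2 <= N)%N]].
have /boolp.choice[g hg] : forall x, exists kn, x \in A -> P x kn.
  move=> x; case: (boolP (x \in A)) => [|_]; last by exists (0, 0%N).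
  rewrite inE => /andP[/eqP nx /asboolP[k [k1 k2 sk gk]]].
  have k0 : 0 < k by apply: le_lt_trans k1; rewrite mulr_ge0 // ltW.
  have [n [om cb si bd]] := hit_eigen lpos conn tree cubic wt ut uv alle allv degr onlyr k0 gk sk.
  exists (k, n) => _; split=> //=; first by rewrite -nx.
  split=> //; rewrite -(ler_nat R); apply: le_trans bd (le_trans _ hN).
  rewrite lerD2r mulrA ler_wpM2r ?invr_ge0 ?(ltW p0) // mulrA ler_wpM2r ?total_length_ge0 //.
  apply: le_trans k2 _.
  by rewrite -[X in _ + X]mul1r -mulrDl ler_wpM2r ?(ltW d0) // natr1 ler_nat.
have inj : {in A &, injective (fun x => inord (g x).2 : 'I_N.+1)}.
  move=> x y xA yA; have [x1 x2 x3 _ [x4 x5 x6]] := hg x xA; have [y1 y2 y3 _ [y4 y5 y6]] := hg y yA.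
  move=> /(congr1 val); rewrite /= !inordK // => inner_count.
  have kk : (g x).1 = (g y).1.
    have := count_below_inj lpos x4 x5; rewrite inner_count => /(_ _ y4 y5) /eqP.
    rewrite eqrXn2 // => [/eqP //||]; first by apply/ltW; apply: le_lt_trans x1; rewrite mulr_ge0 // ltW.
    by apply/ltW; apply: le_lt_trans y1; rewrite mulr_ge0 // ltW.
  have le (u v : nat) (k : R) : u%:R * d < k -> k <= v%:R * d + d -> (u <= v)%N.
    move=> h1 h2; rewrite -ltnS -(ltr_nat R) -(ltr_pM2r d0) -natr1 mulrDl mul1r.
    exact: lt_le_trans h1 h2.
  rewrite [x]surjective_pairing [y]surjective_pairing; congr (_, _).
    apply/val_inj/eqP; rewrite eqn_leq; rewrite kk in x1 x2.
    by rewrite (le _ _ _ x1 y2) (le _ _ _ y1 x2).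
  by apply: has_pattern_inj y3; rewrite -kk.
rewrite ler_nat -(card_in_imset inj) /cnt.
apply: (@leq_trans #|[set i : 'I_N.+1 | `[< omega_is src tgt len i (- 1 - b%:Z) >]]%SET|).
  apply: subset_leq_card; apply/fintype.subsetP => i /imsetP[x xA ->].
  have [_ _ _ x4 [_ _ x6]] := hg x xA; rewrite inE inordK //; exact/asboolP.
rewrite -sum1_card big_mkcond /=; apply: leq_sum => i _; rewrite inE.
by case: (`[< _ >]).
Qed.

Lemma omega_lower (b : nat) :
  lower_density (fun N => (cnt (fun n => omega_is src tgt len n (- 1 - b%:Z)) N)%:R)
       ('C(inner_count t, b)%:R / 2 ^+ inner_count t : R).
Proof.
apply: lower_density_closed => e e0; have p0 := pi_gt0 R.
set Cb : R := 'C(inner_count t, b)%:R; set m := inner_count t.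
have Cb0 : 0 <= Cb by [].
(* By Bernoulli's inequality (1 - eta) ^ m falls short of 1 by at most m eta, so eta is chosen with
   Cb m eta at most e. *)
pose eta := Num.min (1 / 2) (e / (Cb * m%:R + 1)).
have D0 : 0 < Cb * m%:R + 1 by rewrite ltr_wpDl // mulr_ge0.
have eta0 : 0 < eta by rewrite lt_min; apply/andP; split; apply: divr_gt0.
have eta1 : eta <= 1 / 2 by rewrite ge_min lexx.
have eta2 : eta * (Cb * m%:R + 1) <= e by rewrite -ler_pdivlMr // ge_min lexx orbT.
have eta01 : 0 < eta < 1 by rewrite eta0; lra.
have [d0 d00 hd] := hit_freq lpos eta01 ut.
have [d [dp dd nr]] := nonresonant_small indep d00.
have hp := hd d dp dd nr.
have L0 : 0 < total_length len t.
  by rewrite (total_length_sum) -(edges_sum ut alle) (bigD1 (rt t)) //= ltr_pwDl // sumr_ge0 // => e' _; apply: ltW.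
have s0 : 0 < d * total_length len t / pi by rewrite divr_gt0 // mulr_gt0.
have := @lower_mean_sum R (patternT t) (index_enum (patternT t)) (fun p => nb p == b) _ _ (fun p _ => hp p).
rewrite sumr_const pat_count -/m => hG.
have := lower_density_sample s0 (ler0n R #|E|) hG (fun N => ler0n R (cnt _ N)) (fun N J => @hits_inject b d N J dp).
(* Hits per step divided by labels per step: d and the total length cancel. *)
have -> : (d / pi * (((1 - eta) / 2) ^+ m * total_length len t)) *+ 'C(m, b) / (d * total_length len t / pi) =
   Cb / 2 ^+ m * (1 - eta) ^+ m.
  rewrite -mulr_natr -/Cb expr_div_n.
  move: (gt_eqF p0) (gt_eqF L0) (gt_eqF dp); generalize pi (total_length len t) => q l q0 l0 dd0.
  by field; rewrite q0 l0 dd0 expf_neq0.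
move=> h e' e'0; have [N0 h0] := h e' e'0; exists N0 => N /h0; apply: le_trans.
rewrite ler_wpM2r // lerD2r.
have ber : 1 - m%:R * eta <= (1 - eta) ^+ m by apply: bernoulli; rewrite (ltW eta0); lra.
have c2 : 0 <= Cb / 2 ^+ m by rewrite divr_ge0 // exprn_ge0.
have c3 : Cb / 2 ^+ m <= Cb by rewrite ler_pdivrMr ?exprn_gt0 // ler_peMr // exprn_ege1 // ler1n.
apply: le_trans (ler_wpM2l c2 ber).
have h4 : Cb / 2 ^+ m * (m%:R * eta) <= Cb * (m%:R * eta) by rewrite ler_wpM2r // mulr_ge0 // ltW.
have h5 : Cb * (m%:R * eta) <= e.
  apply: le_trans eta2; rewrite mulrDr mulr1 [eta * _]mulrC -mulrA lerDl; exact: ltW.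
by rewrite mulrBr mulr1 lerD2l lerN2; exact: le_trans h4 h5.
Qed.

End Counting.

(** * From lower densities with sum 1 to limits *)

Section Limit.
Variable R : realType.

Lemma cnt_le (P : nat -> Prop) N : (cnt P N <= N.+1)%N.
Proof.
rewrite /cnt -[X in (_ <= X)%N](card_ord N.+1) -sum1_card; apply: leq_sum => i _.
by case: (`[< _ >]).
Qed.

Lemma cnt_disjoint (m : nat) (A : nat -> nat -> Prop) (G : nat -> Prop) N :
  (forall b b' n, A b n -> A b' n -> b = b') -> (forall b n, A b n -> G n) ->
  (\sum_(b < m.+1) cnt (A b) N <= cnt G N)%N.
Proof.
move=> dj sub; rewrite /cnt exchange_big /=; apply: leq_sum => i _.
have [[b Ab]|no] := pselect (exists b : 'I_m.+1, A b i).
  rewrite (bigD1 b) //= big1 => [|b' bb].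
    by rewrite addn0 asboolT // asboolT //; exact: sub Ab.
  by rewrite asboolF // => Ab'; case/eqP: bb; apply/val_inj/(dj _ _ _ Ab' Ab).
by rewrite big1 // => b _; rewrite asboolF // => Ab; apply: no; exists b.
Qed.

(* The lower densities have sum 1, so none of the sets can be any denser. *)
Lemma density_limit (m : nat) (A : nat -> nat -> Prop) (G : nat -> Prop) (c : nat -> R) :
  (forall b b' n, A b n -> A b' n -> b = b') -> (forall b n, A b n -> G n) ->
  (forall b, lower_density (fun N => (cnt (A b) N)%:R) (c b)) -> \sum_(b < m.+1) c b = 1 ->
  forall b, (b <= m)%N -> dens_ratio R (A b) G @ \oo --> c b.
Proof.
move=> dj sub lo sc b bm; apply/cvgrPdist_le => e e0.
(* The first bound makes the m + 1 errors add up to at most e; the second keeps the share [g] of the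
   labels in G positive. *)
pose e1 : R := Num.min (e / m.+1%:R) (1 / (2 * m.+1%:R)).
have m0 : 0 < m.+1%:R :> R by [].
have e10 : 0 < e1 by rewrite lt_min; apply/andP; split; apply: divr_gt0 => //; apply: mulr_gt0.
have e1a : e1 * m.+1%:R <= e by rewrite -ler_pdivlMr // ge_min lexx.
have e1b : e1 * m.+1%:R <= 1 / 2.
  have : e1 <= 1 / (2 * m.+1%:R) by rewrite ge_min lexx orbT.
  by rewrite ler_pdivlMr ?mulr_gt0 // mulrCA => h; lra.
have /boolp.choice[N0 hN0] : forall b, exists N0, forall N, (N0 <= N)%N ->
    (c b - e1) * N.+1%:R <= (cnt (A b) N)%:R by move=> b'; apply: lo.
exists (\max_(b < m.+1) N0 b)%N => // N /= hN.
have low (b' : 'I_m.+1) : (c b' - e1) <= (cnt (A b') N)%:R / N.+1%:R.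
  rewrite ler_pdivlMr //; apply: hN0; apply: leq_trans hN.
  exact: (leq_bigmax (F := fun b : 'I_m.+1 => N0 b)).
pose x b' : R := (cnt (A b') N)%:R / N.+1%:R; pose g : R := (cnt G N)%:R / N.+1%:R.
have bm' : (b < m.+1)%N by [].
have xg : \sum_(b < m.+1) x b <= g.
  rewrite /x /g -mulr_suml ler_wpM2r ?invr_ge0 // -natr_sum ler_nat.
  exact: cnt_disjoint.
have g1 : g <= 1 by rewrite /g ler_pdivrMr // mul1r ler_nat cnt_le.
have split_x : \sum_(b < m.+1) x b = x b + \sum_(i < m.+1 | i != Ordinal bm') x i by rewrite (bigD1 (Ordinal bm')).
have split_c : \sum_(b < m.+1) c b = c b + \sum_(i < m.+1 | i != Ordinal bm') c i by rewrite (bigD1 (Ordinal bm')).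
have rest : \sum_(i < m.+1 | i != Ordinal bm') c i - e1 * m%:R <= \sum_(i < m.+1 | i != Ordinal bm') x i.
  have -> : e1 * m%:R = \sum_(i < m.+1 | i != Ordinal bm') e1.
    rewrite mulr_natr sumr_const; congr (_ *+ _).
    transitivity #|predC1 (Ordinal bm')|; first by rewrite cardC1 card_ord.
    by apply: eq_card.
  by rewrite -sumrB; apply: ler_sum => i _; apply: low.
have lb := low (Ordinal bm'); rewrite -/(x b) /= in lb.
have x0 : 0 <= x b by rewrite divr_ge0.
rewrite sc in split_c; rewrite split_x in xg.
have mm : e1 * m.+1%:R = e1 * m%:R + e1 by rewrite -natr1 mulrDr mulr1.
rewrite mm in e1a e1b.
have em : 0 <= e1 * m%:R by rewrite mulr_ge0 // ltW.
have g0 : 0 < g by lra.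
have -> : dens_ratio R (A b) G N = x b / g.
  by rewrite /dens_ratio /x /g invfM invrK mulrACA mulVf ?mulr1 // pnatr_eq0.
have r1 : x b <= x b / g by rewrite ler_pdivlMr // ler_piMr.
(* The share g - x b, which contains the other sets, can only grow when divided by g, as g is at
   most 1. *)
have r2 : g - x b <= 1 - x b / g.
  have -> : 1 - x b / g = (g - x b) / g by rewrite mulrBl divff // gt_eqF.
  rewrite ler_pdivlMr // ler_piMr //.
  have : 0 <= \sum_(i < m.+1 | i != Ordinal bm') x i by apply: sumr_ge0 => i _; rewrite divr_ge0.
  by move: xg; clear; lra.
rewrite ler_norml; apply/andP; split.
  by move: r2 xg rest split_c e1a e10; clear; lra.
by move: r1 lb e1a em; clear; lra.
Qed.

Lemma binom_sum (m : nat) : \sum_(b < m.+1) ('C(m, b)%:R / 2 ^+ m : R) = 1.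
Proof.
rewrite -mulr_suml -natr_sum -(eq_bigr _ (fun i _ => muln1 _)).
have -> : (\sum_(i < m.+1) 'C(m, i) * 1)%N = (2 ^ m)%N.
  by rewrite -[2%N]/(1 + 1)%N expnDn; apply: eq_bigr => i _; rewrite !exp1n !muln1.
by rewrite natrX divff // expf_neq0.
Qed.

End Limit.

Theorem theorem2p6 (R : realType) (V E : finType) (src tgt : E -> V)
    (len : E -> R) :
  (forall e, 0 < len e) ->
  is_tree src tgt ->
  (forall v, deg src tgt v = 1%N \/ deg src tgt v = 3%N) ->
  rat_indep len ->
  forall j : int,
    - (#|bdry src tgt|%:Z) + 1 <= j <= -1 ->
    dens_ratio R (fun n => omega_is src tgt len n j) (inG src tgt len)
      @ \oo -->
    (('C(#|bdry src tgt| - 2,  absz (- j - 1)%R)%N)%:R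
       / 2 ^+ (#|bdry src tgt| - 2)%N : R).
Proof.
move=> lpos [conn tree] cubic indep j /andP[j1 j2].
have [t [r [[wt ut uv alle allv] [degr onlyr bd]]]] := rooted R conn tree cubic.
rewrite bd addnK in j1 *.
pose A b n := omega_is src tgt len n (- 1 - b%:Z).
(* Here b = - j - 1 counts the inner vertices with negative sign, and the range of j corresponds
   exactly to b between 0 and m. *)
have jb : j = - 1 - (absz (- j - 1)%R)%:Z by lia.
have bm : (absz (- j - 1)%R <= inner_count t)%N by lia.
rewrite [X in dens_ratio R (fun n => omega_is _ _ _ n X)]jb.
apply: (@density_limit R (inner_count t) A _ (fun b => 'C(inner_count t, b)%:R / 2 ^+ inner_count t)) => //.
- by move=> b b' n h h'; have := omega_unique lpos h h'; lia.
- by move=> b n; exact: omega_inG.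
- by move=> b; apply: (omega_lower lpos conn tree cubic indep wt).
- exact: binom_sum.
Qed.
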